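(* Let $1<q\le p<\infty$, $1\le r\le\infty$, $s\in\mathbb{R}$, and let $f\in\mathcal{E}^s_{pqr}$. Then $f\in\overset{\diamond}{\mathcal{E}}{}^s_{pqr}$ if and only if $\sum_{j=0}^N\varphi_j(D)f$ converges to $f$ in $\mathcal{E}^s_{pqr}$ as $N\to\infty$.
   Context: All function spaces are on $\mathbb{R}^n$; $\mathcal{S}$ and $\mathcal{S}'$ are the Schwartz space and the space of tempered distributions on $\mathbb{R}^n$; $B(x,R)$ is the ball of center $x$ and radius $R$, and $B(R)=B(0,R)$; $\chi_E$ is the indicator function of $E$. Morrey space: for $1<q\le p<\infty$ and $f\in L^q_{\rm loc}(\mathbb{R}^n)$, $\|f\|_{\mathcal{M}^p_q}:=\sup_{x\in\mathbb{R}^n,\,R>0}|B(x,R)|^{\frac1p-\frac1q}\left(\int_{B(x,R)}|f(y)|^q\,dy\right)^{\frac1q}$, and $\mathcal{M}^p_q$ is the set of all such $f$ with finite norm. Littlewood-Paley decomposition: fix $\varphi\in\mathcal{S}$ with $\chi_{B(2)}\le\varphi\le\chi_{B(3)}$, and set $\varphi_0:=\varphi$ and $\varphi_j:=\varphi(2^{-j}\cdot)-\varphi(2^{-j+1}\cdot)$ for $j\in\mathbb{N}=\{1,2,\dots\}$, so that $\sum_{j=0}^\infty\varphi_j=1$. Put $\varphi_j(D)g:=\mathcal{F}^{-1}(\varphi_j\mathcal{F}g)$, where $\mathcal{F}g(\xi)=(2\pi)^{-n/2}\int_{\mathbb{R}^n}g(x)e^{-ix\cdot\xi}\,dx$ and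 $\mathcal{F}^{-1}$ is its inverse (extended to $\mathcal{S}'$). Triebel-Lizorkin-Morrey space: for $1<q\le p<\infty$, $1\le r\le\infty$, $s\in\mathbb{R}$, $\mathcal{E}^s_{pqr}$ is the set of $f\in\mathcal{S}'$ with finite norm $\|f\|_{\mathcal{E}^s_{pqr}}:=\|\varphi_0(D)f\|_{\mathcal{M}^p_q}+\left\|\left(\sum_{j=1}^\infty 2^{jrs}|\varphi_j(D)f|^r\right)^{1/r}\right\|_{\mathcal{M}^p_q}$ (with the usual supremum modification $\sup_{j\ge1}2^{js}|\varphi_j(D)f|$ when $r=\infty$). The space does not depend on the choice of $\varphi$. Diamond space: $\overset{\diamond}{\mathcal{E}}{}^s_{pqr}$ is the closure in $\mathcal{E}^s_{pqr}$ of the set of all smooth functions $f$ such that $\partial^\alpha f\in\mathcal{E}^s_{pqr}$ for all multi-indices $\alpha$. *)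

(* Defs.v *)
From HB Require Import structures.
From mathcomp Require Import all_boot all_order all_algebra complex.
From mathcomp Require Import all_classical all_reals all_analysis.

Set Implicit Arguments.
Unset Strict Implicit.
Unset Printing Implicit Defensive.
Import Order.TTheory GRing.Theory Num.Theory numFieldNormedType.Exports.
Local Open Scope classical_set_scope.
Local Open Scope ring_scope.

Definition rV_display : measure_display -> measure_display.
Proof. exact. Qed.

Section measurable_rV.
Context {d} {T : measurableType d}.
Variable n : nat.

Let coord : 'I_n -> 'rV[T]_n -> T := fun i x => x 0 i.

Let rV_set0 : g_sigma_preimage coord set0.
Proof. exact: sigma_algebra0. Qed.

Let rV_setC A : g_sigma_preimage coord A -> g_sigma_preimage coord (~` A).
Proof. exact: sigma_algebraC. Qed.

Let rV_bigcup (F : _^nat) : (forall i, g_sigma_preimage coord (F i)) ->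
  g_sigma_preimage coord (\bigcup_i (F i)).
Proof. exact: sigma_algebra_bigcup. Qed.

(* The product sigma-algebra, generated by the coordinate maps; it is the
   Borel sigma-algebra when T is the real line. *)
HB.instance Definition _ := @isMeasurable.Build (rV_display d)
  'rV[T]_n (g_sigma_preimage coord) rV_set0 rV_setC rV_bigcup.

Lemma measurable_coord (i : 'I_n) :
  measurable_fun [set: 'rV[T]_n] (fun x : 'rV[T]_n => x 0 i).
Proof.
move=> _ Y mY; rewrite setTI; apply: sub_sigma_algebra => /=.
rewrite -bigcup_seq/=; exists i => /=; first by rewrite mem_index_enum.
by exists Y => //; rewrite setTI.
Qed.

End measurable_rV.

Lemma measurable_fun_coordP d1 d2 (T1 : measurableType d1)
    (T2 : measurableType d2) n (f : T1 -> 'rV[T2]_n) :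
  measurable_fun [set: T1] f <->
  forall i, measurable_fun [set: T1] (fun x => f x 0 i).
Proof.
split=> [mf i|mf].
  by apply: (@measurableT_comp _ _ _ _ _ _ (fun x : 'rV[T2]_n => x 0 i));
    [exact: measurable_coord|exact: mf].
suff : g_sigma_preimage (fun i x => f x 0 i) `<=` measurable.
  rewrite (g_sigma_preimage_comp (fun i (x : 'rV[T2]_n) => x 0 i)) => H.
  by move=> _ A mA; apply: H; exists A.
apply: smallest_sub; first exact: sigma_algebra_measurable.
rewrite -bigcup_seq => A /= [i _ [B mB <-]].
exact: mf.
Qed.

Section lebesgue_rV.
Context {R : realType}.

Definition cons_rV n (z : measurableTypeR R * 'rV[R]_n) : 'rV[R]_n.+1 :=
  \row_i oapp (z.2 0) z.1 (unlift ord0 i).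

Lemma measurable_cons_rV n : measurable_fun setT (@cons_rV n).
Proof.
apply/measurable_fun_coordP => i.
case: (unliftP ord0 i) => [j|] ->.
  rewrite (_ : (fun _ => _) =
    fun z : measurableTypeR R * 'rV[R]_n => z.2 0 j); last first.
    by apply/funext => z; rewrite mxE liftK.
  apply: (@measurableT_comp _ _ _ _ _ _ (fun x : 'rV[R]_n => x 0 j)) => //.
  exact: measurable_coord.
rewrite (_ : (fun _ => _) = @fst (measurableTypeR R) 'rV[R]_n)//.
by apply/funext => z; rewrite mxE unlift_none.
Qed.

Section step.
Variables (n : nat) (mu : {sigma_finite_measure set 'rV[R]_n -> \bar R}).

Definition lebesgue_rV_step : set 'rV[R]_n.+1 -> \bar R :=
  pushforward (@lebesgue_measure R \x mu)%E (@cons_rV n).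

Let step0 : lebesgue_rV_step set0 = 0%E.
Proof. by rewrite /lebesgue_rV_step /pushforward preimage_set0 measure0. Qed.

Let step_ge0 A : (0 <= lebesgue_rV_step A)%E.
Proof. exact: (measure_ge0 (@lebesgue_measure R \x mu)%E). Qed.

Let step_sigma_additive : semi_sigma_additive lebesgue_rV_step.
Proof.
move=> F mF tF mUF; rewrite /lebesgue_rV_step /pushforward preimage_bigcup.
have mc A : measurable A -> measurable (@cons_rV n @^-1` A).
  by move=> mA; rewrite -[X in measurable X]setTI; exact: measurable_cons_rV.
apply: measure_semi_sigma_additive.
- by move=> k; exact: mc.
- apply/trivIsetP => /= i j _ _ ij; rewrite -preimage_setI.
  by move/trivIsetP : tF => /(_ _ _ _ _ ij) ->//; rewrite preimage_set0.
- by rewrite -preimage_bigcup; exact: mc.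
Qed.

HB.instance Definition _ := isMeasure.Build _ _ _ lebesgue_rV_step
  step0 step_ge0 step_sigma_additive.

Let step_sigma_finite : sigma_finite setT lebesgue_rV_step.
Proof.
have /sigma_finiteP[F [TF ndF Foo]] := sigma_finiteT (@lebesgue_measure R).
have /sigma_finiteP[G [TG ndG Goo]] := sigma_finiteT mu.
pose tl (x : 'rV[R]_n.+1) : measurableTypeR R * 'rV[R]_n :=
  (x 0 ord0, \row_j x 0 (lift ord0 j)).
have consK : cancel (@cons_rV n) tl.
  move=> [a v]; congr pair; first by rewrite mxE unlift_none.
  by apply/rowP => j; rewrite !mxE liftK.
have mtl : measurable_fun setT tl.
  apply: measurable_fun_pair; first exact: measurable_coord.
  apply/measurable_fun_coordP => j.
  rewrite (_ : (fun _ => _) = fun x : 'rV[R]_n.+1 => x 0 (lift ord0 j)).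
    exact: measurable_coord.
  by apply/funext => x; rewrite mxE.
exists (fun k => tl @^-1` (F k `*` G k)) => [|k].
  rewrite -preimage_bigcup -[LHS](preimage_setT tl); congr preimage.
  rewrite -setXTT TF TG predeqE => -[x y]; split.
    move=> [/= [i _ Fix] [k _ Gky]]; exists (maxn i k) => //; split.
    - by move: x Fix; exact/subsetPset/ndF/leq_maxl.
    - by move: y Gky; exact/subsetPset/ndG/leq_maxr.
  by move=> [k _ []] /= Fx Gy; split; [exists k|exists k].
have [mF oF] := Foo k; have [mG oG] := Goo k; split.
  rewrite -[X in measurable X]setTI; apply: mtl => //.
  exact: measurableX.
rewrite /lebesgue_rV_step /pushforward -comp_preimage.
rewrite (_ : tl \o _ = id) ?preimage_id; last exact/funext/consK.
by rewrite product_measure1E// lte_mul_pinfty// ge0_fin_numE.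
Qed.

HB.instance Definition _ := Measure_isSigmaFinite.Build _ _ _ lebesgue_rV_step
  step_sigma_finite.
End step.

(* The n-fold product of the Lebesgue measure on R. *)
Fixpoint lebesgue_rV n : {sigma_finite_measure set 'rV[R]_n -> \bar R} :=
  match n with
  | 0 => \d_(0 : 'rV[R]_0)
  | m.+1 => lebesgue_rV_step (lebesgue_rV m)
  end.
End lebesgue_rV.

Section euclidean.
Context {R : realType} {n : nat}.
Implicit Types (x y : 'rV[R]_n) (f g psi : 'rV[R]_n -> R[i]).

Definition dotp x y : R := \sum_i x 0 i * y 0 i.

(* The library norm on 'rV[R]_n is the sup norm. *)
Definition enorm x : R := Num.sqrt (dotp x x).

Definition eball x (rho : R) : set 'rV[R]_n := [set y | enorm (y - x) < rho].

Definition cmod (z : R[i]) : R := Normc.normc z.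

Definition reC f : 'rV[R]_n -> R := fun x => complex.Re (f x).
Definition imC f : 'rV[R]_n -> R := fun x => complex.Im (f x).

Definition pd (i : 'I_n) f : 'rV[R]_n -> R[i] :=
  fun x => Complex ('D_(delta_mx 0 i) (reC f) x) ('D_(delta_mx 0 i) (imC f) x).

(* C^infinity: every iterated partial derivative, in any order, exists and is
   continuous. *)
Definition smooth f : Prop :=
  forall s : seq 'I_n, let g := foldr pd f s in
  [/\ continuous (reC g), continuous (imC g) &
      forall (i : 'I_n) x, derivable (reC g) x (delta_mx 0 i) /\
                           derivable (imC g) x (delta_mx 0 i)].

Definition multi_index := 'I_n -> nat.

Definition mdeg (alpha : multi_index) : nat := (\sum_i alpha i)%N.

Definition monomial (alpha : multi_index) x : R := \prod_i x 0 i ^+ alpha i.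

Definition mderiv (alpha : multi_index) f : 'rV[R]_n -> R[i] :=
  foldr (fun i g => iter (alpha i) (pd i) g) f (enum 'I_n).

Definition schwartz f : Prop :=
  smooth f /\
  forall alpha beta : multi_index, exists M : R,
    forall x, `|monomial alpha x| * cmod (mderiv beta f x) <= M.

Definition test_function psi : Prop :=
  smooth psi /\ compact (closure [set x | psi x != 0]).

Definition cintegral f : R[i] :=
  Complex (\int[lebesgue_rV n]_x reC f x) (\int[lebesgue_rV n]_x imC f x).

(* exp(i t) *)
Definition cis (t : R) : R[i] := Complex (cos t) (sin t).

Definition fourier_const : R[i] := ((2 * pi) `^ (- (n%:R / 2)))%:C%C.

Definition fourier f : 'rV[R]_n -> R[i] := fun xi =>
  fourier_const * cintegral (fun x => f x * cis (- dotp x xi)).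

Definition fourier_inv f : 'rV[R]_n -> R[i] := fun x =>
  fourier_const * cintegral (fun xi => f xi * cis (dotp x xi)).

End euclidean.

(* A tempered distribution is represented by a functional on all functions
   R^n -> C; only its values on Schwartz functions are ever used. *)
Notation functional R n := (('rV[R]_n -> R[i]) -> R[i]).

Section distributions.
Context {R : realType} {n : nat}.
Implicit Types (u v : functional R n) (g psi : 'rV[R]_n -> R[i]).

(* Linearity on the Schwartz space, and continuity at 0 for the topology given
   by the seminorms sup_x |x^alpha| |partial^beta psi(x)|. *)
Definition tempered u : Prop :=
  (forall (a : R[i]) psi1 psi2, schwartz psi1 -> schwartz psi2 ->
     u (fun x => a * psi1 x + psi2 x) = a * u psi1 + u psi2) /\
  (forall eps : R, 0 < eps -> exists (m : nat) (delta : R), 0 < delta /\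
     forall psi, schwartz psi ->
     (forall alpha beta : multi_index,
        (mdeg alpha <= m)%N -> (mdeg beta <= m)%N ->
        forall x, `|monomial alpha x| * cmod (mderiv beta psi x) <= delta) ->
     cmod (u psi) < eps).

Definition locally_integrableC g : Prop :=
  [/\ measurable_fun setT (reC g), measurable_fun setT (imC g) &
      forall K, compact K ->
        (\int[lebesgue_rV n]_(x in K) (cmod (g x))%:E < +oo)%E].

(* The distribution u is the function g. Testing on C_c^infinity, which is dense
   in the Schwartz space, also covers the tempered distributions given by a
   locally integrable function whose product with some Schwartz function is not
   integrable. *)
Definition represents g u : Prop :=
  locally_integrableC g /\
  forall psi, test_function psi -> u psi = cintegral (fun x => g x * psi x).

Definition dfourier u : functional R n := fun psi => u (fourier psi).
Definition dfourier_inv u : functional R n := fun psi => u (fourier_inv psi).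
Definition dmul (m : 'rV[R]_n -> R) u : functional R n :=
  fun psi => u (fun x => (m x)%:C%C * psi x).

(* m(D) u *)
Definition multiplier (m : 'rV[R]_n -> R) u : functional R n :=
  dfourier_inv (dmul m (dfourier u)).

End distributions.

Section triebel_lizorkin_morrey.
Context {R : realType} {n : nat}.
Variable phi : 'rV[R]_n -> R.
Implicit Types (p q s : R) (r : \bar R) (u v : functional R n).
Implicit Types (g : nat -> 'rV[R]_n -> R[i]).

Definition LP_generator : Prop :=
  schwartz (fun x => (phi x)%:C%C) /\
  forall x, \1_(eball 0 2) x <= phi x <= \1_(eball 0 3) x.

Definition phi_ (j : nat) : 'rV[R]_n -> R := fun x =>
  if j is k.+1 then phi (2 ^- k.+1 *: x) - phi (2 ^- k *: x) else phi x.

Definition morrey_norm p q (h : 'rV[R]_n -> \bar R) : \bar R :=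
  ereal_sup [set
    ((fine (lebesgue_rV n (eball c.1 c.2)) `^ (p^-1 - q^-1))%:E *
     (\int[lebesgue_rV n]_(y in eball c.1 c.2) (`|h y| `^ q)) `^ q^-1)%E
    | c in [set c : 'rV[R]_n * R | 0 < c.2]].

(* Values in [0, +oo]. The second branch is meant for r = +oo; -oo does not
   occur, as 1 <= r. *)
Definition lr_fun s r g (x : 'rV[R]_n) : \bar R :=
  if r is r0%:E then
    ((\sum_(1 <= j <oo)
       ((2 `^ (j%:R * r0 * s) * cmod (g j x) `^ r0)%R)%:E) `^ r0^-1)%E
  else
    ereal_sup [set (2 `^ (j%:R * s) * cmod (g j x))%:E
              | j in [set j : nat | (1 <= j)%N]].

(* The infimum ranges over the families g of functions g_j representing the
   distributions phi_j(D) u. Two such families agree almost everywhere, so they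
   all give the same value; the infimum is +oo if there is no such family. *)
Definition TLM_norm p q r s u : \bar R :=
  ereal_inf [set (morrey_norm p q (fun x => (cmod (g 0%N x))%:E) +
                  morrey_norm p q (lr_fun s r g))%E
            | g in [set g | forall j, represents (g j) (multiplier (phi_ j) u)]].

Definition TLM p q r s u : Prop :=
  tempered u /\ (TLM_norm p q r s u < +oo)%E.

Definition fun_in_TLM p q r s (f : 'rV[R]_n -> R[i]) : Prop :=
  exists2 w, TLM p q r s w & represents f w.

Definition TLM_smooth p q r s v : Prop :=
  TLM p q r s v /\
  exists f, [/\ smooth f, represents f v &
    forall alpha : multi_index, fun_in_TLM p q r s (mderiv alpha f)].

Definition TLM_diamond p q r s u : Prop :=
  TLM p q r s u /\
  forall eps : R, 0 < eps ->
    exists2 v, TLM_smooth p q r s v & (TLM_norm p q r s (u - v)%R < eps%:E)%E.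

End triebel_lizorkin_morrey.

(* Main.v *)
(** A tempered distribution [u] composed with the operator [Tm m], i.e. the
    Fourier multiplier [m(D)], is convolution with the Schwartz kernel [ker m];
    by Jensen's inequality this is bounded on Morrey spaces with constant
    [2 * kL1 m], and [kL1] is invariant under dilation of [m], so all the partial
    sums [Phi N = phi (2 ^- N *: _)] are uniformly bounded.

    If the partial sums converge, they are themselves admissible approximations:
    [Phi N (D) f] is the convolution of a Morrey function with a Schwartz kernel,
    hence smooth, and its derivatives have finitely many nonzero pieces.

    Conversely let [v] be smooth with [f - v] of norm less than [eps]. The pieces
    [j < N] of [f - S_N f] vanish, those with [j > N + 1] are the pieces of
    [f - v] plus those of [v], and the two remaining ones are controlled by the
    uniform bound. The pieces of [v] are recovered from those of its gradient by a
    multiplier of [L^1] norm [O(2 ^- j)], so their contribution is [O(2 ^- N)].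
    Quasi-triangle inequalities suffice throughout, as constants do not matter. *)
Require Import Defs.
From HB Require Import structures.
From mathcomp Require Import all_boot all_order all_algebra complex.
From mathcomp Require Import all_classical all_reals all_analysis.
From mathcomp Require Import measurable_realfun.
From mathcomp Require Import ring lra.
Set Implicit Arguments.
Unset Strict Implicit.
Unset Printing Implicit Defensive.
Import Order.TTheory GRing.Theory Num.Theory numFieldNormedType.Exports.
Local Open Scope classical_set_scope.
Local Open Scope ring_scope.

(** * Euclidean norm and Lebesgue measure *)

(** [represents] tests only on compactly supported functions, but moving [m(D)] to the other side of
    a pairing produces an operator that destroys compact support. A Morrey bound repairs this: it
    forces integrability against [wt x ^- n.+1], so such a function is itself a tempered
    distribution, and density extends the pairing to all Schwartz functions. [mrep] records the
    outcome, and the pieces are estimated through it. Multipliers are applied to one piece at a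
    time, so every convolution estimate is scalar and uniform in [r], the ends [1] and [+oo]
    included. In the tail, the pieces of [f - v] keep their [l^r] bound as a whole; all other terms
    are finitely many or carry the factor [2 ^- j], which pays for summing scalar bounds. That
    factor comes from writing [1] as the sum over [i] of [(- i x_i) (i x_i / |x| ^ 2)]. The second
    symbol is homogeneous of degree [-1]; on the dyadic shell of the j-th piece it is therefore
    [2 ^- j] times a dilate of one fixed symbol, cut off to have an integrable kernel. *)

Section norms.
Context {R : realType} {n : nat}.
Implicit Types x y : 'rV[R]_n.

Lemma ler_coord_norm x i : `|x 0 i| <= `|x|.
Proof.
rewrite [leRHS]mx_normrE.
by apply: (le_bigmax _ (fun ij : 'I_1 * 'I_n => `|x ij.1 ij.2|) (0, i)).
Qed.

Lemma norm_rV_le x (M : R) : 0 <= M -> (forall i, `|x 0 i| <= M) -> `|x| <= M.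
Proof.
move=> M0 h; rewrite [leLHS]mx_normrE; apply/bigmax_leP; split => //= -[i j] _ /=.
by rewrite (ord1 i).
Qed.

Lemma norm_rV_lt x (M : R) : 0 < M -> (forall i, `|x 0 i| < M) -> `|x| < M.
Proof.
move=> M0 h; rewrite [ltLHS]mx_normrE; apply/bigmax_ltP; split => //= -[i j] _ /=.
by rewrite (ord1 i).
Qed.

Lemma norm_le_enorm x : `|x| <= enorm x.
Proof.
apply: norm_rV_le => [|i]; first exact: sqrtr_ge0.
rewrite -sqrtr_sqr; apply: ler_wsqrtr.
rewrite /dotp (bigD1 i)//= -expr2 lerDl.
by apply: sumr_ge0 => j _; rewrite -expr2 sqr_ge0.
Qed.

(** Cruder than the square root of [n], but positive also for [n = 0], so that one may divide by
    it. *)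
Lemma enorm_le_norm x : enorm x <= n.+1%:R * `|x|.
Proof.
rewrite -[leRHS]ger0_norm ?mulr_ge0//.
rewrite -sqrtr_sqr; apply: ler_wsqrtr.
rewrite exprMn.
apply: (@le_trans _ _ (n%:R * `|x| ^+ 2)).
  rewrite (_ : _ * _ = \sum_(i < n) `|x| ^+ 2); last by rewrite sumr_const card_ord mulr_natl.
  apply: ler_sum => i _.
  rewrite -expr2 -real_normK ?num_real//.
  by rewrite lerXn2r ?nnegrE//; exact: ler_coord_norm.
rewrite ler_wpM2r// ?sqr_ge0//.
by rewrite -natrX ler_nat expnS expn1 (leq_trans (leqnSn n))// leq_pmulr.
Qed.

Lemma dotpC x y : dotp x y = dotp y x.
Proof. by apply: eq_bigr => i _; rewrite mulrC. Qed.

Lemma dotpZl a x y : dotp (a *: x) y = a * dotp x y.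
Proof. by rewrite /dotp mulr_sumr; apply: eq_bigr => i _; rewrite mxE mulrA. Qed.

Lemma dotpZr a x y : dotp x (a *: y) = a * dotp x y.
Proof. by rewrite dotpC dotpZl dotpC. Qed.

Lemma dotpDl x y z : dotp (x + y) z = dotp x z + dotp y z.
Proof. by rewrite /dotp -big_split; apply: eq_bigr => i _; rewrite mxE mulrDl. Qed.

Lemma dotpNl x y : dotp (- x) y = - dotp x y.
Proof. by rewrite -scaleN1r dotpZl mulN1r. Qed.

Lemma dotpNr x y : dotp x (- y) = - dotp x y.
Proof. by rewrite dotpC dotpNl dotpC. Qed.

End norms.

Section measurability.
Context {R : realType} {n : nat}.
Implicit Types U : set 'rV[R]_n.

Lemma measurable_ball_rV (c : 'rV[R]_n) (e : R) : 0 < e ->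
  measurable [set x : 'rV[R]_n | `|x - c| < e].
Proof.
move=> e0.
rewrite (_ : [set _ | _] = \bigcap_(i in [set: 'I_n]) [set x : 'rV[R]_n | `|x 0 i - c 0 i| < e]); last first.
  apply/seteqP; split => x /=.
    by move=> h i _ /=; apply: le_lt_trans h; rewrite (le_trans _ (ler_coord_norm _ i))// !mxE.
  by move=> h; apply: norm_rV_lt => // i; rewrite !mxE; exact: h.
apply: fin_bigcap_measurable => // i _.
have m : measurable_fun setT (fun x : 'rV[R]_n => `|x 0 i - c 0 i|).
  apply: measurableT_comp => //.
  apply: measurable_funB => //; exact: measurable_coord.
by rewrite -[X in measurable X]setTI; exact: (measurable_fun_ltr m (@measurable_cst _ _ _ _ _ e)).
Qed.

(** The sigma-algebra is generated by the coordinates, and a ball of the sup norm is a finite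
    intersection of coordinate conditions. An open set is the union of the balls inside it that have
    rational centre and radius [k.+1%:R^-1], a countable family. *)
Lemma open_measurable_rV U : open U -> measurable U.
Proof.
move=> oU.
pose B (z : 'rV[rat]_n * nat) := [set x : 'rV[R]_n | `|x - map_mx ratr z.1| < z.2.+1%:R^-1].
rewrite (_ : U = \bigcup_z (if `[< B z `<=` U >] then B z else set0)); last first.
  apply/seteqP; split => x; last first.
    by case=> z _; case: asboolP => // h; exact: h.
  move=> Ux.
  have /nbhs_ballP[e /= e0 eU] := open_nbhs_nbhs (conj oU Ux).
  (* Half of [e], since the ball has to contain [x] without being centred at it. *)
  have [k ke] : exists k : nat, k.+1%:R^-1 < e / 2.
    have := @near_infty_natSinv_lt R (PosNum (divr_gt0 e0 (ltr0n R 2))).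
    by case=> k _ /(_ k (leqnn _)) h; exists k.
  have [q qx] : exists q : 'rV[rat]_n, forall i, `|x 0 i - ratr (q 0 i)| < k.+1%:R^-1.
    have : forall i, exists q : rat, `|x 0 i - ratr q| < k.+1%:R^-1.
      move=> i.
      have [q] := @rat_in_itvoo R (x 0 i - k.+1%:R^-1) (x 0 i) ltac:(by rewrite ltrBlDr ltrDl invr_gt0).
      rewrite in_itv/= => /andP[q1 q2]; exists q; rewrite ger0_norm ?subr_ge0 ?ltW//.
      by rewrite ltrBlDr -ltrBlDl.
    move=> /choice[q hq]; exists (\row_i q i) => i; rewrite mxE; exact: hq.
  have Bx : B (q, k) x.
    by rewrite /B /=; apply: norm_rV_lt => // i; rewrite !mxE.
  exists (q, k) => //; case: asboolP => // h; exfalso; apply: h => y By.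
  apply: eU; rewrite mx_norm_ball/=.
  rewrite (_ : x - y = (x - map_mx ratr q) - (y - map_mx ratr q)); last first.
    by rewrite opprB addrA subrK.
  apply: (le_lt_trans (ler_normB _ _)).
  by rewrite [ltRHS]splitr ltrD// (lt_trans _ ke).
apply: countable_bigcupT_measurable => [|z].
  exact: countableP.
case: ifP => _; last exact: measurable0.
exact: measurable_ball_rV.
Qed.

Lemma closed_measurable_rV U : closed U -> measurable U.
Proof.
by move=> cU; rewrite -(setCK U); apply: measurableC; apply: open_measurable_rV; exact: closed_openC.
Qed.

Lemma continuous_measurable_rV (f : 'rV[R]_n -> R) : continuous f -> measurable_fun setT f.
Proof.
move=> cf; apply: (measurability _ (RGenOpens.measurableE R)).
move=> _ [_ [a [b ->] <-]]; rewrite setTI; apply: open_measurable_rV.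
by apply: open_comp => //= x _; exact: cf.
Qed.

End measurability.

Section continuity.
Context {R : realType} {T : topologicalType}.
Implicit Types f g : T -> R.

Lemma ctsD f g : continuous f -> continuous g -> continuous (fun x => f x + g x).
Proof. by move=> cf cg x; apply: (@continuousD _ R^o _ f g x); [exact: cf|exact: cg]. Qed.

Lemma ctsN f : continuous f -> continuous (fun x => - f x).
Proof. by move=> cf x; apply: (@continuousN _ R^o _ f x); exact: cf. Qed.

Lemma ctsB f g : continuous f -> continuous g -> continuous (fun x => f x - g x).
Proof. by move=> cf cg; apply: ctsD => //; exact: ctsN. Qed.

Lemma ctsM f g : continuous f -> continuous g -> continuous (fun x => f x * g x).
Proof. by move=> cf cg x; apply: (@continuousM _ _ f g x); [exact: cf|exact: cg]. Qed.

Lemma cts_cst (c : R) : continuous (fun _ : T => c).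
Proof. by move=> x; exact: cst_continuous. Qed.

Lemma ctsV f : (forall x, f x != 0) -> continuous f -> continuous (fun x => (f x)^-1).
Proof. by move=> f0 cf x; apply: (@continuousV _ _ f x); [exact: f0|exact: cf]. Qed.

Lemma ctsX f k : continuous f -> continuous (fun x => f x ^+ k).
Proof.
move=> cf; elim: k => [|k IH].
  by rewrite (_ : (fun _ => _) = fun=> 1); [exact: cts_cst|apply/funext => x; rewrite expr0].
rewrite (_ : (fun _ => _) = fun x => f x * f x ^+ k); first exact: ctsM.
by apply/funext => x; rewrite exprS.
Qed.

Lemma cts_sum (I : Type) (r : seq I) (P : pred I) (F : I -> T -> R) :
  (forall i, continuous (F i)) -> continuous (fun x => \sum_(i <- r | P i) F i x).
Proof.
move=> cF; elim: r => [|i r IH].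
  by rewrite (_ : (fun _ => _) = fun=> 0); [exact: cts_cst|apply/funext => x; rewrite big_nil].
rewrite (_ : (fun _ => _) = fun x => (if P i then F i x else 0) + \sum_(j <- r | P j) F j x).
  by apply: ctsD => //; case: (P i) => //; exact: cts_cst.
by apply/funext => x; rewrite big_cons; case: (P i); rewrite ?add0r.
Qed.

Lemma cts_comp (U : topologicalType) (h : U -> R) (f : T -> U) : continuous f -> continuous h -> continuous (fun x => h (f x)).
Proof. by move=> cf ch x; apply: (@continuous_comp _ _ _ f h); [exact: cf|exact: ch]. Qed.

End continuity.

Section continuity_rV.
Context {R : realType} {n : nat}.
Local Notation V := 'rV[R]_n.

Lemma cts_coord i : continuous (fun x : V => x 0 i).
Proof. exact: coord_continuous. Qed.

Lemma cts_norm : continuous (fun x : V => `|x|).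
Proof. exact: norm_continuous. Qed.

Lemma cts_affine (a : R) (v : V) : continuous (fun x : V => a *: x + v).
Proof.
move=> x; apply: (@continuousD R V V (fun x => a *: x) (fun=> v) x); last exact: cst_continuous.
exact: scaler_continuous.
Qed.

Lemma cts_dotp (v : V) : continuous (dotp v).
Proof. by apply: cts_sum => i; apply: ctsM; [exact: cts_cst|exact: cts_coord]. Qed.

Lemma cts_enorm : continuous (@enorm R n).
Proof.
apply: (@cts_comp _ _ _ Num.sqrt (fun x : V => dotp x x)); last exact: sqrt_continuous.
by apply: cts_sum => i; apply: ctsM; exact: cts_coord.
Qed.

End continuity_rV.

(** * Lebesgue measure under affine maps *)

Section affine.
Context {R : realType}.

(** Uniqueness of Lebesgue measure: for [a > 0], [a] times its pushforward by the map agrees with it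
    on half-open intervals. A negative [a] is first replaced by [- a] through the invariance under
    reflection. *)
Lemma lebesgue_affine (a b : R) (A : set R) : a != 0 -> measurable A ->
  (@lebesgue_measure R ((fun x => a * x + b)%R @^-1` A) = (`|a|^-1)%:E * lebesgue_measure A)%E.
Proof.
move=> a0.
wlog : a a0 A / 0 < a.
  move=> H mA; have [?|] := ltrP 0 a; first exact: H.
  rewrite le_eqVlt (negbTE a0)/= => an.
  rewrite -normrN -H ?oppr_gt0 ?oppr_eq0//.
  rewrite -[RHS]lebesgue_measureN; last first.
    rewrite -[X in measurable X]setTI.
    apply: (_ : measurable_fun _ _) => //.
    by apply: measurable_funD => //; exact: measurable_funM.
  by rewrite /pushforward; congr (lebesgue_measure _); apply/seteqP; split=> x /=; rewrite mulrNN.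
move=> a_gt0 mA.
have mf : measurable_fun setT (fun x : measurableTypeR R => a * x + b : measurableTypeR R).
  by apply: measurable_funD => //; exact: measurable_funM.
pose F := (fun x : measurableTypeR R => a * x + b : measurableTypeR R).
pose an : {nonneg R} := NngNum (ltW a_gt0).
pose mu := (mscale an (measure_function_pushforward__canonical__measure_function_Measure lebesgue_measure mf)).
have key : lebesgue_measure A = mu A.
  apply: (@lebesgue_measure_unique _ (mscale an (measure_function_pushforward__canonical__measure_function_Measure lebesgue_measure mf))) => // _ [[u v]] _ <-.
  rewrite /mu /= /mscale /= /pushforward.
  rewrite (_ : F @^-1` _ = [set` `](u - b)/a, (v - b) / a]]); last first.
    apply/seteqP; split=> x; rewrite /= !in_itv /= ler_pdivlMr// ltr_pdivrMr// [x * a]mulrC;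
      by rewrite ltrBlDr lerBrDr.
  rewrite !lebesgue_measure_itv /= !lte_fin.
  rewrite ltr_pM2r ?invr_gt0// ltrD2r; case: ifP => _; last by rewrite mule0.
  rewrite -!EFinB -EFinM; congr EFin.
  by field.
rewrite [in RHS]key /mu/= /mscale/= muleA -EFinM gtr0_norm// mulVf ?gt_eqF//.
by rewrite mul1e.
Qed.

End affine.

Section affine_rV.
Context {R : realType}.

Lemma measurable_affine_rV n (a : R) (v : 'rV[R]_n) : measurable_fun setT (fun x : 'rV[R]_n => a *: x + v).
Proof.
apply/measurable_fun_coordP => i.
rewrite (_ : (fun _ => _) = (fun x : 'rV[R]_n => a * x 0 i + v 0 i)); last first.
  by apply/funext => x; rewrite !mxE.
apply: measurable_funD => //; apply: measurable_funM => //; exact: measurable_coord.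
Qed.

(** Induction on the dimension through sections: the section over each first coordinate contributes
    [|a| ^- n], and the integral in that coordinate one more [|a|^-1]. *)
Lemma lebesgue_rV_affine n (a : R) (v : 'rV[R]_n) (A : set 'rV[R]_n) :
  a != 0 -> measurable A ->
  (lebesgue_rV n ((fun x => a *: x + v)%R @^-1` A) = (`|a| ^- n)%:E * lebesgue_rV n A)%E.
Proof.
elim: n v A => [|n IH] v A a0 mA.
  rewrite expr0 invr1 mul1e; congr (lebesgue_rV 0 _).
  by apply/seteqP; split => x /=; rewrite (thinmx0 (a *: x + v)) (thinmx0 x).
rewrite /= /lebesgue_rV_step /pushforward /=.
set B := @cons_rV R n @^-1` A.
have mB : measurable B by rewrite -[X in measurable X]setTI; exact: measurable_cons_rV.
pose v' := \row_j v 0 (lift ord0 j).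
rewrite (_ : _ @^-1` _ = (fun z : measurableTypeR R * 'rV[R]_n => (a * z.1 + v 0 ord0, a *: z.2 + v')) @^-1` B); last first.
  rewrite /B; apply/seteqP; split => -[x y]/=; congr (A _); apply/rowP => i; rewrite !mxE;
    case: (unliftP ord0 i) => [j ->|->] /=; by rewrite ?mxE.
rewrite /product_measure1.
under eq_integral => x _.
  rewrite /= (_ : xsection _ x = (fun y => a *: y + v') @^-1` (xsection B (a * x + v 0 ord0))); last first.
    by apply/seteqP; split => y; rewrite /= /xsection/= !inE.
  rewrite IH//; last exact: measurable_xsection.
  over.
rewrite ge0_integralZl//; last first.
  rewrite (_ : (fun x => _) = (lebesgue_rV n \o xsection B) \o (fun x : measurableTypeR R => a * x + v 0 ord0 : measurableTypeR R)); last by [].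
  apply: measurableT_comp; first exact: measurable_fun_xsection.
  by apply: measurable_funD => //; exact: measurable_funM.
pose F := (fun x : measurableTypeR R => a * x + v 0 ord0 : measurableTypeR R).
have mF : measurable_fun setT F by apply: measurable_funD => //; exact: measurable_funM.
have mg : measurable_fun setT (lebesgue_rV n \o xsection B) by exact: measurable_fun_xsection.
have an : 0 <= `|a|^-1 by rewrite invr_ge0.
have -> : (\int[lebesgue_measure]_x lebesgue_rV n (xsection B (a * x + v 0 ord0)%R) =
  \int[pushforward (@lebesgue_measure R) F]_x (lebesgue_rV n \o xsection B) x)%E.
  by rewrite ge0_integral_pushforward.
rewrite (@eq_measure_integral _ _ _ _ (mscale (NngNum an) (@lebesgue_measure R)) (measure_function_pushforward__canonical__measure_function_Measure lebesgue_measure mF)); last first.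
  move=> C mC _; rewrite /pushforward /mscale [RHS]/=; exact: lebesgue_affine.
rewrite ge0_integral_mscale//= muleA -EFinM.
by rewrite -exprVn -exprSr exprVn.
Qed.

Lemma ge0_integral_affine_rV n (a : R) (v : 'rV[R]_n) (f : 'rV[R]_n -> \bar R) :
  a != 0 -> measurable_fun setT f -> (forall x, 0 <= f x)%E ->
  (\int[lebesgue_rV n]_x f (a *: x + v)%R = (`|a| ^- n)%:E * \int[lebesgue_rV n]_x f x)%E.
Proof.
move=> a0 mf f0.
pose F := (fun x : 'rV[R]_n => a *: x + v).
have an : 0 <= `|a| ^- n by rewrite invr_ge0 exprn_ge0.
transitivity (\int[pushforward (lebesgue_rV n) F]_x f x)%E.
  by rewrite ge0_integral_pushforward//; exact: measurable_affine_rV.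
rewrite (@eq_measure_integral _ _ _ _ (mscale (NngNum an) (lebesgue_rV n)) (measure_function_pushforward__canonical__measure_function_Measure (lebesgue_rV n) (measurable_affine_rV a v))); last first.
  move=> C mC _; rewrite /pushforward /mscale [RHS]/=; exact: lebesgue_rV_affine.
by rewrite ge0_integral_mscale.
Qed.

Lemma lebesgue_rVS n (A : set (measurableTypeR R)) (B : set 'rV[R]_n) : measurable A -> measurable B ->
  (lebesgue_rV n.+1 [set x : 'rV[R]_n.+1 | A (x 0%R ord0) /\ B (\row_(j < n) x 0%R (lift ord0 j))] = lebesgue_measure A * lebesgue_rV n B)%E.
Proof.
move=> mA mB; rewrite /= /lebesgue_rV_step /pushforward.
rewrite (_ : _ @^-1` _ = A `*` B) ?product_measure1E//.
apply/seteqP; split => -[x y] /=; rewrite !mxE unlift_none /=;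
  rewrite (_ : \row_j _ = y)//; by apply/rowP => j; rewrite !mxE liftK.
Qed.

Lemma lebesgue_rVT_neq0 n : lebesgue_rV n [set: 'rV[R]_n] != 0%E.
Proof.
elim: n => [|n IH].
  rewrite (_ : lebesgue_rV 0 _ = \d_(0 : 'rV[R]_0) setT)//.
  by rewrite diracT.
have := @lebesgue_rVS n setT setT measurableT measurableT.
rewrite (_ : [set x | _] = setT); last by apply/seteqP.
move=> ->; rewrite mule_neq0//.
have := @lebesgue_measure_itv R `]-oo, +oo[; rewrite /=.
by rewrite set_itvNyy => ->.
Qed.

Lemma lebesgue_rV_cube n (M : R) : (lebesgue_rV n [set x : 'rV[R]_n | forall i, (`|x 0 i| <= M)%R] < +oo)%E.
Proof.
elim: n => [|n IH].
  rewrite (_ : lebesgue_rV 0 _ = \d_(0 : 'rV[R]_0) [set x : 'rV[R]_0 | forall i, `|x 0 i| <= M])//.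
  by rewrite diracE; case: (_ \in _); rewrite ltry.
have mI : measurable [set x : measurableTypeR R | `|x| <= M].
  by rewrite -[X in measurable X]setTI; apply: measurable_fun_ler => //; exact: measurableT_comp.
have mC : measurable [set x : 'rV[R]_n | forall i, `|x 0 i| <= M].
  rewrite (_ : [set _ | _] = \bigcap_(i in [set: 'I_n]) [set x : 'rV[R]_n | `|x 0 i| <= M]); last first.
    by apply/seteqP; split => x /= h i; [move=> _|]; exact: h.
  apply: fin_bigcap_measurable => // i _.
  by rewrite -[X in measurable X]setTI; apply: measurable_fun_ler => //; apply: measurableT_comp => //; exact: measurable_coord.
have := lebesgue_rVS mI mC.
rewrite (_ : [set x | _] = [set x : 'rV[R]_n.+1 | forall i, `|x 0 i| <= M]); last first.
  apply/seteqP; split => x /=.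
    by move=> [h1 h2] i; case: (unliftP ord0 i) => [j ->|->] //; have := h2 j; rewrite mxE.
  by move=> h; split => // i; rewrite mxE.
move=> ->; apply: lte_mul_pinfty => //.
- rewrite ge0_fin_numE// (_ : [set x : measurableTypeR R | _] = [set` `[- M, M]]); last first.
    by apply/seteqP; split => x; rewrite /= in_itv /= ler_norml.
  by rewrite lebesgue_measure_itv; case: ifP => _; rewrite ?ltry// -EFinB ltry.
Qed.

End affine_rV.

(** * Volume of Euclidean balls *)

Section balls.
Context {R : realType} {n : nat}.
Implicit Types x y c : 'rV[R]_n.
Local Notation L := (@lebesgue_rV R n).

Lemma enormZ a x : enorm (a *: x) = `|a| * enorm x.
Proof. by rewrite /enorm dotpZl dotpZr mulrA -expr2 sqrtrM ?sqr_ge0// sqrtr_sqr. Qed.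

Lemma measurable_eball c (rho : R) : measurable (eball c rho).
Proof.
apply: open_measurable_rV.
rewrite (_ : eball c rho = (fun y => enorm (y - c)) @^-1` [set` `]-oo, rho[]); last first.
  by apply/seteqP; split => y; rewrite /eball /= in_itv.
apply: open_comp => // y _.
apply: (@cts_comp _ _ _ (@enorm R n) (fun y => y - c)); last exact: cts_enorm.
rewrite (_ : (fun y => _) = (fun y => 1 *: y - c)); last by apply/funext => z; rewrite scale1r.
exact: cts_affine.
Qed.

Lemma eball_affine c (rho : R) : 0 < rho ->
  eball c rho = (fun x => rho^-1 *: x + - (rho^-1 *: c)) @^-1` eball 0 1.
Proof.
move=> r0; apply/seteqP; split => y /=; rewrite /eball /= subr0 -scalerBr enormZ gtr0_norm ?invr_gt0//;
  by rewrite mulrC ltr_pdivrMr// mul1r.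
Qed.

Definition vol1 : R := fine (L (eball 0 1)).

Lemma vol1E : L (eball 0 1) = vol1%:E.
Proof.
rewrite /vol1 fineK// ge0_fin_numE//.
apply: le_lt_trans (lebesgue_rV_cube n 1).
apply: le_measure; rewrite ?inE.
- exact: measurable_eball.
- apply: closed_measurable_rV.
  rewrite (_ : [set x | _] = \bigcap_(i in [set: 'I_n]) [set x : 'rV[R]_n | `|x 0 i| <= 1]); last first.
    by apply/seteqP; split => x /= h i; [move=> _|]; exact: h.
  apply: closed_bigI => i _.
  apply: (@closed_comp _ _ (fun x : 'rV[R]_n => `|x 0 i|) [set x | x <= 1]); last exact: closed_le.
  move=> x _; move: x; apply: (@cts_comp _ _ _ (fun r : R => `|r|) (fun x : 'rV[R]_n => x 0 i)); first exact: cts_coord.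
  exact: norm_continuous.
- move=> x; rewrite /eball /= subr0 => /ltW h i.
  by rewrite (le_trans (ler_coord_norm _ _))// (le_trans (norm_le_enorm _)).
Qed.

Lemma lebesgue_eball c (rho : R) : 0 < rho -> L (eball c rho) = (rho ^+ n * vol1)%:E.
Proof.
move=> r0; rewrite eball_affine// lebesgue_rV_affine ?invr_eq0 ?gt_eqF//; last exact: measurable_eball.
by rewrite vol1E EFinM gtr0_norm ?invr_gt0// exprVn invrK.
Qed.

(** By scaling, a null unit ball would make every ball null, whereas countably many balls cover a
    space of nonzero measure. *)
Lemma vol1_gt0 : 0 < vol1.
Proof.
rewrite lt_neqAle fine_ge0// andbT; apply/eqP => v0.
have /eqP := lebesgue_rVT_neq0 (R := R) n; apply.
have -> : [set: 'rV[R]_n] = \bigcup_k eball 0 k.+1%:R.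
  apply/seteqP; split => // x _; exists (Num.trunc (enorm x)) => //.
  by rewrite /eball /= subr0; exact: truncnS_gt.
apply/eqP; rewrite -measure_le0.
apply: (@le_trans _ _ (\sum_(k <oo) L (eball 0 k.+1%:R)))%E.
  by apply: measure_sigma_subadditive => // [k|]; [exact: measurable_eball|apply: bigcup_measurable => k _; exact: measurable_eball].
by rewrite eseries0// => k _ _; rewrite lebesgue_eball// -v0 mulr0.
Qed.

Lemma eball_trans c (rho : R) z : (fun y => y + z) @^-1` eball c rho = eball (c - z) rho.
Proof. by apply/seteqP; split => y; rewrite /eball /= opprB addrA. Qed.

End balls.

(** * Polynomial weights and integrability *)

Section decay.
Context {R : realType} {n : nat}.
Local Notation V := 'rV[R]_n.
Implicit Types x y : V.
Local Notation L := (@lebesgue_rV R n).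

Definition wt x : R := 1 + `|x|.

Lemma wt_ge1 x : 1 <= wt x. Proof. by rewrite lerDl. Qed.
Lemma wt_gt0 x : 0 < wt x. Proof. exact: lt_le_trans (wt_ge1 x). Qed.
Lemma wt_ge0 x : 0 <= wt x. Proof. exact: ltW (wt_gt0 x). Qed.
Hint Resolve wt_gt0 wt_ge0 wt_ge1 : core.

Lemma wtD x y : wt (x + y) <= wt x * wt y.
Proof.
rewrite /wt.
by have := ler_normD x y; have := mulr_ge0 (normr_ge0 x) (normr_ge0 y); nra.
Qed.

Lemma wtN x : wt (- x) = wt x. Proof. by rewrite /wt normrN. Qed.

Lemma wtX_gt0 x k : 0 < wt x ^+ k. Proof. by rewrite exprn_gt0 ?wt_gt0. Qed.
Lemma wtX_ge0 x k : 0 <= wt x ^+ k. Proof. exact/ltW/wtX_gt0. Qed.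
Lemma ler_wtX x j k : (j <= k)%N -> wt x ^+ j <= wt x ^+ k.
Proof. by move=> jk; apply: ler_weXn2l. Qed.

Lemma continuous_wt : continuous wt.
Proof. by apply: ctsD; [exact: cts_cst|exact: cts_norm]. Qed.

Lemma ball_measurable (rho : R) : measurable [set x : V | `|x| < rho].
Proof.
apply: open_measurable_rV.
rewrite (_ : [set x : V | _] = (fun x : V => `|x|) @^-1` [set` `]-oo, rho[]); last first.
  by apply/seteqP; split => y; rewrite /= in_itv.
by apply: open_comp => // y _; exact: norm_continuous.
Qed.

(** Dyadic decomposition: on the shell where [2 ^+ k] is the first such power above [|x|], the
    weight is of order [2 ^- (k * a.+1)] against an integral of order [2 ^+ (a * k)], which leaves a
    geometric series. *)
Lemma growth_integral (h : V -> R) (C : R) (a : nat) :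
  measurable_fun setT h -> (forall x, 0 <= h x) ->
  (forall k : nat, (\int[L]_(x in [set x : V | (`|x| < 2 ^+ k)%R]) (h x)%:E <= (C * 2 ^+ (a * k))%:E)%E) ->
  (\int[L]_x (h x * (wt x ^- a.+1))%:E < +oo)%E.
Proof.
move=> mh h0 hC.
pose B k := [set x : V | `|x| < 2 ^+ k].
have mB k : measurable (B k) by exact: ball_measurable.
(* [wt x] is at least [2 ^+ k / 2] on the k-th shell, hence this bound for its inverse power. *)
pose c k : R := 2 ^+ a.+1 / 2 ^+ (k * a.+1).
have c0 k : 0 <= c k by rewrite divr_ge0// exprn_ge0.
pose u k x := ((c k * (h x * \1_(B k) x))%:E : \bar R).
have u0 k x : (0 <= u k x)%E by rewrite lee_fin mulr_ge0// mulr_ge0.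
have mw : measurable_fun setT (fun x => wt x ^- a.+1).
  apply: continuous_measurable_rV; apply: ctsV.
    by move=> x; rewrite expf_neq0// gt_eqF.
  exact/ctsX/continuous_wt.
have mu k : measurable_fun setT (u k).
  by apply/measurable_EFinP; apply: measurable_funM => //; apply: measurable_funM.
have C0 : 0 <= C.
  have := hC 0%N; rewrite muln0 expr0 mulr1 => /(le_trans _); rewrite -lee_fin; apply.
  by apply: integral_ge0 => x _; rewrite lee_fin.
apply: (@le_lt_trans _ _ (\int[L]_x (\sum_(k <oo) u k x))%E).
  apply: ge0_le_integral => //.
  - by move=> x _; rewrite lee_fin mulr_ge0// invr_ge0 exprn_ge0.
  - by apply/measurable_EFinP; exact: measurable_funM.
  - exact: ge0_emeasurable_sum.
  move=> x _.
  have ex : exists k : nat, `|x| < 2 ^+ k.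
    exists (Num.trunc `|x|).+1; apply: lt_le_trans (truncnS_gt _) _.
    by rewrite -natrX ler_nat ltnW// ltn_expl.
  pose k := ex_minn ex.
  have : (wt x ^- a.+1 <= c k) /\ B k x.
    rewrite /k; case: ex_minnP => k' k'x mink; split => //.
    have -> : c k' = (2 / 2 ^+ k') ^+ a.+1 by rewrite /c exprMn exprM exprVn.
    rewrite -[leLHS]exprVn; apply: lerXn2r; rewrite ?nnegrE ?invr_ge0 ?divr_ge0 ?exprn_ge0//.
    case: k' k'x mink => [|k'] k'x mink; first by rewrite divr1 (le_trans _ (_ : 1 <= 2))// ?invf_le1//; lra.
    rewrite exprS invfM mulVKf// lef_pV2 ?posrE ?exprn_gt0//.
    have : 2 ^+ k' <= `|x| by rewrite leNgt; apply/negP => /mink; rewrite ltnn.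
    by rewrite /wt; lra.
  move=> [h1 h2].
  apply: (@le_trans _ _ (u k x)).
    rewrite lee_fin indicE mem_set// mulr1 mulrC ler_wpM2r//.
  rewrite (@nneseriesD1 _ (u^~ x) k xpredT)//.
  by rewrite leeDl//; apply: nneseries_ge0 => *; exact: u0.
rewrite integral_nneseries//.
(* The shift to [a.+2] and [k.+1] gives the geometric series the form [e / 2 ^+ k.+1], of sum
   [e]. *)
apply: (@le_lt_trans _ _ (\sum_(k <oo) ((C * 2 ^+ a.+2) / 2 ^+ k.+1)%:E)%E).
  apply: lee_nneseries => // k _; first by move=> _; exact: integral_ge0.
  have mhk : measurable_fun setT (fun x => (h x * \1_(B k) x)%:E).
    by apply/measurable_EFinP; exact: measurable_funM.
  have hk0 x : (0 <= (h x * \1_(B k) x)%:E)%E by rewrite lee_fin mulr_ge0.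
  rewrite /u; under eq_integral do rewrite EFinM.
  rewrite ge0_integralZl//; last by rewrite lee_fin.
  have -> : (\int[L]_x (h x * \1_(B k) x)%:E = \int[L]_(x in B k) (h x)%:E)%E.
    rewrite [RHS]integral_mkcond epatch_indic; apply: eq_integral => x _.
    by rewrite EFinM.
  apply: (@le_trans _ _ ((c k)%:E * (C * 2 ^+ (a * k))%:E)%E).
    apply: lee_wpmul2l; [rewrite lee_fin; exact: c0|exact: hC].
  rewrite -EFinM lee_fin /c mulnS exprD (mulnC a k) (exprS _ a.+1) (exprS _ k).
  rewrite le_eqVlt; apply/orP; left; apply/eqP; field.
  by rewrite !expf_neq0.
apply: le_lt_trans (ltry (C * 2 ^+ a.+2)).
have := @epsilon_trick0 R (C * 2 ^+ a.+2) xpredT.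
under eq_eseriesr do rewrite natrX.
by apply; rewrite mulr_ge0// exprn_ge0.
Qed.

End decay.

Section wt_integral.
Context {R : realType} {n : nat}.
Local Notation V := 'rV[R]_n.
Local Notation L := (@lebesgue_rV R n).

Lemma measurable_wtV k : measurable_fun setT (fun x : V => wt x ^- k).
Proof.
apply: continuous_measurable_rV; apply: ctsV.
  by move=> x; rewrite expf_neq0// gt_eqF// wt_gt0.
exact/ctsX/continuous_wt.
Qed.

Lemma ball_le_eball (rho : R) : [set x : V | `|x| < rho] `<=` eball 0 (n.+1%:R * rho).
Proof.
move=> x /= h; rewrite /eball /= subr0 (le_lt_trans (enorm_le_norm _))//.
by rewrite ltr_pM2l.
Qed.

(** The ball of radius [2 ^+ k] has volume of order [2 ^+ (n * k)], so the exponent [n.+1] is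
    enough; it is the reference weight from here on. *)
Lemma wt_integral_lty : (\int[L]_x (wt x ^- n.+1)%:E < +oo)%E.
Proof.
rewrite (_ : (fun x => _) = (fun x => ((fun=> 1) x * wt x ^- n.+1)%:E)); last by apply/funext => x; rewrite mul1r.
apply: (@growth_integral _ _ _ (n.+1%:R ^+ n * vol1 (R := R) (n := n))) => // k.
rewrite integral_cst; last exact: ball_measurable.
rewrite mul1e; apply: (@le_trans _ _ (L (eball 0 (n.+1%:R * 2 ^+ k)))).
  apply: le_measure; rewrite ?inE; [exact: ball_measurable|exact: measurable_eball|exact: ball_le_eball].
rewrite lebesgue_eball ?mulr_gt0 ?exprn_gt0// lee_fin exprMn -exprM mulnC mulrAC.
by [].
Qed.

End wt_integral.

(** * Smooth functions *)

Section complex_basics.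
Context {R : realType}.
Implicit Types z w : R[i].

Lemma cplx_eq z w : complex.Re z = complex.Re w -> complex.Im z = complex.Im w -> z = w.
Proof. by case: z w => [a b] [c d] /= -> ->. Qed.

Lemma cReD z w : complex.Re (z + w) = complex.Re z + complex.Re w.
Proof. by case: z w => [a b] [c d]. Qed.
Lemma cImD z w : complex.Im (z + w) = complex.Im z + complex.Im w.
Proof. by case: z w => [a b] [c d]. Qed.
Lemma cReM z w : complex.Re (z * w) = complex.Re z * complex.Re w - complex.Im z * complex.Im w.
Proof. by case: z w => [a b] [c d]. Qed.
Lemma cImM z w : complex.Im (z * w) = complex.Re z * complex.Im w + complex.Im z * complex.Re w.
Proof. by case: z w => [a b] [c d]. Qed.
Lemma cmodE z : cmod z = Num.sqrt (complex.Re z ^+ 2 + complex.Im z ^+ 2).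
Proof. by case: z. Qed.
Lemma cmod_ge0 z : 0 <= cmod z. Proof. by rewrite cmodE sqrtr_ge0. Qed.
Lemma cmod0 : cmod (0 : R[i]) = 0. Proof. exact: Normc.normc0. Qed.
Lemma cmodM z w : cmod (z * w) = cmod z * cmod w. Proof. exact: Normc.normcM. Qed.
Lemma cmodD z w : cmod (z + w) <= cmod z + cmod w. Proof. exact: le_normcD. Qed.
Lemma cmodN z : cmod (- z) = cmod z. Proof. exact: normcN. Qed.
Lemma cmodB z w : cmod (z - w) <= cmod z + cmod w.
Proof. by rewrite (le_trans (cmodD _ _))// cmodN. Qed.
Lemma cmod_real (x : R) : cmod (x%:C)%C = `|x|.
Proof. by rewrite cmodE /= expr0n addr0 sqrtr_sqr. Qed.
Lemma cmod_eq0 z : cmod z = 0 -> z = 0. Proof. exact: Normc.eq0_normc. Qed.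
Lemma Re_le_cmod z : `|complex.Re z| <= cmod z.
Proof. by rewrite cmodE -sqrtr_sqr ler_wsqrtr// lerDl sqr_ge0. Qed.
Lemma Im_le_cmod z : `|complex.Im z| <= cmod z.
Proof. by rewrite cmodE -sqrtr_sqr ler_wsqrtr// lerDr sqr_ge0. Qed.
Lemma cmod_le_ReIm z : cmod z <= `|complex.Re z| + `|complex.Im z|.
Proof.
rewrite cmodE -(ger0_norm (addr_ge0 (normr_ge0 (complex.Re z)) (normr_ge0 (complex.Im z)))).
rewrite -sqrtr_sqr ler_wsqrtr// sqrrD !real_normK ?num_real//.
by rewrite addrAC lerDl mulrn_wge0// mulr_ge0.
Qed.

Lemma cmod_cis (t : R) : cmod (cis t) = 1.
Proof. by rewrite cmodE /= cos2Dsin2 sqrtr1. Qed.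
Lemma cisD (s t : R) : cis (s + t) = cis s * cis t.
Proof. by apply: cplx_eq; rewrite ?cReM ?cImM /= ?cosD ?sinD; ring. Qed.
Lemma cis0 : cis (0 : R) = 1.
Proof. by rewrite /cis cos0 sin0. Qed.
Lemma mulCr_Re (a : R) z : complex.Re (a%:C%C * z) = a * complex.Re z.
Proof. by rewrite cReM /= mul0r subr0. Qed.
Lemma mulCr_Im (a : R) z : complex.Im (a%:C%C * z) = a * complex.Im z.
Proof. by rewrite cImM /= mul0r addr0. Qed.

End complex_basics.

Section line_derivative.
Context {R : realType} {V : normedModType R}.
Implicit Types (f g : V -> R) (x v : V).

Lemma is_derive_val f x v a b : is_derive x v f a -> a = b -> is_derive x v f b.
Proof. by move=> h <-. Qed.

Lemma isdD f g x v a b : is_derive x v f a -> is_derive x v g b -> is_derive x v (fun y => f y + g y) (a + b).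
Proof. by move=> h1 h2; exact: (@is_deriveD _ _ _ f g). Qed.

Lemma isdN f x v a : is_derive x v f a -> is_derive x v (fun y => - f y) (- a).
Proof. by move=> h1; exact: (@is_deriveN _ _ _ f). Qed.

Lemma isdB f g x v a b : is_derive x v f a -> is_derive x v g b -> is_derive x v (fun y => f y - g y) (a - b).
Proof. by move=> h1 h2; apply: isdD => //; exact: isdN. Qed.

Lemma isdM f g x v a b : is_derive x v f a -> is_derive x v g b -> is_derive x v (fun y => f y * g y) (a * g x + f x * b).
Proof.
move=> h1 h2; apply: is_derive_val (@is_deriveM _ _ f g x v a b h1 h2) _.
by rewrite addrC /GRing.scale/= [g x * a]mulrC.
Qed.

Lemma isd_cst (c : R) x v : is_derive x v (fun=> c) 0.
Proof. exact: (@is_derive_cst _ _ _ c). Qed.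

Lemma isd_sum (I : Type) (r : seq I) (F : I -> V -> R) (a : I -> R) x v :
  (forall i, is_derive x v (F i) (a i)) -> is_derive x v (fun y => \sum_(i <- r) F i y) (\sum_(i <- r) a i).
Proof.
move=> h; elim: r => [|i r IH].
  rewrite big_nil (_ : (fun _ => _) = fun=> 0); first exact: isd_cst.
  by apply/funext => y; rewrite big_nil.
rewrite big_cons (_ : (fun _ => _) = fun y => F i y + \sum_(j <- r) F j y); first exact: isdD.
by apply/funext => y; rewrite big_cons.
Qed.

Lemma isd_line f x v t a : is_derive (x + t *: v) v f a <-> is_derive t 1 (fun s => f (x + s *: v)) a.
Proof.
have E : (fun h : R => h^-1 *: ((f \o shift (x + t *: v)) (h *: v) - f (x + t *: v))) =
   (fun h : R => h^-1 *: (((fun s => f (x + s *: v)) \o shift t) (h *: (1 : R)) - f (x + t *: v))).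
  apply/funext => h /=; do 3 f_equal.
  by rewrite [h *: 1]mulr1 scalerDl addrCA.
by split => -[h1 h2]; split; move: h1 h2; rewrite /derivable /derive E.
Qed.

Lemma isd_line0 f x v a : is_derive x v f a <-> is_derive (0:R) 1 (fun s => f (x + s *: v)) a.
Proof. by rewrite -isd_line scale0r addr0. Qed.

Lemma isd_comp (h : R -> R) f x v a b : is_derive x v f a -> is_derive (f x) 1 h b ->
  is_derive x v (fun y => h (f y)) (b * a).
Proof.
move=> /isd_line0 h1 h2; apply/isd_line0.
apply: (@is_derive1_comp _ h (fun s => f (x + s *: v)) 0 b a) => //.
by rewrite scale0r addr0.
Qed.

End line_derivative.

Section line_derivative2.
Context {R : realType} {V : normedModType R}.
Implicit Types (f g : V -> R) (x v : V).

Lemma isd_scale f (c : R) x v a : is_derive (c *: x) v f a -> is_derive x v (fun y => f (c *: y)) (c * a).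
Proof.
move=> h; apply/(@isd_line0 R V (fun y => f (c *: y))).
rewrite (_ : (fun _ => _) = (fun s => f (c *: x + s *: v)) \o (fun s => c * s)); last first.
  by apply/funext => s /=; rewrite scalerDr scalerA.
rewrite mulrC; apply: is_derive1_comp.
  by rewrite mulr0; apply/(@isd_line R V f (c *: x) v 0 a); rewrite scale0r addr0.
by have := isdM (isd_cst c (0 : R) (1 : R)) (is_derive_id (0 : R) (1 : R)); rewrite mul0r add0r mulr1.
Qed.

Lemma isd_unique f x v a b : is_derive x v f a -> is_derive x v f b -> a = b.
Proof. by move=> [_ <-] [_ <-]. Qed.

Lemma line_MVT f f' x v (t : R) : 0 < t -> (forall y, is_derive y v f (f' y)) ->
  exists2 s, 0 < s < t & f (x + t *: v) - f x = t * f' (x + s *: v).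
Proof.
move=> t0 h.
have h1 : forall s : R, is_derive s 1 (fun s => f (x + s *: v)) (f' (x + s *: v)).
  by move=> s; apply/(@isd_line R V f x v s).
have [] := @MVT R (fun s => f (x + s *: v)) (fun s => f' (x + s *: v)) 0 t t0.
- apply: derivable_within_continuous => s _; by have [] := h1 s.
move=> s; rewrite in_itv/= => st; rewrite scale0r addr0 subr0 => ->.
by exists s => //; rewrite mulrC.
Qed.

Lemma line_bound f f' x v (t M : R) : (forall y, is_derive y v f (f' y)) ->
  (forall s, `|s| <= `|t| -> `|f' (x + s *: v)| <= M) -> `|f (x + t *: v) - f x| <= `|t| * M.
Proof.
move=> h hM; have [t0|t0|->] := ltgtP t 0; last first.
- by rewrite scale0r addr0 subrr normr0 mul0r.
- have [s /andP[s0 st] ->] := line_MVT x t0 h.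
  by rewrite normrM ler_wpM2l// hM// !gtr0_norm// ltW.
have nt : 0 < - t by rewrite oppr_gt0.
have [s /andP[s0 st] E] := line_MVT (x + t *: v) nt h.
rewrite distrC; move: E; rewrite scaleNr addrK => ->.
rewrite normrM normrN ler_wpM2l// -addrA -scalerDl hM//.
by rewrite !ltr0_norm//; lra.
Qed.

End line_derivative2.

(** * Symmetry of second derivatives *)

Section clairaut.
Context {R : realType} {V : normedModType R}.
Implicit Types (f g : V -> R) (x u v : V).

(** The second difference of [f] over the parallelogram of sides [t *: u] and [t *: v] is [t ^+ 2]
    times a value of [fuv] near [x], and also [t ^+ 2] times a value of [fvu] near [x], by the mean
    value theorem applied twice in either order; continuity at [x] concludes. *)
Lemma clairaut f fu fv fuv fvu u v x :
  (forall y, is_derive y u f (fu y)) -> (forall y, is_derive y v f (fv y)) ->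
  (forall y, is_derive y v fu (fuv y)) -> (forall y, is_derive y u fv (fvu y)) ->
  {for x, continuous fuv} -> {for x, continuous fvu} -> fuv x = fvu x.
Proof.
move=> hu hv huv hvu cuv cvu.
apply/eqP; rewrite -subr_eq0 -normr_eq0 eq_le normr_ge0 andbT.
apply/ler_addgt0Pr => e e0; rewrite add0r.
have e2 : 0 < e / 2 by rewrite divr_gt0.
move/cvgrPdist_lt : cuv => /(_ _ e2) /nbhs_ballP[d1 /= d10 H1].
move/cvgrPdist_lt : cvu => /(_ _ e2) /nbhs_ballP[d2 /= d20 H2].
pose d := Num.min d1 d2.
have d0 : 0 < d by rewrite lt_min d10 d20.
(* Small enough for the parallelogram to lie in the ball of radius [d], where each mixed derivative
   is within [e / 2] of its value at [x]. *)
pose t := d / (1 + `|u| + `|v|).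
have D0 : 0 < 1 + `|u| + `|v| by rewrite -addrA ltr_pwDl.
have t0 : 0 < t by rewrite divr_gt0.
have key a b : 0 < a < t -> 0 < b < t -> `|a *: u + b *: v| < d.
  move=> /andP[a0 at_] /andP[b0 bt].
  apply: (le_lt_trans (ler_normD _ _)); rewrite !normrZ !gtr0_norm//.
  apply: (@le_lt_trans _ _ (t * (`|u| + `|v|))).
    by rewrite mulrDr lerD// ler_wpM2r// ltW.
  rewrite -[ltRHS](@divfK _ (1 + `|u| + `|v|)) ?gt_eqF// -/t ltr_pM2l//.
  by rewrite -addrA ltrDr.
have shift (g : V -> R) g' w : (forall y, is_derive y w g (g' y)) ->
    forall z y, is_derive y w (fun y => g (y + z)) (g' (y + z)).
  move=> hg z y; apply/(@isd_line0 R V (fun y => g (y + z))).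
  rewrite (_ : (fun s => _) = fun s => g ((y + z) + s *: w)); first by move: (hg (y + z)) => /isd_line0.
  by apply/funext => s; rewrite addrAC.
have hB (g : V -> R) g' w z : (forall y, is_derive y w g (g' y)) ->
    forall y, is_derive y w (fun y => g (y + z) - g y) (g' (y + z) - g' y).
  by move=> hg y; apply: isdB => //; exact: shift.
have [s1 /andP[s10 s11] E1] := line_MVT x t0 (hB _ _ _ (t *: v) hu).
have [s2 /andP[s20 s21] E2] := line_MVT (x + s1 *: u) t0 huv.
have [s3 /andP[s30 s31] E3] := line_MVT x t0 (hB _ _ _ (t *: u) hv).
have [s4 /andP[s40 s41] E4] := line_MVT (x + s3 *: v) t0 hvu.
have : fuv (x + s1 *: u + s2 *: v) = fvu (x + s3 *: v + s4 *: u).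
  apply: (mulfI (lt0r_neq0 t0)); apply: (mulfI (lt0r_neq0 t0)).
  rewrite -E2 -E4 -E1 -E3 (addrAC x (t *: v)).
  by ring.
have H1' : `|fuv x - fuv (x + s1 *: u + s2 *: v)| < e / 2.
  apply: H1; rewrite -ball_normE /ball_ /= -addrA opprD addNKr normrN.
  by apply: lt_le_trans (key _ _ _ _) _; rewrite ?s10 ?s20// ge_min lexx.
have H2' : `|fvu x - fvu (x + s3 *: v + s4 *: u)| < e / 2.
  apply: H2; rewrite -ball_normE /ball_ /= -addrA opprD addNKr normrN addrC.
  by apply: lt_le_trans (key _ _ _ _) _; rewrite ?s30 ?s40// ge_min lexx orbT.
move=> E; rewrite E in H1'.
rewrite (_ : fuv x - fvu x = (fuv x - fvu (x + s3 *: v + s4 *: u)) - (fvu x - fvu (x + s3 *: v + s4 *: u))); last by ring.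
by rewrite (le_trans (ler_normB _ _))// [leRHS]splitr lerD// ltW.
Qed.

End clairaut.

(** * Calculus of smooth functions *)

Section smooth_functions.
Context {R : realType} {n : nat}.
Local Notation V := 'rV[R]_n.
Local Notation e i := (delta_mx 0 i : V).
Implicit Types (f g : V -> R[i]) (s : seq 'I_n).

Definition ispd (i : 'I_n) f g := forall x : V,
  is_derive x (e i) (reC f) (reC g x) /\ is_derive x (e i) (imC f) (imC g x).

Lemma ispd_pd i f g : ispd i f g -> pd i f = g.
Proof.
move=> h; apply/funext => x; have [[_ h1] [_ h2]] := h x.
by apply: cplx_eq; rewrite /pd /= ?h1 ?h2.
Qed.

(** Words compose by concatenation and accept a letter at either end, which suits inductions better
    than the fixed order of [mderiv]; [dw_mderiv] translates back. *)
Definition dw s f := foldr (@pd R n) f s.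

Lemma dw_nil f : dw [::] f = f. Proof. by []. Qed.
Lemma dw_cons i s f : dw (i :: s) f = pd i (dw s f). Proof. by []. Qed.

Lemma dw_rcons s i f : dw (rcons s i) f = dw s (pd i f).
Proof. by rewrite /dw -cats1 foldr_cat. Qed.

Lemma dw_cat s1 s2 f : dw (s1 ++ s2) f = dw s1 (dw s2 f).
Proof. by rewrite /dw foldr_cat. Qed.

Lemma smooth_dw s f : smooth f -> smooth (dw s f).
Proof. by move=> h s'; have := h (s' ++ s); rewrite foldr_cat. Qed.

Lemma smooth_pd i f : smooth f -> smooth (pd i f).
Proof. exact: (@smooth_dw [:: i]). Qed.

Lemma smooth_ispd i f : smooth f -> ispd i f (pd i f).
Proof.
move=> h x; have [_ _ d] := h [::]; have [d1 d2] := d i x.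
by split; apply: derivableP.
Qed.

Lemma smooth_ctsRe f : smooth f -> continuous (reC f).
Proof. by move=> h; have [] := h [::]. Qed.

Lemma smooth_ctsIm f : smooth f -> continuous (imC f).
Proof. by move=> h; have [] := h [::]. Qed.

(** Coinduction for [smooth]: an invariant that implies continuity and passes to partial derivatives
    covers all iterated derivatives at once. It is applied to [sm], to Fourier transforms of
    Schwartz functions and to convolutions. *)
Lemma smooth_coind (P : (V -> R[i]) -> Prop) :
  (forall f, P f -> [/\ continuous (reC f), continuous (imC f) &
     forall i, exists2 g, ispd i f g & P g]) ->
  forall f, P f -> smooth f.
Proof.
move=> H f Pf s.
have {Pf} : P (dw s f).
  elim: s => [|i s IH] //=; have [_ _ /(_ i)[g hg Pg]] := H _ IH.
  by rewrite (ispd_pd hg).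
rewrite /dw; move: (foldr _ _ _) => g /= /H[c1 c2 hd]; split => // i x.
by have [g' /(_ x)[[d1 _] [d2 _]] _] := hd i.
Qed.

(* Closed under partial derivatives, so [smooth_coind] applies to it and yields
   the stability of smoothness under all the constructors. *)
Inductive sm : (V -> R[i]) -> Prop :=
| sm_smooth f : smooth f -> sm f
| sm_add f g : sm f -> sm g -> sm (fun x => f x + g x)
| sm_mul f g : sm f -> sm g -> sm (fun x => f x * g x)
| sm_cst c : sm (fun _ => c)
| sm_coord i : sm (fun x => (x 0 i)%:C%C)
| sm_scale a f : sm f -> sm (fun x => f (a *: x))
| sm_inv (f : V -> R) : (forall x, f x != 0) -> sm (fun x => (f x)%:C%C) ->
    sm (fun x => (f x)^-1%:C%C).

Lemma ispd_add i f f' g g' : ispd i f f' -> ispd i g g' -> ispd i (fun x => f x + g x) (fun x => f' x + g' x).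
Proof.
move=> hf hg x; have [h1 h2] := hf x; have [h3 h4] := hg x; split.
  rewrite /reC cReD (_ : (fun x => _) = (fun x => reC f x + reC g x)); first exact: isdD.
  by apply/funext => y; rewrite cReD.
rewrite /imC cImD (_ : (fun x => _) = (fun x => imC f x + imC g x)); first exact: isdD.
by apply/funext => y; rewrite cImD.
Qed.

Lemma ispd_mul i f f' g g' : ispd i f f' -> ispd i g g' ->
  ispd i (fun x => f x * g x) (fun x => f' x * g x + f x * g' x).
Proof.
move=> hf hg x; have [h1 h2] := hf x; have [h3 h4] := hg x; split.
  rewrite /reC (_ : (fun x => _) = (fun x => reC f x * reC g x - imC f x * imC g x)); last first.
    by apply/funext => y; rewrite cReM.
  apply: is_derive_val (isdB (isdM h1 h3) (isdM h2 h4)) _.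
  by rewrite cReD !cReM /reC /imC; ring.
rewrite /imC (_ : (fun x => _) = (fun x => reC f x * imC g x + imC f x * reC g x)); last first.
  by apply/funext => y; rewrite cImM.
apply: is_derive_val (isdD (isdM h1 h4) (isdM h2 h3)) _.
by rewrite cImD !cImM /reC /imC; ring.
Qed.

Lemma ispd_cst i c : ispd i (fun=> c) (fun=> 0).
Proof. by move=> x; split; exact: isd_cst. Qed.

Lemma isd_coord (i j : 'I_n) (x : V) : is_derive x (e i) (fun y : V => y 0 j) ((i == j)%:R).
Proof.
apply/(@isd_line0 R V (fun y : V => y 0 j)).
rewrite (_ : (fun t => _) = (fun t : R => x 0 j + t * (i == j)%:R)); last first.
  by apply/funext => t; rewrite !mxE eqxx /= eq_sym.
apply: is_derive_val (isdD (@isd_cst _ _ _ _ _) (isdM (@is_derive_id _ R^o (0:R) 1) (@isd_cst _ _ _ _ _))) _.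
by rewrite mulr0 addr0 add0r mul1r.
Qed.

Lemma ispd_coord (i j : 'I_n) : ispd i (fun x => (x 0 j)%:C%C) (fun=> ((i == j)%:R)%:C%C).
Proof.
move=> x; split; first exact: isd_coord.
exact: isd_cst.
Qed.

Lemma ispd_scale i a f f' : ispd i f f' -> ispd i (fun x => f (a *: x)) (fun x => a%:C%C * f' (a *: x)).
Proof.
move=> h x; have [h1 h2] := h (a *: x); split.
  by rewrite /reC mulCr_Re; exact: (isd_scale h1).
by rewrite /imC mulCr_Im; exact: (isd_scale h2).
Qed.

Lemma ispd_real_Im i (f : V -> R) g : ispd i (fun x => (f x)%:C%C) g -> forall x, complex.Im (g x) = 0.
Proof. by move=> h x; have [_ h2] := h x; exact: isd_unique h2 (isd_cst _ _ _). Qed.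

Lemma isd_inv (f : V -> R) (x v : V) a : f x != 0 -> is_derive x v f a ->
  is_derive x v (fun y => (f y)^-1) (- a * (f x)^-1 * (f x)^-1).
Proof.
move=> f0 [h1 h2]; have [d] := conj (derivableV f0 h1) (deriveV f0 h1).
move=> e0; split => //; rewrite [LHS]e0 h2 /GRing.scale /=.
by rewrite -exprVn expr2; ring.
Qed.

Lemma ispd_inv i (f : V -> R) g : (forall x, f x != 0) -> ispd i (fun x => (f x)%:C%C) g ->
  ispd i (fun x => (f x)^-1%:C%C) (fun x => (-1)%:C%C * g x * (f x)^-1%:C%C * (f x)^-1%:C%C).
Proof.
move=> f0 h x; have gI := ispd_real_Im h x; have [h1 h2] := h x; split.
  apply: is_derive_val (isd_inv (f0 x) h1) _.
  by rewrite /reC !cReM !cImM /= gI; ring.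
rewrite (_ : imC _ x = 0); first exact: isd_cst.
by rewrite /imC !(cImM, cReM) /= gI; ring.
Qed.

Lemma sm_is_smooth f : sm f -> smooth f.
Proof.
move: f; apply: smooth_coind => f; elim => {f}.
- move=> f h; split; [exact: smooth_ctsRe|exact: smooth_ctsIm|move=> i].
  by exists (pd i f); [exact: smooth_ispd|exact/sm_smooth/smooth_pd].
- move=> f g sf [c1 c2 d] sg [c3 c4 d']; split.
  + by rewrite /reC; under [X in continuous X]eq_fun do rewrite cReD; exact: ctsD.
  + by rewrite /imC; under [X in continuous X]eq_fun do rewrite cImD; exact: ctsD.
  + move=> i; have [f' hf sf'] := d i; have [g' hg sg'] := d' i.
    by eexists; [exact: ispd_add hf hg|exact: sm_add].
- move=> f g sf [c1 c2 d] sg [c3 c4 d']; split.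
  + by rewrite /reC; under [X in continuous X]eq_fun do rewrite cReM; apply: ctsB; exact: ctsM.
  + by rewrite /imC; under [X in continuous X]eq_fun do rewrite cImM; apply: ctsD; exact: ctsM.
  + move=> i; have [f' hf sf'] := d i; have [g' hg sg'] := d' i.
    by eexists; [exact: ispd_mul hf hg|apply: sm_add; exact: sm_mul].
- move=> c; split; [exact: cts_cst|exact: cts_cst|move=> i].
  by exists (fun=> 0); [exact: ispd_cst|exact: sm_cst].
- move=> i; split; [exact: cts_coord|exact: cts_cst|move=> j].
  by eexists; [exact: ispd_coord|exact: sm_cst].
- move=> a f sf [c1 c2 d]; split.
  + by apply: (@cts_comp R V V (reC f) (fun x => a *: x)) => // x; exact: scaler_continuous.
  + by apply: (@cts_comp R V V (imC f) (fun x => a *: x)) => // x; exact: scaler_continuous.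
  + move=> i; have [f' hf sf'] := d i; eexists; first exact: ispd_scale hf.
    by apply: sm_mul; [exact: sm_cst|exact: sm_scale].
- move=> f f0 sf [c1 c2 d]; split; [|exact: cts_cst|].
  + exact: (@ctsV _ _ f).
  + move=> i; have [f' hf sf'] := d i; eexists; first exact: ispd_inv hf.
    apply: sm_mul; last exact: sm_inv.
    apply: sm_mul; last exact: sm_inv.
    by apply: sm_mul => //; exact: sm_cst.
Qed.

Lemma smoothD f g : smooth f -> smooth g -> smooth (fun x => f x + g x).
Proof. by move=> /sm_smooth h /sm_smooth h'; apply/sm_is_smooth/sm_add. Qed.

Lemma smoothM f g : smooth f -> smooth g -> smooth (fun x => f x * g x).
Proof. by move=> /sm_smooth h /sm_smooth h'; apply/sm_is_smooth/sm_mul. Qed.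

Lemma smooth_cst c : smooth (fun _ : V => c).
Proof. exact/sm_is_smooth/sm_cst. Qed.

Lemma smooth_coord i : smooth (fun x : V => (x 0 i)%:C%C).
Proof. exact/sm_is_smooth/sm_coord. Qed.

Lemma smooth_scale a f : smooth f -> smooth (fun x => f (a *: x)).
Proof. by move=> /sm_smooth h; apply/sm_is_smooth/sm_scale. Qed.

Lemma smooth_inv (f : V -> R) : (forall x, f x != 0) -> smooth (fun x => (f x)%:C%C) ->
    smooth (fun x => (f x)^-1%:C%C).
Proof. by move=> f0 /sm_smooth h; apply/sm_is_smooth/sm_inv. Qed.

Lemma smooth_sum (I : Type) (r : seq I) (F : I -> V -> R[i]) :
  (forall i, smooth (F i)) -> smooth (fun x => \sum_(i <- r) F i x).
Proof.
move=> h; elim: r => [|i r IH].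
  rewrite (_ : (fun x => _) = (fun _ : V => 0)); first exact: smooth_cst.
  by apply/funext => x; rewrite big_nil.
rewrite (_ : (fun x => _) = (fun x : V => F i x + \sum_(j <- r) F j x)); first exact: smoothD.
by apply/funext => x; rewrite big_cons.
Qed.

Lemma pd_add i f g : smooth f -> smooth g -> pd i (fun x => f x + g x) = fun x => pd i f x + pd i g x.
Proof. by move=> hf hg; apply: ispd_pd; apply: ispd_add; exact: smooth_ispd. Qed.

Lemma pd_mul i f g : smooth f -> smooth g -> pd i (fun x => f x * g x) = fun x => pd i f x * g x + f x * pd i g x.
Proof. by move=> hf hg; apply: ispd_pd; apply: ispd_mul; exact: smooth_ispd. Qed.

Lemma pd_scale i a f : smooth f -> pd i (fun x => f (a *: x)) = fun x => a%:C%C * pd i f (a *: x).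
Proof. by move=> hf; apply: ispd_pd; apply: ispd_scale; exact: smooth_ispd. Qed.

Lemma pd_cst i c : pd i (fun _ : V => c) = fun=> 0.
Proof. exact/ispd_pd/ispd_cst. Qed.

Lemma pd_comm i j f : smooth f -> pd i (pd j f) = pd j (pd i f).
Proof.
move=> hf; apply/funext => x.
have hi := smooth_ispd i hf; have hj := smooth_ispd j hf.
have hij := smooth_ispd i (smooth_pd j hf); have hji := smooth_ispd j (smooth_pd i hf).
have cij := smooth_pd i (smooth_pd j hf); have cji := smooth_pd j (smooth_pd i hf).
apply: cplx_eq.
  apply: (clairaut (f := reC f) (fu := reC (pd j f)) (fv := reC (pd i f)) (u := e j) (v := e i) (fuv := reC (pd i (pd j f))) (fvu := reC (pd j (pd i f)))).
  - by move=> y; have [] := hj y.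
  - by move=> y; have [] := hi y.
  - by move=> y; have [] := hij y.
  - by move=> y; have [] := hji y.
  - exact: smooth_ctsRe.
  - exact: smooth_ctsRe.
apply: (clairaut (f := imC f) (fu := imC (pd j f)) (fv := imC (pd i f)) (u := e j) (v := e i) (fuv := imC (pd i (pd j f))) (fvu := imC (pd j (pd i f)))).
- by move=> y; have [] := hj y.
- by move=> y; have [] := hi y.
- by move=> y; have [] := hij y.
- by move=> y; have [] := hji y.
- exact: smooth_ctsIm.
- exact: smooth_ctsIm.
Qed.

Lemma dw_pd_comm s i f : smooth f -> dw s (pd i f) = pd i (dw s f).
Proof.
move=> hf; elim: s => //= j s ->.
by rewrite pd_comm//; exact: smooth_dw.
Qed.

Lemma dw_perm s s' f : smooth f -> perm_eq s s' -> dw s f = dw s' f.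
Proof.
move=> hf; elim: s s' => [|i s IH] s'.
  by rewrite perm_sym => /perm_nilP ->.
move=> h; have : i \in s' by rewrite -(perm_mem h) mem_head.
move=> /path.splitPr hs; case: hs h => a b h.
have {}h : perm_eq s (a ++ b).
  by rewrite -(perm_cons i) (perm_trans h)// -[i :: b]cat1s perm_catCA.
rewrite [LHS]/= (IH _ h) dw_cat [in RHS]dw_cat /= -/(dw b f).
by rewrite dw_pd_comm//; exact: smooth_dw.
Qed.

Definition word_of (alpha : multi_index (n := n)) : seq 'I_n :=
  flatten [seq nseq (alpha i) i | i <- enum 'I_n].

Lemma mderiv_word alpha f : mderiv alpha f = dw (word_of alpha) f.
Proof.
rewrite /mderiv /word_of; elim: (enum 'I_n) => //= i t ->.
rewrite dw_cat; elim: (alpha i) => //= k <-; done.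
Qed.

Lemma size_word_of alpha : size (word_of alpha) = mdeg alpha.
Proof.
rewrite /word_of size_flatten /shape -map_comp sumnE big_map /mdeg big_enum /=.
by apply: eq_bigr => i _; rewrite size_nseq.
Qed.

Lemma count_word_of alpha i : count_mem i (word_of alpha) = alpha i.
Proof.
rewrite /word_of count_flatten -map_comp sumnE big_map /= big_enum /=.
rewrite (bigD1 i)//= count_nseq /= eqxx mul1n big1 ?addn0// => j ji.
by rewrite count_nseq /= (negbTE ji).
Qed.

Lemma dw_mderiv s f : smooth f -> dw s f = mderiv (fun i => count_mem i s) f.
Proof.
move=> hf; rewrite mderiv_word; apply: dw_perm => //.
by apply/allP => i _ /=; rewrite count_word_of.
Qed.

End smooth_functions.

(** * Schwartz functions and tempered distributions *)

Section seminorms.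
Context {R : realType} {n : nat}.
Local Notation V := 'rV[R]_n.
Implicit Types (f g psi : V -> R[i]) (s : seq 'I_n).

(** [M] is an upper bound and not a supremum, so no seminorm has to be formed. One index [m] governs
    both the weight and the order, which makes the family monotone in [m]. *)
Definition sn (m : nat) psi (M : R) := forall s, (size s <= m)%N ->
  forall x, wt x ^+ m * cmod (dw s psi x) <= M.

Definition schw psi := smooth psi /\ forall m, exists M, sn m psi M.

Lemma sn_le m m' psi M : (m <= m')%N -> sn m' psi M -> sn m psi M.
Proof.
move=> mm h s sm x; apply: le_trans (h s (leq_trans sm mm) x).
by rewrite ler_wpM2r ?cmod_ge0// ler_wtX// leqnSn.
Qed.

Lemma sn_leM m psi M M' : M <= M' -> sn m psi M -> sn m psi M'.
Proof. by move=> MM h s sm x; exact: le_trans (h s sm x) MM. Qed.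

Lemma sn_ge0 m psi M : sn m psi M -> 0 <= M.
Proof.
move=> /(_ [::] isT 0); apply: le_trans.
by rewrite mulr_ge0 ?cmod_ge0 ?wtX_ge0.
Qed.

Lemma words_bound (B : seq 'I_n -> R) m : exists M, forall s, (size s <= m)%N -> B s <= M.
Proof.
elim: m B => [|m IH] B.
  by exists (B [::]) => s; rewrite leqn0 => /nilP ->.
have /choice[M hM] := fun i => IH (fun s => B (i :: s)).
exists (`|B [::]| + \sum_i `|M i|) => -[_|i s].
  by rewrite (le_trans (ler_norm _))// lerDl sumr_ge0.
rewrite /= ltnS => /(hM i) h.
apply: (le_trans h); rewrite (le_trans (ler_norm _))//.
rewrite ler_wpDl// (bigD1 i)//= lerDl sumr_ge0//.
Qed.

(** For [|x| > 1] the sup norm is attained at some coordinate and [wt x <= 2 * |x|]; for [|x| <= 1]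
    the summand 1 suffices. The weight is thus controlled by the pure powers [mono1 i m]. *)
Lemma wtX_le (x : V) m : wt x ^+ m <= 2 ^+ m * (1 + \sum_i `|x 0 i| ^+ m).
Proof.
have S0 : 0 <= \sum_i `|x 0 i| ^+ m by apply: sumr_ge0 => i _; exact: exprn_ge0.
have [x1|x1] := leP `|x| 1.
  apply: (@le_trans _ _ (2 ^+ m)).
    by apply: lerXn2r; rewrite ?nnegrE ?wt_ge0// /wt; lra.
  by rewrite -[leLHS]mulr1 ler_wpM2l ?exprn_ge0// lerDl.
have /mx_norm_neq0[[z i] /=] : mx_norm x != 0.
  by rewrite gt_eqF// (lt_trans _ x1).
rewrite (ord1 z) => E; have {}E : `|x| = `|x 0 i| := E.
apply: (@le_trans _ _ ((2 * `|x|) ^+ m)).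
  by apply: lerXn2r; rewrite ?nnegrE ?mulr_ge0 ?wt_ge0// /wt; lra.
rewrite exprMn ler_wpM2l ?exprn_ge0// E.
rewrite (bigD1 i)//= [leRHS]addrCA lerDl addr_ge0//.
by apply: sumr_ge0 => j _; exact: exprn_ge0.
Qed.

Lemma monomial_le (alpha : multi_index (n := n)) (x : V) : `|monomial alpha x| <= wt x ^+ mdeg alpha.
Proof.
rewrite /monomial /mdeg normr_prod expr_sum; apply: ler_prod => i _.
rewrite normr_ge0 normrX; apply: lerXn2r; rewrite ?nnegrE ?wt_ge0//.
by rewrite (le_trans (ler_coord_norm _ _))// /wt lerDr.
Qed.

Definition mono1 (i : 'I_n) (m : nat) : multi_index (n := n) := fun j => if j == i then m else 0%N.

Lemma mdeg_mono1 i m : mdeg (mono1 i m) = m.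
Proof.
rewrite /mdeg (bigD1 i)//= /mono1 eqxx big1 ?addn0// => j ji.
by rewrite (negbTE ji).
Qed.

Lemma monomial_mono1 i m (x : V) : monomial (mono1 i m) x = x 0 i ^+ m.
Proof.
rewrite /monomial (bigD1 i)//= /mono1 eqxx big1 ?mulr1// => j ji.
by rewrite (negbTE ji) expr0.
Qed.

Lemma seminorm_wt psi s m x M : smooth psi -> 0 <= M ->
  (forall alpha, (mdeg alpha <= m)%N -> `|monomial alpha x| * cmod (mderiv (fun i => count_mem i s) psi x) <= M) ->
  wt x ^+ m * cmod (dw s psi x) <= 2 ^+ m * (1 + n%:R) * M.
Proof.
move=> hs M0 H; rewrite dw_mderiv//.
apply: (@le_trans _ _ (2 ^+ m * (1 + \sum_i `|x 0 i| ^+ m) * cmod (mderiv (fun i => count_mem i s) psi x))).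
  by rewrite ler_wpM2r ?cmod_ge0// wtX_le.
rewrite -!mulrA ler_wpM2l ?exprn_ge0//.
rewrite !mulrDl !mul1r; apply: lerD.
  have := H (fun=> 0%N); rewrite /mdeg big1// => /(_ isT).
  by rewrite /monomial big1 ?normr1 ?mul1r// => i _; rewrite expr0.
rewrite mulr_suml.
rewrite (_ : n%:R * M = \sum_(i < n) M); last by rewrite sumr_const card_ord mulr_natl.
apply: ler_sum => i _; have := H (mono1 i m); rewrite mdeg_mono1 leqnn => /(_ isT).
by rewrite monomial_mono1 normrX.
Qed.

Lemma schwartz_schw psi : schwartz psi <-> schw psi.
Proof.
split=> -[hs h]; split => //.
  move=> m.
  have hB s : exists M, 0 <= M /\ forall x, wt x ^+ m * cmod (dw s psi x) <= M.
    have /choice[B hB] := fun i => h (mono1 i m) (fun i => count_mem i s).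
    have [B0 hB0] := h (fun=> 0%N) (fun i => count_mem i s).
    pose M := `|B0| + \sum_i `|B i|.
    have M0 : 0 <= M by rewrite addr_ge0// sumr_ge0.
    exists (2 ^+ m * (1 + n%:R) * M); split; first by rewrite !mulr_ge0 ?exprn_ge0// addr_ge0.
    move=> x; rewrite dw_mderiv//.
    apply: (@le_trans _ _ (2 ^+ m * (1 + \sum_i `|x 0 i| ^+ m) * cmod (mderiv (fun i => count_mem i s) psi x))).
      by rewrite ler_wpM2r ?cmod_ge0// wtX_le.
    rewrite -!mulrA ler_wpM2l ?exprn_ge0// !mulrDl !mul1r; apply: lerD.
      have := hB0 x; rewrite /monomial big1 ?normr1 ?mul1r; last by move=> i _; rewrite expr0.
      move=> /le_trans; apply; rewrite (le_trans (ler_norm _))// lerDl sumr_ge0//.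
    rewrite mulr_suml.
    rewrite (_ : n%:R * M = \sum_(i < n) M); last by rewrite sumr_const card_ord mulr_natl.
    apply: ler_sum => i _; have := hB i x; rewrite monomial_mono1 normrX => /le_trans; apply.
    rewrite (le_trans (ler_norm _))// /M ler_wpDl// (bigD1 i)//= lerDl sumr_ge0//.
  have /choice[B {}hB] := hB.
  have [M hM] := words_bound B m.
  by exists M => s sm x; have [_ hx] := hB s; exact: le_trans (hx x) (hM s sm).
move=> alpha beta.
have [M hM] := h (maxn (mdeg alpha) (mdeg beta)).
exists M => x; rewrite mderiv_word.
apply: le_trans (hM (word_of beta) _ x); last by rewrite size_word_of leq_maxr.
rewrite ler_wpM2r ?cmod_ge0//; exact: le_trans (monomial_le _ _) (ler_wtX _ (leq_maxl _ _)).
Qed.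

Definition stemp (u : functional R n) : Prop :=
  (forall (a : R[i]) psi1 psi2, schw psi1 -> schw psi2 ->
     u (fun x => a * psi1 x + psi2 x) = a * u psi1 + u psi2) /\
  (forall eps : R, 0 < eps -> exists (m : nat) (delta : R), 0 < delta /\
     forall psi, schw psi -> sn m psi delta -> cmod (u psi) < eps).

Lemma tempered_stemp u : tempered u <-> stemp u.
Proof.
split=> -[hl hc]; split.
- by move=> a p1 p2 /schwartz_schw h1 /schwartz_schw h2; exact: hl.
- move=> eps /hc[m [d [d0 H]]]; exists m, d; split => // psi hs hsn.
  apply: H; first exact/schwartz_schw.
  move=> alpha beta ha hb x; rewrite mderiv_word.
  apply: le_trans (hsn (word_of beta) _ x); last by rewrite size_word_of.
  rewrite ler_wpM2r ?cmod_ge0//; exact: le_trans (monomial_le _ _) (ler_wtX _ ha).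
- by move=> a p1 p2 /schwartz_schw h1 /schwartz_schw h2; exact: hl.
- move=> eps /hc[m [d [d0 H]]].
  (* The loss of [seminorm_wt] in passing from monomials to the weight. *)
  pose K : R := 2 ^+ m * (1 + n%:R).
  have K0 : 0 < K by rewrite mulr_gt0 ?exprn_gt0// ltr_pwDl.
  exists m, (d / K); split; first by rewrite divr_gt0.
  move=> psi hs hsn; apply: H; first exact/schwartz_schw.
  move=> s sm x.
  have -> : d = K * (d / K) by rewrite mulrC divfK// gt_eqF.
  apply: seminorm_wt; [by case: hs|by rewrite divr_ge0// ltW|].
  move=> alpha ha; apply: hsn => //.
  rewrite -size_word_of.
  suff /perm_size -> : perm_eq (word_of (fun i => count_mem i s)) s by [].
  by apply/allP => i _ /=; rewrite count_word_of.
Qed.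

Lemma dw_add s f g : smooth f -> smooth g -> dw s (fun x => f x + g x) = fun x => dw s f x + dw s g x.
Proof.
move=> hf hg; elim: s => [|i s IH]; first by rewrite !dw_nil.
by rewrite !dw_cons IH; apply: pd_add; exact: smooth_dw.
Qed.

Lemma dw_cM s (c : R[i]) f : smooth f -> dw s (fun x => c * f x) = fun x => c * dw s f x.
Proof.
move=> hf; elim: s => [|i s IH]; first by rewrite !dw_nil.
rewrite !dw_cons IH (pd_mul i (smooth_cst c) (smooth_dw s hf)) pd_cst.
by apply/funext => x; rewrite mul0r add0r.
Qed.

(** Each derivative falls on one of the two factors, which doubles the number of terms; only the
    count [2 ^+ size s] is kept. The induction removes the last letter, the one that acts on the
    product first. *)
Lemma leibniz_bound s f g x (A B : R) : smooth f -> smooth g -> 0 <= A -> 0 <= B ->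
  (forall s1, (size s1 <= size s)%N -> cmod (dw s1 f x) <= A) ->
  (forall s1, (size s1 <= size s)%N -> cmod (dw s1 g x) <= B) ->
  cmod (dw s (fun x => f x * g x) x) <= 2 ^+ size s * (A * B).
Proof.
elim/last_ind: s f g => [|s i IH] f g hf hg A0 B0 hA hB.
  rewrite dw_nil expr0 mul1r cmodM; apply: ler_pM; [exact: cmod_ge0|exact: cmod_ge0|exact: (hA [::])|exact: (hB [::])].
have hf' := smooth_pd i hf; have hg' := smooth_pd i hg.
rewrite dw_rcons (pd_mul i hf hg) (dw_add _ (smoothM hf' hg) (smoothM hf hg')).
have sr : (size s <= size (rcons s i))%N by rewrite size_rcons.
rewrite size_rcons exprS -mulrA mulr2n mulrDl mul1r.
apply: (le_trans (cmodD _ _)); apply: lerD.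
  apply: (IH _ _ hf' hg A0 B0) => s1 h1.
    by rewrite -dw_rcons hA// !size_rcons.
  by rewrite hB// (leq_trans h1).
apply: (IH _ _ hf hg' A0 B0) => s1 h1.
  by rewrite hA// (leq_trans h1).
by rewrite -dw_rcons hB// !size_rcons.
Qed.

(** The growth exponent [k] is common to all orders of derivation; multiplication by such a function
    preserves the Schwartz space ([sop_mul]). *)
Definition tame (k : nat) g := smooth g /\ forall m, exists2 C : R, 0 <= C &
  forall s, (size s <= m)%N -> forall x, cmod (dw s g x) <= C * wt x ^+ k.

(** Continuous linear operators of the Schwartz space; continuity is quantitative, so that constants
    multiply under composition. *)
Definition sop (T : (V -> R[i]) -> (V -> R[i])) := [/\
  forall psi, schw psi -> schw (T psi),
  forall (a : R[i]) psi1 psi2, schw psi1 -> schw psi2 ->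
     T (fun x => a * psi1 x + psi2 x) = fun x => a * T psi1 x + T psi2 x &
  forall m, exists m', exists2 C : R, 0 <= C & forall psi M, schw psi -> sn m' psi M -> sn m (T psi) (C * M)].

Lemma sop_intro T : (forall psi, schw psi -> smooth (T psi)) ->
  (forall (a : R[i]) psi1 psi2, schw psi1 -> schw psi2 ->
     T (fun x => a * psi1 x + psi2 x) = fun x => a * T psi1 x + T psi2 x) ->
  (forall m, exists m', exists2 C : R, 0 <= C & forall psi M, schw psi -> sn m' psi M -> sn m (T psi) (C * M)) ->
  sop T.
Proof.
move=> h1 h2 h3; split => // psi hp; split; first exact: h1.
move=> m; have [m' [C C0 H]] := h3 m; have [_ /(_ m')[M hM]] := hp.
by exists (C * M); exact: H.
Qed.

Lemma sop_comp T T' : sop T -> sop T' -> sop (fun psi => T' (T psi)).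
Proof.
move=> [a1 a2 a3] [b1 b2 b3]; split.
- by move=> psi /a1 /b1.
- by move=> a p1 p2 h1 h2; rewrite a2// b2//; exact: a1.
- move=> m; have [m' [C C0 H]] := b3 m; have [m'' [D D0 K]] := a3 m'.
  exists m'', (C * D); first exact: mulr_ge0.
  by move=> psi M hp hM; rewrite -mulrA; apply: H; [exact: a1|exact: K].
Qed.

Lemma stemp_sop u T : stemp u -> sop T -> stemp (fun psi => u (T psi)).
Proof.
move=> [ul uc] [a1 a2 a3]; split.
- by move=> a p1 p2 h1 h2; rewrite a2// ul//; exact: a1.
- move=> eps /uc[m [d [d0 H]]]; have [m' [C C0 K]] := a3 m.
  (* [C] may vanish, hence [C + 1]. *)
  exists m', (d / (C + 1)); split; first by rewrite divr_gt0// ltr_wpDl.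
  move=> psi hp hsn; apply: H; first exact: a1.
  apply: sn_leM (K _ _ hp hsn).
  by rewrite mulrCA ler_piMr ?(ltW d0)// ler_pdivrMr ?ltr_wpDl// mul1r lerDl.
Qed.

Lemma schw_smooth psi : schw psi -> smooth psi. Proof. by case. Qed.

Lemma schwD psi1 psi2 (a : R[i]) : schw psi1 -> schw psi2 -> schw (fun x => a * psi1 x + psi2 x).
Proof.
move=> [s1 h1] [s2 h2]; split.
  exact: (smoothD (smoothM (smooth_cst a) s1) s2).
move=> m; have [M1 H1] := h1 m; have [M2 H2] := h2 m.
exists (cmod a * M1 + M2) => s sm x.
rewrite (dw_add _ (smoothM (smooth_cst a) s1) s2) (dw_cM _ _ s1); apply: (@le_trans _ _ (wt x ^+ m * (cmod a * cmod (dw s psi1 x) + cmod (dw s psi2 x)))).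
  by rewrite ler_wpM2l ?wtX_ge0// -cmodM; exact: cmodD.
rewrite mulrDr mulrCA lerD//; last exact: H2.
by rewrite ler_wpM2l ?cmod_ge0//; exact: H1.
Qed.

Lemma schw0 : schw (fun=> 0).
Proof.
split; first exact: smooth_cst.
move=> m; exists 0 => s _ x.
have -> : dw s (fun _ : V => (0 : R[i])) = fun=> 0 by elim: s => [|i s IH]; [exact: dw_nil|rewrite dw_cons IH; exact: pd_cst].
by rewrite cmod0 mulr0 lexx.
Qed.

Lemma sop_pd i : sop (@pd R n i).
Proof.
apply: sop_intro => [psi [h _]|a p1 p2 [h1 _] [h2 _]|m]; first exact: smooth_pd.
  rewrite (pd_add _ (smoothM (smooth_cst a) h1) h2) (pd_mul _ (smooth_cst a) h1).
  by apply/funext => x; rewrite pd_cst mul0r add0r.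
exists m.+1, 1 => // psi M _ hM s sm x; rewrite -dw_rcons mul1r.
apply: le_trans (hM (rcons s i) _ x); last by rewrite size_rcons.
by rewrite ler_wpM2r ?cmod_ge0// ler_wtX// leqnSn.
Qed.

Lemma sop_mul k g : tame k g -> sop (fun psi x => g x * psi x).
Proof.
move=> [hg tg]; apply: sop_intro => [psi [h _]|a p1 p2 _ _|m]; first exact: smoothM.
  by apply/funext => x; ring.
have [C C0 hC] := tg m.
exists (m + k)%N, (2 ^+ m * C); first by rewrite mulr_ge0// exprn_ge0.
move=> psi M [hp _] hM s sm x.
have w0 := wtX_gt0 x (m + k); have M0 := sn_ge0 hM.
pose K := (C * wt x ^+ k) * (M / wt x ^+ (m + k)).
have K0 : 0 <= K by rewrite !mulr_ge0 ?invr_ge0 ?wtX_ge0.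
apply: (@le_trans _ _ (wt x ^+ m * (2 ^+ m * K))).
  rewrite ler_wpM2l ?wtX_ge0//.
  apply: (@le_trans _ _ (2 ^+ size s * K)).
    apply: (leibniz_bound hg hp).
    - by rewrite mulr_ge0 ?wtX_ge0.
    - by rewrite divr_ge0 ?wtX_ge0.
    - by move=> s1 s1s; apply: hC; exact: leq_trans s1s sm.
    - move=> s1 s1s; rewrite ler_pdivlMr// mulrC; apply: hM.
      by rewrite (leq_trans s1s)// (leq_trans sm)// leq_addr.
  by rewrite ler_wpM2r// ler_weXn2l// ler1n.
rewrite /K exprD le_eqVlt; apply/orP; left; apply/eqP; field.
by rewrite !expf_neq0// gt_eqF ?wt_gt0.
Qed.

Lemma tame_coord_bound i s (x : V) : cmod (dw s (fun x : V => (x 0 i)%:C%C) x) <= wt x.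
Proof.
elim/last_ind: s => [|s j _].
  by rewrite dw_nil cmod_real (le_trans (ler_coord_norm _ _))// /wt lerDr.
rewrite dw_rcons (ispd_pd (@ispd_coord _ _ j i)); case: s => [|l s].
  by rewrite dw_nil cmod_real; case: (_ == _); rewrite ?normr1 ?normr0 ?wt_ge0 ?wt_ge1.
have -> : dw (l :: s) (fun _ : V => ((j == i)%:R : R)%:C%C) = fun=> 0.
  elim: s l => [|l' s IH] l; first exact: pd_cst.
  by rewrite dw_cons IH pd_cst.
by rewrite cmod0 wt_ge0.
Qed.

Lemma tame_coord i : tame 1 (fun x : V => (x 0 i)%:C%C).
Proof.
split; first exact: smooth_coord.
move=> m; exists 1 => // s _ x; rewrite mul1r expr1; exact: tame_coord_bound.
Qed.

Lemma tame_cst (c : R[i]) : tame 0 (fun _ : V => c).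
Proof.
split; first exact: smooth_cst.
move=> m; exists (cmod c); first exact: cmod_ge0.
move=> s _ x; rewrite expr0 mulr1; case/lastP: s => [//|s j].
rewrite dw_rcons pd_cst.
have -> : dw s (fun _ : V => (0 : R[i])) = fun=> 0 by elim: s => [|i s IH]; [exact: dw_nil|rewrite dw_cons IH; exact: pd_cst].
by rewrite cmod0 cmod_ge0.
Qed.

End seminorms.

(** * Integration of complex-valued functions *)

Section lipschitz.
Context {R : realType} {n : nat}.
Local Notation V := 'rV[R]_n.
Local Notation e i := (delta_mx 0 i : V).

(** [z k] takes its first [k] coordinates from [x] and the others from [x0]. Consecutive points
    differ in one coordinate, and the segments between them stay in the sup-norm ball, a box, where
    the bound [M] applies. *)
Lemma lip_coord (f : V -> R) (f' : 'I_n -> V -> R) (x0 : V) (r M : R) :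
  (forall i y, is_derive y (e i) f (f' i y)) ->
  (forall i y, `|y - x0| <= r -> `|f' i y| <= M) ->
  forall x, `|x - x0| <= r -> `|f x - f x0| <= n%:R * M * `|x - x0|.
Proof.
move=> hf hM x xr.
pose z (k : nat) : V := \row_j (if (j < k)%N then x 0 j else x0 0 j).
have z0 : z 0%N = x0 by apply/rowP => j; rewrite mxE.
have zn : z n = x by apply/rowP => j; rewrite mxE ltn_ord.
have zd (k : 'I_n) s : `|s| <= `|x 0 k - x0 0 k| -> `|z k + s *: e k - x0| <= `|x - x0|.
  move=> hs; apply: norm_rV_le => // j; rewrite !mxE eqxx /=.
  have [->|jk] := eqVneq j k.
    rewrite ltnn mulr1 addrAC subrr add0r (le_trans hs)//.
    by have := ler_coord_norm (x - x0) k; rewrite !mxE.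
  rewrite mulr0 addr0; case: ifP => _; last by rewrite subrr normr0.
  by have := ler_coord_norm (x - x0) j; rewrite !mxE.
have step (k : 'I_n) : `|f (z k.+1) - f (z k)| <= M * `|x - x0|.
  have -> : z k.+1 = z k + (x 0 k - x0 0 k) *: e k.
    apply/rowP => j; rewrite !mxE eqxx /= ltnS leq_eqVlt.
    have [/val_inj ->|jk] := eqVneq (val j) (val k).
      by rewrite ltnn eqxx mulr1 addrC subrK.
    have -> : (j == k) = false by apply/negbTE; apply: contra jk => /eqP ->.
    by rewrite mulr0 addr0.
  have [x1 x2] := (ler_coord_norm (x - x0) k, I); rewrite !mxE in x1.
  have M0 : 0 <= M by apply: le_trans (normr_ge0 (f' k x0)) _; apply: hM; rewrite subrr normr0 (le_trans _ xr).
  apply: (@le_trans _ _ (`|x 0 k - x0 0 k| * M)).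
    apply: (@line_bound _ _ f (f' k) (z k) (e k)) => // s hs.
    by apply: hM; apply: le_trans (zd k s hs) xr.
  by rewrite mulrC ler_wpM2l.
have -> : f x - f x0 = \sum_(k < n) (f (z k.+1) - f (z k)).
  rewrite -zn -{1}z0 -(big_mkord xpredT (fun k => f (z k.+1) - f (z k))).
  by rewrite telescope_sumr.
apply: (le_trans (ler_norm_sum _ _ _)).
apply: (@le_trans _ _ (\sum_(k < n) M * `|x - x0|)).
  by apply: ler_sum => k _; exact: step.
by rewrite sumr_const card_ord -mulrA mulr_natl.
Qed.

Lemma lip_at (W : normedModType R) (f : W -> R) x0 (K : R) :
  (forall x, `|x - x0| <= 1 -> `|f x - f x0| <= K * `|x - x0|) -> {for x0, continuous f}.
Proof.
move=> h; apply/cvgrPdist_lt => eps eps0.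
have K0 : 0 < `|K| + 1 by rewrite ltr_wpDl.
near=> x.
have x1 : `|x - x0| <= 1.
  by rewrite distrC; near: x; apply: cvgr_dist_le => //; exact: cvg_id.
have x2 : `|x - x0| < eps / (`|K| + 1).
  by rewrite distrC; near: x; apply: cvgr_dist_lt; [exact: cvg_id|rewrite divr_gt0].
rewrite distrC; apply: (le_lt_trans (h x x1)).
apply: (@le_lt_trans _ _ ((`|K| + 1) * `|x - x0|)).
  by rewrite ler_wpM2r// ler_wpDr// ler_norm.
by rewrite mulrC -ltr_pdivlMr.
Unshelve. all: by end_near. Qed.

(** For Fourier integrals and convolutions, bounds on the first derivatives are at hand; this lemma
    turns them into continuity. *)
Lemma lip_continuous (f : V -> R) (f' : 'I_n -> V -> R) :
  (forall i y, is_derive y (e i) f (f' i y)) ->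
  (forall x0, exists M, forall i y, `|y - x0| <= 1 -> `|f' i y| <= M) -> continuous f.
Proof.
move=> hf hM x0; have [M {}hM] := hM x0.
apply: (@lip_at V f x0 (n%:R * M)) => x x1.
exact: (lip_coord hf hM x1).
Qed.

Lemma const_coord (f : V -> R) : (forall i y, is_derive y (e i) f 0) -> forall x, f x = f 0.
Proof.
move=> hf x; apply/eqP; rewrite -subr_eq0 -normr_eq0 eq_le normr_ge0 andbT.
have := @lip_coord f (fun _ _ => 0) 0 `|x| 0 hf.
move=> /(_ (fun i y _ => _) x); rewrite subr0 => /(_ _ (lexx _)).
by rewrite mulr0 mul0r; apply; rewrite normr0.
Qed.

End lipschitz.

Section complex_integral.
Context {R : realType} {n : nat}.
Local Notation V := 'rV[R]_n.
Local Notation L := (@lebesgue_rV R n).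
Implicit Types (f g : V -> R[i]).

Definition cm f := measurable_fun setT (reC f) /\ measurable_fun setT (imC f).
Definition ci f := L.-integrable setT (EFin \o reC f) /\ L.-integrable setT (EFin \o imC f).

Lemma measurable_sqrt : measurable_fun setT (@Num.sqrt R).
Proof. by apply: continuous_measurable_fun; exact: sqrt_continuous. Qed.

Lemma measurable_cmod d (T : measurableType d) (f : T -> R[i]) :
  measurable_fun setT (fun x => complex.Re (f x)) -> measurable_fun setT (fun x => complex.Im (f x)) ->
  measurable_fun setT (fun x => cmod (f x)).
Proof.
move=> m1 m2; rewrite (_ : (fun x => _) = Num.sqrt \o (fun x => complex.Re (f x) ^+ 2 + complex.Im (f x) ^+ 2)).
  by apply: measurableT_comp; [exact: measurable_sqrt|apply: measurable_funD; exact: measurable_funX].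
by apply/funext => x; rewrite cmodE.
Qed.

Lemma cm_cmod f : cm f -> measurable_fun setT (fun x => cmod (f x)).
Proof. by move=> [m1 m2]; exact: measurable_cmod. Qed.

Lemma ci_cm f : ci f -> cm f.
Proof.
by move=> [/measurable_int h1 /measurable_int h2]; split; apply/measurable_EFinP.
Qed.

Lemma cmD f g : cm f -> cm g -> cm (fun x => f x + g x).
Proof.
move=> [h1 h2] [h3 h4]; split.
  by rewrite /reC; under eq_fun do rewrite cReD; exact: measurable_funD.
by rewrite /imC; under eq_fun do rewrite cImD; exact: measurable_funD.
Qed.

Lemma cmM f g : cm f -> cm g -> cm (fun x => f x * g x).
Proof.
move=> [h1 h2] [h3 h4]; split.
  by rewrite /reC; under eq_fun do rewrite cReM; apply: measurable_funB; exact: measurable_funM.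
by rewrite /imC; under eq_fun do rewrite cImM; apply: measurable_funD; exact: measurable_funM.
Qed.

Lemma cm_cst (c : R[i]) : cm (fun=> c).
Proof. by split; exact: measurable_cst. Qed.

Lemma cm_cts f : continuous (reC f) -> continuous (imC f) -> cm f.
Proof. by move=> c1 c2; split; exact: continuous_measurable_rV. Qed.

Lemma smooth_cm f : smooth f -> cm f.
Proof. by move=> h; apply: cm_cts; [exact: smooth_ctsRe|exact: smooth_ctsIm]. Qed.

Lemma gintZl (a : R) (G : V -> R) : 0 <= a -> measurable_fun setT G -> (forall x, 0 <= G x) ->
  (\int[L]_x (a * G x)%:E = a%:E * \int[L]_x (G x)%:E)%E.
Proof.
move=> a0 mG G0; under eq_integral do rewrite EFinM.
by rewrite ge0_integralZl ?lee_fin//; [exact/measurable_EFinP|move=> x _; rewrite lee_fin].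
Qed.

Lemma integrable_dom (f G : V -> R) : measurable_fun setT f -> measurable_fun setT G ->
  (forall x, `|f x| <= G x) -> (\int[L]_x (G x)%:E < +oo)%E -> L.-integrable setT (EFin \o f).
Proof.
move=> mf mG fG iG; apply/integrableP; split; first exact/measurable_EFinP.
apply: le_lt_trans iG; apply: ge0_le_integral => //.
- by apply: measurableT_comp => //; exact/measurable_EFinP.
- exact/measurable_EFinP.
- by move=> x _; rewrite /= lee_fin.
Qed.

Lemma ci_dom f (G : V -> R) : cm f -> measurable_fun setT G ->
  (forall x, cmod (f x) <= G x) -> (\int[L]_x (G x)%:E < +oo)%E -> ci f.
Proof.
move=> [m1 m2] mG fG iG; split; apply: (integrable_dom _ mG) => // x.
  exact: le_trans (Re_le_cmod _) (fG x).
exact: le_trans (Im_le_cmod _) (fG x).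
Qed.

Lemma ci_lty f : ci f -> (\int[L]_x (cmod (f x))%:E < +oo)%E.
Proof.
move=> [/integrableP[m1 i1] /integrableP[m2 i2]].
have m1' := m1; have m2' := m2; move/measurable_EFinP : m1' => m1'; move/measurable_EFinP : m2' => m2'.
apply: (@le_lt_trans _ _ (\int[L]_x (`|(reC f x)%:E| + `|(imC f x)%:E|))%E).
  apply: ge0_le_integral => //.
  - by move=> x _; rewrite lee_fin cmod_ge0.
  - by apply/measurable_EFinP; exact: cm_cmod.
  - by apply: emeasurable_funD; apply: measurableT_comp.
  - by move=> x _; rewrite /= lee_fin; exact: cmod_le_ReIm.
rewrite ge0_integralD//; [|exact: measurableT_comp|exact: measurableT_comp].
exact: lte_add_pinfty.
Qed.

Lemma ci_cmodP f : cm f -> (\int[L]_x (cmod (f x))%:E < +oo)%E -> ci f.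
Proof. by move=> mf h; apply: (ci_dom mf (cm_cmod mf)). Qed.

Lemma ciZ (c : R[i]) f : ci f -> ci (fun x => c * f x).
Proof.
move=> h; have mf := ci_cm h; apply: ci_cmodP; first by apply: cmM => //; exact: cm_cst.
under eq_integral do rewrite cmodM EFinM.
rewrite ge0_integralZl//.
- by rewrite lte_mul_pinfty ?lee_fin ?cmod_ge0//; exact: ci_lty.
- by apply/measurable_EFinP; exact: cm_cmod.
- by move=> x _; rewrite lee_fin cmod_ge0.
- by rewrite lee_fin cmod_ge0.
Qed.

Lemma cintD f g : ci f -> ci g -> cintegral (fun x => f x + g x) = cintegral f + cintegral g.
Proof.
move=> [h1 h2] [h3 h4]; apply: cplx_eq; rewrite ?cReD ?cImD /=.
  by rewrite -RintegralD//; apply: eq_Rintegral => x _; rewrite /reC cReD.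
by rewrite -RintegralD//; apply: eq_Rintegral => x _; rewrite /imC cImD.
Qed.

Lemma cintZ (c : R[i]) f : ci f -> cintegral (fun x => c * f x) = c * cintegral f.
Proof.
move=> [h1 h2]; have iZ (a : R) (g : V -> R) : L.-integrable setT (EFin \o g) -> L.-integrable setT (EFin \o (fun x => a * g x)).
  by move=> hg; rewrite (_ : EFin \o _ = (fun x => a%:E * (EFin \o g) x)%E);
    [exact: integrableZl|apply/funext => x; rewrite /= EFinM].
apply: cplx_eq; rewrite ?cReM ?cImM /=.
  rewrite -!RintegralZl// -RintegralB//; [|exact: iZ|exact: iZ].
  by apply: eq_Rintegral => x _; rewrite /reC cReM.
rewrite -!RintegralZl// -RintegralD//; [|exact: iZ|exact: iZ].
by apply: eq_Rintegral => x _; rewrite /imC cImM.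
Qed.

(** The factor 2 comes from estimating the real and imaginary parts separately. It reappears in
    [fbd] and in [mor_conv]. *)
Lemma cmod_cint f : ci f -> ((cmod (cintegral f))%:E <= 2%:E * \int[L]_x (cmod (f x))%:E)%E.
Proof.
move=> cf; have [h1 h2] := cf.
have mf := cm_cmod (ci_cm cf).
have bnd (g : V -> R) : L.-integrable setT (EFin \o g) -> (forall x, `|g x| <= cmod (f x)) ->
    (`|\int[L]_x g x|%:E <= \int[L]_x (cmod (f x))%:E)%E.
  move=> ig gf; rewrite EFin_normr_Rintegral//.
  apply: (le_trans (le_abse_integral _ _ _)) => //; first exact: measurable_int ig.
  apply: ge0_le_integral => //.
  - by apply: measurableT_comp => //; exact: measurable_int ig.
  - exact/measurable_EFinP.
  - by move=> x _; rewrite /= lee_fin.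
apply: (@le_trans _ _ ((`|\int[L]_x reC f x|)%:E + (`|\int[L]_x imC f x|)%:E)%E).
  by rewrite -EFinD lee_fin; exact: cmod_le_ReIm.
rewrite (_ : 2%:E = 1%:E + 1%:E :> \bar R)%E; last by rewrite -EFinD.
rewrite ge0_muleDl// mul1e; apply: leeD; apply: bnd => // x.
  exact: Re_le_cmod.
exact: Im_le_cmod.
Qed.

Lemma cmod_cint_le f (G : V -> R) : ci f -> measurable_fun setT G -> (forall x, cmod (f x) <= G x) ->
  (\int[L]_x (G x)%:E < +oo)%E -> cmod (cintegral f) <= 2 * fine (\int[L]_x (G x)%:E)%E.
Proof.
move=> cf mG fG iG; rewrite -lee_fin EFinM.
apply: (le_trans (cmod_cint cf)).
have G0 x : 0 <= G x by exact: le_trans (cmod_ge0 _) (fG x).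
rewrite fineK; last first.
  by rewrite ge0_fin_numE//; apply: integral_ge0 => x _; rewrite lee_fin.
rewrite lee_pmul2l ?lte_fin//; apply: ge0_le_integral => //.
- by move=> x _; rewrite lee_fin cmod_ge0.
- by apply/measurable_EFinP; apply: cm_cmod; exact: ci_cm.
- exact/measurable_EFinP.
- by move=> x _; rewrite lee_fin.
Qed.

Lemma eq_cint f g : f =1 g -> cintegral f = cintegral g.
Proof. by move=> h; congr cintegral; exact/funext. Qed.

Lemma integrable_affine (a : R) (v : V) (f : V -> R) : a != 0 ->
  L.-integrable setT (EFin \o f) ->
  L.-integrable setT (EFin \o (fun x => f (a *: x + v))) /\
  \int[L]_x f (a *: x + v) = `|a| ^- n * \int[L]_x f x.
Proof.
move=> a0 /[dup] intf /integrableP[mf fi].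
have mT := @measurable_affine_rV R n a v.
have ma : measurable_fun setT (EFin \o (fun x => f (a *: x + v))) by exact: (measurableT_comp mf mT).
have an : 0 <= `|a| ^- n by rewrite invr_ge0 exprn_ge0.
split.
  apply/integrableP; split => //.
  have := @ge0_integral_affine_rV R n a v (fun x => `|(f x)%:E|%E) a0.
  have m' : measurable_fun setT (fun x => `|(f x)%:E|%E) by exact: (@measurableT_comp _ _ _ _ _ _ abse _ (EFin \o f)).
  by move=> /(_ m' (fun x => abse_ge0 _)) E; rewrite [ltLHS]E lte_mul_pinfty.
rewrite /Rintegral [in LHS]integralE [in RHS]integralE.
rewrite (_ : (fun x => (f (a *: x + v))%:E)^\+%E = (fun x => ((EFin \o f)^\+ (a *: x + v)%R))%E)//.
rewrite (_ : (fun x => (f (a *: x + v))%:E)^\-%E = (fun x => ((EFin \o f)^\- (a *: x + v)%R))%E)//.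
rewrite !ge0_integral_affine_rV//; [|exact: measurable_funeneg|exact: measurable_funepos].
rewrite -muleBr//; last first.
  by apply: fin_num_adde_defr; exact: integrable_pos_fin_num.
rewrite -integralE fineM//.
  by apply: (@integrable_fin_num _ _ _ L setT measurableT (EFin \o f)).
all: by apply/funext => x; rewrite ?funenegE ?funeposE.
Qed.

Lemma ci_affine (a : R) (v : V) f : a != 0 -> ci f -> ci (fun x => f (a *: x + v)).
Proof.
move=> a0 [h1 h2]; split.
  by have [] := integrable_affine v a0 h1.
by have [] := integrable_affine v a0 h2.
Qed.

Lemma cint_affine (a : R) (v : V) f : a != 0 -> ci f ->
  cintegral (fun x => f (a *: x + v)) = (`|a| ^- n)%:C%C * cintegral f.
Proof.
move=> a0 [h1 h2]; apply: cplx_eq; rewrite ?mulCr_Re ?mulCr_Im /=.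
  by have [_] := integrable_affine v a0 h1.
by have [_] := integrable_affine v a0 h2.
Qed.

Lemma cint_cvg (f_ : nat -> V -> R[i]) f (G : V -> R) : (forall k, cm (f_ k)) -> cm f ->
  (forall x, (fun k => complex.Re (f_ k x)) @ \oo --> complex.Re (f x)) ->
  (forall x, (fun k => complex.Im (f_ k x)) @ \oo --> complex.Im (f x)) ->
  measurable_fun setT G -> (forall k x, cmod (f_ k x) <= G x) -> (\int[L]_x (G x)%:E < +oo)%E ->
  (fun k => complex.Re (cintegral (f_ k))) @ \oo --> complex.Re (cintegral f) /\
  (fun k => complex.Im (cintegral (f_ k))) @ \oo --> complex.Im (cintegral f).
Proof.
move=> mf_ mf cR cI mG fG iG.
have iGG : L.-integrable setT (EFin \o G).
  apply: (integrable_dom mG mG) => // x.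
  by rewrite ger0_norm//; exact: le_trans (cmod_ge0 (f_ 0%N x)) (fG _ _).
have key (g_ : nat -> V -> R) (g : V -> R) : (forall k, measurable_fun setT (g_ k)) -> measurable_fun setT g ->
    (forall x, (fun k => g_ k x) @ \oo --> g x) -> (forall k x, `|g_ k x| <= G x) ->
    (fun k => \int[L]_x g_ k x) @ \oo --> \int[L]_x g x.
  move=> mg_ mg cg gG.
  have [|||||ig _ c] := @dominated_convergence _ _ _ L setT measurableT (fun k => EFin \o g_ k) (EFin \o g) (EFin \o G).
  - by move=> k; apply/measurable_EFinP.
  - exact/measurable_EFinP.
  - by apply: aeW => x _; apply/cvg_EFin; [exact: nearW|exact: cg].
  - exact: iGG.
  - by apply: aeW => x k _; rewrite /= lee_fin.
  rewrite /Rintegral; apply: fine_cvg; rewrite fineK//; exact: integrable_fin_num.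
split; apply: key => //; try by move=> k; have [] := mf_ k.
- by case: mf.
- by move=> k x; exact: le_trans (Re_le_cmod _) (fG k x).
- by case: mf.
- by move=> k x; exact: le_trans (Im_le_cmod _) (fG k x).
Qed.

(** Domination by a product of integrable functions gives integrability on the product and also, at
    every point rather than almost every one, in each variable; the inner integrals are therefore
    genuine everywhere. *)
Lemma cint_Fubini (K : V -> V -> R[i]) (G1 G2 : V -> R) :
  measurable_fun setT (fun z : V * V => complex.Re (K z.1 z.2)) ->
  measurable_fun setT (fun z : V * V => complex.Im (K z.1 z.2)) ->
  measurable_fun setT G1 -> measurable_fun setT G2 -> (forall x, 0 <= G1 x) -> (forall x, 0 <= G2 x) ->
  (forall x y, cmod (K x y) <= G1 x * G2 y) ->
  (\int[L]_x (G1 x)%:E < +oo)%E -> (\int[L]_x (G2 x)%:E < +oo)%E ->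
  [/\ ci (fun x => cintegral (K x)), ci (fun y => cintegral (K^~ y)) &
  cintegral (fun x => cintegral (K x)) = cintegral (fun y => cintegral (K^~ y))].
Proof.
move=> mR mI mG1 mG2 G10 G20 KG iG1 iG2.
have key (k : V -> V -> R) (H1 H2 : V -> R) : measurable_fun setT H1 -> measurable_fun setT H2 ->
   (forall x, 0 <= H1 x) -> (forall x, 0 <= H2 x) ->
  (\int[L]_x (H1 x)%:E < +oo)%E -> (\int[L]_x (H2 x)%:E < +oo)%E -> measurable_fun setT (fun z : V * V => k z.1 z.2) ->
   (forall x y, `|k x y| <= H1 x * H2 y) ->
   L.-integrable setT (EFin \o (fun x => \int[L]_y k x y)) /\
       \int[L]_x \int[L]_y k x y = \int[L]_y \int[L]_x k x y.
  move=> mH1 mH2 H10 H20 iH1 iH2 mk kG.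
  have mk' : measurable_fun setT (EFin \o (fun z : V * V => k z.1 z.2)) by exact/measurable_EFinP.
  have i1 x : L.-integrable setT (EFin \o k x).
    apply: (@integrable_dom _ (fun y => H1 x * H2 y)) => //.
    - exact: (measurableT_comp mk (measurable_pair1 x)).
    - exact: measurable_funM.
    - by rewrite gintZl// lte_mul_pinfty ?lee_fin.
  have i2 y : L.-integrable setT (EFin \o k^~ y).
    apply: (@integrable_dom _ (fun x => H1 x * H2 y)) => //.
    - exact: (measurableT_comp mk (measurable_pair2 y)).
    - exact: measurable_funM.
    - under eq_integral do rewrite mulrC.
      by rewrite gintZl// lte_mul_pinfty ?lee_fin.
  have ik : (L \x L)%E.-integrable setT (EFin \o (fun z : V * V => k z.1 z.2)).
    apply/integrable12ltyP => //.
    apply: (@le_lt_trans _ _ (\int[L]_x ((H1 x)%:E * \int[L]_y (H2 y)%:E))%E).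
      apply: ge0_le_integral => //.
      - by move=> x _; apply: integral_ge0 => y _.
      - apply: (@measurable_fun_fubini_tonelli_F _ _ _ _ _ L (abse \o (EFin \o (fun z : V * V => k z.1 z.2)))).
          exact: measurableT_comp.
        by move=> z; exact: abse_ge0.
      - by apply: emeasurable_funM; [exact/measurable_EFinP|exact: measurable_cst].
      - move=> x _; rewrite -gintZl//.
        apply: ge0_le_integral => //.
        + by apply: measurableT_comp => //; exact: measurable_int (i1 x).
        + by apply/measurable_EFinP; apply: measurable_funM.
        + by move=> y _; rewrite /= lee_fin.
    have I2 : (0 <= \int[L]_y (H2 y)%:E)%E by apply: integral_ge0 => y _; rewrite lee_fin.
    have fH2 : (\int[L]_y (H2 y)%:E)%E \is a fin_num by rewrite ge0_fin_numE.
    rewrite -(fineK fH2); under eq_integral do rewrite -EFinM mulrC.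
    by rewrite gintZl ?fine_ge0// lte_mul_pinfty ?lee_fin ?fine_ge0.
  have E1 : EFin \o (fun x => \int[L]_y k x y) = fubini_F L (EFin \o (fun z : V * V => k z.1 z.2)).
    by apply/funext => x; rewrite /= /Rintegral fineK//; exact: integrable_fin_num (i1 x).
  have E2 : EFin \o (fun y => \int[L]_x k x y) = fubini_G L (EFin \o (fun z : V * V => k z.1 z.2)).
    by apply/funext => x; rewrite /= /Rintegral fineK//; exact: integrable_fin_num (i2 x).
  split.
  - rewrite E1; exact: integrable_fubini_F.
  - rewrite /Rintegral; congr fine.
    transitivity (\int[L]_x (fubini_F L (EFin \o (fun z : V * V => k z.1 z.2)) x))%E.
      by apply: eq_integral => x _; rewrite -E1.
    transitivity (\int[L]_y (fubini_G L (EFin \o (fun z : V * V => k z.1 z.2)) y))%E.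
      exact: Fubini.
    by apply: eq_integral => y _; rewrite -E2.
have bR x y := le_trans (Re_le_cmod _) (KG x y); have bI x y := le_trans (Im_le_cmod _) (KG x y).
have KG' x y : cmod (K y x) <= G2 x * G1 y by rewrite mulrC.
have bR' x y := le_trans (Re_le_cmod _) (KG' x y); have bI' x y := le_trans (Im_le_cmod _) (KG' x y).
have [a1 a3] := key (fun x y => complex.Re (K x y)) G1 G2 mG1 mG2 G10 G20 iG1 iG2 mR bR.
have [b1 b3] := key (fun x y => complex.Im (K x y)) G1 G2 mG1 mG2 G10 G20 iG1 iG2 mI bI.
have [a2 _] := key (fun x y => complex.Re (K y x)) G2 G1 mG2 mG1 G20 G10 iG2 iG1 (measurableT_comp mR (@measurable_swap _ _ V V)) bR'.
have [b2 _] := key (fun x y => complex.Im (K y x)) G2 G1 mG2 mG1 G20 G10 iG2 iG1 (measurableT_comp mI (@measurable_swap _ _ V V)) bI'.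
by split; [split|split|apply: cplx_eq].
Qed.

End complex_integral.

(** * The Fourier transform *)

Section decay_class.
Context {R : realType} {n : nat}.
Local Notation V := 'rV[R]_n.
Local Notation L := (@lebesgue_rV R n).
Implicit Types (f g psi : V -> R[i]).

Definition dk (k : nat) f := cm f /\ exists2 C : R, 0 <= C & forall x, cmod (f x) <= C * wt x ^- k.

Lemma wtVX_ge0 (x : V) k : 0 <= wt x ^- k.
Proof. by rewrite invr_ge0 wtX_ge0. Qed.

Lemma wtVX_gt0 (x : V) k : 0 < wt x ^- k.
Proof. by rewrite invr_gt0 wtX_gt0. Qed.

Lemma wtVX_le (x : V) j k : (j <= k)%N -> wt x ^- k <= wt x ^- j.
Proof. by move=> jk; rewrite lef_pV2 ?posrE ?wtX_gt0// ler_wtX. Qed.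

(** Peetre's inequality, from the submultiplicativity of [wt] applied to [x = (x + y) - y]: a
    translation costs only a power of the weight of the shift. *)
Lemma wt_peetre (x y : V) k : wt (x + y) ^- k <= wt y ^+ k * wt x ^- k.
Proof.
rewrite ler_pdivlMr ?wtX_gt0// mulrC ler_pdivrMr ?wtX_gt0// mulrC -exprMn.
apply: lerXn2r; rewrite ?nnegrE ?mulr_ge0 ?wt_ge0//.
by rewrite -{1}(addrK y x) -[wt y]wtN wtD.
Qed.

Lemma dk_ci f : dk n.+1 f -> ci f.
Proof.
move=> [mf [C C0 hC]]; apply: (ci_dom mf (G := fun x => C * wt x ^- n.+1)) => //.
  by apply: measurable_funM => //; exact: measurable_wtV.
rewrite gintZl//; [|exact: measurable_wtV|by move=> x; exact: wtVX_ge0].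
by rewrite lte_mul_pinfty ?lee_fin//; exact: wt_integral_lty.
Qed.

Lemma dk_le j k f : (j <= k)%N -> dk k f -> dk j f.
Proof.
move=> jk [mf [C C0 hC]]; split => //; exists C => // x.
by apply: le_trans (hC x) _; rewrite ler_wpM2l// wtVX_le.
Qed.

Lemma dk_bdM k f g (B : R) : cm g -> (forall x, cmod (g x) <= B) -> dk k f -> dk k (fun x => g x * f x).
Proof.
move=> mg gB [mf [C C0 hC]]; split; first exact: cmM.
have B0 : 0 <= B by exact: le_trans (cmod_ge0 _) (gB 0).
exists (B * C); first exact: mulr_ge0.
by move=> x; rewrite cmodM -mulrA; apply: ler_pM; rewrite ?cmod_ge0.
Qed.

Lemma dkZ k (c : R[i]) f : dk k f -> dk k (fun x => c * f x).
Proof. by move=> h; apply: (dk_bdM (B := cmod c)) => //; exact: cm_cst. Qed.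

Lemma dkD k f g : dk k f -> dk k g -> dk k (fun x => f x + g x).
Proof.
move=> [mf [C C0 hC]] [mg [D D0 hD]]; split; first exact: cmD.
exists (C + D); first exact: addr_ge0.
by move=> x; rewrite mulrDl; apply: le_trans (cmodD _ _) (lerD _ _).
Qed.

Lemma cm_coord i : cm (fun x : V => (x 0 i)%:C%C).
Proof. by apply: smooth_cm; exact: smooth_coord. Qed.

Lemma dk_mulx k i f : dk k.+1 f -> dk k (fun x => (x 0 i)%:C%C * f x).
Proof.
move=> [mf [C C0 hC]]; split; first by apply: cmM => //; exact: cm_coord.
exists C => // x; rewrite cmodM cmod_real.
apply: (@le_trans _ _ (wt x * (C * wt x ^- k.+1))).
  apply: ler_pM; rewrite ?cmod_ge0//.
  by rewrite (le_trans (ler_coord_norm _ _))// /wt lerDr.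
by rewrite mulrCA exprS invfM mulVKf// gt_eqF ?wt_gt0.
Qed.

Lemma sn_dkb k psi M : sn k psi M -> forall x, cmod (psi x) <= M * wt x ^- k.
Proof. by move=> h x; rewrite ler_pdivlMr ?wtX_gt0// mulrC; exact: (h [::]). Qed.

Lemma schw_dk k psi : schw psi -> dk k psi.
Proof.
move=> [hs h]; split; first exact: smooth_cm.
have [M hM] := h k; exists M; first exact: sn_ge0 hM.
exact: sn_dkb.
Qed.

End decay_class.

Section differentiation.
Context {R : realType} {n : nat}.
Local Notation V := 'rV[R]_n.
Local Notation L := (@lebesgue_rV R n).
Local Notation e i := (delta_mx 0 i : V).
Implicit Types (f g psi : V -> R[i]).

Lemma norm_delta (i : 'I_n) : `|e i| <= 1.
Proof.
by apply: norm_rV_le => // j; rewrite mxE; case: (_ && _); rewrite ?normr1 ?normr0.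
Qed.

(** On the line [x0 + t *: v] this is differentiation under the integral sign in one real parameter,
    with [G] dominating for [|t| < 1]. *)
Lemma int_isd (k k' : V -> V -> R) (x0 v : V) (G : V -> R) :
  (forall x y, is_derive x v (k^~ y) (k' x y)) ->
  (forall x, L.-integrable setT (EFin \o k x)) ->
  measurable_fun setT G -> (\int[L]_x (G x)%:E < +oo)%E ->
  (forall t y, `|t| < 1 -> `|k' (x0 + t *: v) y| <= G y) ->
  is_derive x0 v (fun x => \int[L]_y k x y) (\int[L]_y k' x0 y).
Proof.
move=> hk ik mG iG hG.
pose f (t : R) (y : V) := k (x0 + t *: v) y.
have hf (t : R) y : is_derive t (1 : R) (f^~ y) (k' (x0 + t *: v) y).
  by apply/(@isd_line R V (k^~ y) x0 v t).
have G0 y : 0 <= G y by apply: le_trans (normr_ge0 _) (hG 0 y _); rewrite normr0.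
have I0 : (`]-1, 1[%classic : set R) 0 by rewrite /= in_itv /= ltrN10 ltr01.
have dE (t : R) y : partial1of2 f t y = k' (x0 + t *: v) y.
  by rewrite partial1of2E; have [_ ->] := hf t y.
have intf (t : R) : (`]-1, 1[%classic : set R) t -> L.-integrable setT (EFin \o f t).
  by move=> _; exact: ik.
have derf (t : R) y : (`]-1, 1[%classic : set R) t -> setT y -> derivable (f^~ y) t 1.
  by move=> _ _; have [] := hf t y.
have iGG : L.-integrable setT (EFin \o G).
  by apply: (integrable_dom mG mG) => // x; rewrite ger0_norm.
have Gub (t : R) y : (`]-1, 1[%classic : set R) t -> setT y -> `|partial1of2 f t y| <= G y.
  by move=> /=; rewrite in_itv/= => t1 _; rewrite dE hG// ltr_norml.
have D := derivable_under_integral measurableT I0 intf derf G0 iGG Gub.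
have E := differentiation_under_integral measurableT I0 intf derf G0 iGG Gub.
apply/(@isd_line0 R V (fun x => \int[L]_y k x y)).
split; first exact: D.
rewrite -derive1E [LHS]E; apply: eq_Rintegral => y _.
by rewrite dE scale0r addr0.
Qed.

Lemma cint_ispd i (K K' : V -> V -> R[i]) :
  (forall y, ispd i (K^~ y) (K'^~ y)) -> (forall x, ci (K x)) ->
  (forall x0, exists G, [/\ measurable_fun setT G, (\int[L]_x (G x)%:E < +oo)%E &
     forall t y, `|t| < 1 -> cmod (K' (x0 + t *: e i) y) <= G y]) ->
  ispd i (fun x => cintegral (K x)) (fun x => cintegral (K' x)).
Proof.
move=> hK iK hG x0; have [G [mG iG {}hG]] := hG x0; split.
  apply: (@int_isd (fun x => reC (K x)) (fun x => reC (K' x)) x0 (e i) G) => //.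
  - by move=> x y; have [] := hK y x.
  - by move=> x; have [] := iK x.
  - by move=> t y t1; exact: le_trans (Re_le_cmod _) (hG t y t1).
apply: (@int_isd (fun x => imC (K x)) (fun x => imC (K' x)) x0 (e i) G) => //.
- by move=> x y; have [] := hK y x.
- by move=> x; have [] := iK x.
- by move=> t y t1; exact: le_trans (Im_le_cmod _) (hG t y t1).
Qed.

Lemma ispd_shift i f f' (z : V) : ispd i f f' -> ispd i (fun x => f (z + x)) (fun x => f' (z + x)).
Proof.
move=> h x; have sh (g : V -> R) a : is_derive (z + x) (e i) g a -> is_derive x (e i) (fun x => g (z + x)) a.
  move=> /(@isd_line0 R V g) hg; apply/(@isd_line0 R V (fun x => g (z + x))).
  rewrite (_ : (fun s => _) = fun s => g (z + x + s *: e i))//.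
  by apply/funext => s; rewrite addrA.
by have [h1 h2] := h (z + x); split; [exact: (sh (reC f))|exact: (sh (imC f))].
Qed.

Lemma wt_line (x : V) (t : R) i : `|t| < 1 -> wt (x + t *: e i) <= 2 * wt x.
Proof.
move=> t1; rewrite mulrC; apply: le_trans (wtD _ _) _.
rewrite ler_wpM2l ?wt_ge0// /wt -[leRHS]/(1 + 1) lerD2l.
rewrite normrZ -[leRHS]mulr1; apply: ler_pM => //; [exact: ltW|exact: norm_delta].
Qed.

(** The integral of the translate [u (y + x)] does not depend on [x]; its derivative at [x = 0],
    taken under the integral sign, is the integral of [u']. *)
Lemma int_pd0 i (u u' : V -> R[i]) : ispd i u u' -> dk n.+1 u -> dk n.+1 u' -> cintegral u' = 0.
Proof.
move=> hu du du'.
have iu := dk_ci du; have iu' := dk_ci du'.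
have sh f (x : V) : ci f -> ci (fun y => f (y + x)) /\ cintegral (fun y => f (y + x)) = cintegral f.
  move=> hf; have E y : f (y + x) = f (1 *: y + x) by rewrite scale1r.
  split; first by rewrite (_ : (fun y => _) = fun y => f (1 *: y + x));
    [apply: ci_affine => //; exact: oner_neq0|exact/funext].
  rewrite (eq_cint E) (cint_affine x (oner_neq0 R) hf).
  by rewrite normr1 expr1n invr1 mul1r.
have H : ispd i (fun x => cintegral (fun y => u (y + x))) (fun x => cintegral (fun y => u' (y + x))).
  apply: cint_ispd.
  - by move=> y; exact: ispd_shift.
  - by move=> x; have [] := sh u x iu.
  - move=> x0; have [mu' [C C0 hC]] := du'.
    exists (fun y => (C * (2 * wt x0) ^+ n.+1) * wt y ^- n.+1); split.
    + by apply: measurable_funM => //; exact: measurable_wtV.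
    + have A0 : 0 <= C * (2 * wt x0) ^+ n.+1 by rewrite mulr_ge0// exprn_ge0// mulr_ge0// wt_ge0.
      rewrite gintZl//; [|exact: measurable_wtV|by move=> x; exact: wtVX_ge0].
      by rewrite lte_mul_pinfty ?lee_fin//; exact: wt_integral_lty.
    + move=> t y t1; apply: le_trans (hC _) _; rewrite -mulrA ler_wpM2l//.
      apply: le_trans (wt_peetre _ _ _) _; rewrite ler_wpM2r ?wtVX_ge0//.
      by apply: lerXn2r; rewrite ?nnegrE ?mulr_ge0 ?wt_ge0//; exact: wt_line.
rewrite (_ : (fun x => _) = fun=> cintegral u) in H; last first.
  by apply/funext => x; have [] := sh u x iu.
have [h1 h2] := H 0; have [] := sh u' 0 iu' => _ E.
rewrite /reC /imC E in h1 h2.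
by apply: cplx_eq; [exact: isd_unique h1 (isd_cst _ _ _)|exact: isd_unique h2 (isd_cst _ _ _)].
Qed.

End differentiation.

Section fourier_transform.
Context {R : realType} {n : nat}.
Local Notation V := 'rV[R]_n.
Local Notation L := (@lebesgue_rV R n).
Local Notation e i := (delta_mx 0 i : V).
Local Notation fc := (@fourier_const R n).
Implicit Types (f g psi : V -> R[i]).

Definition ii : R[i] := Complex 0 1.

(** [sg] is -1 for [fourier] and 1 for its inverse; the assumption [sg * sg = 1] treats the two
    cases together. *)
Definition four (sg : R) psi : V -> R[i] := fun x =>
  fc * cintegral (fun y => psi y * cis (sg * dotp x y)).

Lemma fourierE psi : fourier psi = four (-1) psi.
Proof.
apply/funext => x; rewrite /fourier /four; congr (_ * _); apply: eq_cint => y.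
by rewrite mulN1r dotpC.
Qed.

Lemma fourier_invE psi : fourier_inv psi = four 1 psi.
Proof.
apply/funext => x; rewrite /fourier_inv /four; congr (_ * _); apply: eq_cint => y.
by rewrite mul1r.
Qed.

Lemma isd_dotp i (y x : V) : is_derive x (e i) (fun x => dotp x y) (y 0 i).
Proof.
apply: is_derive_val (isd_sum (index_enum 'I_n) (F := fun j (x : V) => x 0 j * y 0 j) (a := fun j => (i == j)%:R * y 0 j) _) _.
  by move=> j; apply: is_derive_val (isdM (isd_coord i j x) (isd_cst _ _ _)) _; rewrite mulr0 addr0.
by rewrite (bigD1 i)//= eqxx mul1r big1 ?addr0// => j ji; rewrite eq_sym (negbTE ji) mul0r.
Qed.

Lemma ispd_cis i (sg : R) (y : V) :
  ispd i (fun x => cis (sg * dotp x y)) (fun x => (sg * y 0 i)%:C%C * ii * cis (sg * dotp x y)).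
Proof.
move=> x.
have h : is_derive x (e i) (fun x => sg * dotp x y) (sg * y 0 i).
  by apply: is_derive_val (isdM (isd_cst _ _ _) (isd_dotp i y x)) _; rewrite mul0r add0r.
split.
  apply: is_derive_val (isd_comp h (is_derive_cos _)) _.
  by rewrite /reC !(cReM, cImM) /=; ring.
apply: is_derive_val (isd_comp h (is_derive_sin _)) _.
by rewrite /imC !(cReM, cImM) /=; ring.
Qed.

Lemma cm_cis (sg : R) (x : V) : cm (fun y => cis (sg * dotp x y)).
Proof.
have c : continuous (fun y : V => sg * dotp x y) by apply: ctsM; [exact: cts_cst|exact: cts_dotp].
apply: cm_cts.
  apply: (@cts_comp R V R (@cos R) (fun y : V => sg * dotp x y)) => //; exact: continuous_cos.
apply: (@cts_comp R V R (@sin R) (fun y : V => sg * dotp x y)) => //; exact: continuous_sin.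
Qed.

Lemma dk_cis k sg (x : V) psi : dk k psi -> dk k (fun y => psi y * cis (sg * dotp x y)).
Proof.
move=> h; rewrite (_ : (fun y => _) = fun y => cis (sg * dotp x y) * psi y); last first.
  by apply/funext => y; rewrite mulrC.
by apply: (dk_bdM (B := 1)) => //; [exact: cm_cis|move=> y; rewrite cmod_cis].
Qed.

Definition mulx (sg : R) (i : 'I_n) psi : V -> R[i] := fun y => (sg%:C%C * ii) * ((y 0 i)%:C%C * psi y).

Lemma four_ispd sg i psi : dk n.+2 psi -> ispd i (four sg psi) (four sg (mulx sg i psi)).
Proof.
move=> h.
have hm : dk n.+1 (mulx sg i psi) by apply: dkZ; exact: dk_mulx.
have h1 : dk n.+1 psi by exact: dk_le h.
pose K' x y := mulx sg i psi y * cis (sg * dotp x y).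
have H : ispd i (fun x => cintegral (fun y => psi y * cis (sg * dotp x y))) (fun x => cintegral (K' x)).
  apply: cint_ispd.
  - move=> y; have := ispd_mul (ispd_cst i (psi y)) (ispd_cis i sg y).
    rewrite (_ : (fun x => 0 * _ + _) = (K'^~ y))//.
    by apply/funext => x; rewrite /K' /mulx rmorphM /=; ring.
  - by move=> x; apply: dk_ci; exact: dk_cis.
  - move=> x0; have [mm [C C0 hC]] := hm.
    exists (fun y => C * wt y ^- n.+1); split.
    + by apply: measurable_funM => //; exact: measurable_wtV.
    + rewrite gintZl//; [|exact: measurable_wtV|by move=> x; exact: wtVX_ge0].
      by rewrite lte_mul_pinfty ?lee_fin//; exact: wt_integral_lty.
    + by move=> t y _; rewrite /K' cmodM cmod_cis mulr1.
have := ispd_mul (ispd_cst i fc) H.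
rewrite (_ : (fun x => 0 * _ + _) = four sg (mulx sg i psi))//.
by apply/funext => x; rewrite mul0r add0r.
Qed.

(** Integration by parts, that is [int_pd0] for the product of [psi] and the exponential. *)
Lemma four_pd sg i psi psi' : ispd i psi psi' -> dk n.+1 psi -> dk n.+1 psi' -> forall x,
  four sg psi' x = - ((sg * x 0 i)%:C%C * ii * four sg psi x).
Proof.
move=> h d d' x.
have h1 := ispd_cis i sg x.
have h2 := ispd_mul h (_ : ispd i (fun y => cis (sg * dotp x y)) (fun y => (sg * x 0 i)%:C%C * ii * cis (sg * dotp x y))).
have {}h2 := h2 _.
have hc : ispd i (fun y => cis (sg * dotp x y)) (fun y => (sg * x 0 i)%:C%C * ii * cis (sg * dotp x y)).
  move: h1; rewrite (_ : (fun x0 => cis (sg * dotp x0 x)) = (fun y => cis (sg * dotp x y))); last first.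
    by apply/funext => y; rewrite dotpC.
  rewrite (_ : (fun x0 => _ * cis (sg * dotp x0 x)) = (fun y => (sg * x 0 i)%:C%C * ii * cis (sg * dotp x y)))//.
  by apply/funext => y; rewrite dotpC.
have d1 := dk_cis sg x d; have d2 := dk_cis sg x d'.
have d3 := dkZ ((sg * x 0 i)%:C%C * ii) d1.
have E : (fun y => psi' y * cis (sg * dotp x y) + psi y * ((sg * x 0 i)%:C%C * ii * cis (sg * dotp x y))) =
    (fun y => psi' y * cis (sg * dotp x y) + ((sg * x 0 i)%:C%C * ii) * (psi y * cis (sg * dotp x y))).
  by apply/funext => y; ring.
have := int_pd0 (ispd_mul h hc) d1; rewrite E => /(_ (dkD d2 d3)).
rewrite (cintD (dk_ci d2) (ciZ _ (dk_ci d1))) (cintZ _ (dk_ci d1)) => /eqP.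
rewrite addr_eq0 => /eqP H; rewrite /four H; ring.
Qed.

Definition fbd : R := cmod fc * (2 * fine (\int[L]_x (wt x ^- n.+1)%:E)%E).

Lemma fbd_ge0 : 0 <= fbd.
Proof.
rewrite /fbd !mulr_ge0 ?cmod_ge0 ?fine_ge0//.
by apply: integral_ge0 => x _; rewrite lee_fin wtVX_ge0.
Qed.

Lemma four_bound sg psi (C : R) : cm psi -> 0 <= C -> (forall x, cmod (psi x) <= C * wt x ^- n.+1) ->
  forall x, cmod (four sg psi x) <= fbd * C.
Proof.
move=> mp C0 hC x; rewrite /four cmodM /fbd -!mulrA ler_wpM2l ?cmod_ge0//.
have d : dk n.+1 psi by split => //; exists C.
have iw : (\int[L]_x (C * wt x ^- n.+1)%:E < +oo)%E.
  rewrite gintZl//; [|exact: measurable_wtV|by move=> y; exact: wtVX_ge0].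
  by rewrite lte_mul_pinfty ?lee_fin//; exact: wt_integral_lty.
apply: le_trans (cmod_cint_le (dk_ci (dk_cis sg x d)) (G := fun y => C * wt y ^- n.+1) _ _ iw) _.
- by apply: measurable_funM => //; exact: measurable_wtV.
- by move=> y; rewrite cmodM cmod_cis mulr1.
rewrite ler_wpM2l//.
rewrite gintZl//; [|exact: measurable_wtV|by move=> y; exact: wtVX_ge0].
rewrite fineM//; first by rewrite mulrC.
rewrite ge0_fin_numE; first exact: wt_integral_lty.
by apply: integral_ge0 => y _; rewrite lee_fin wtVX_ge0.
Qed.

Lemma four_lin sg (a : R[i]) p1 p2 : dk n.+1 p1 -> dk n.+1 p2 ->
  four sg (fun x => a * p1 x + p2 x) = fun x => a * four sg p1 x + four sg p2 x.
Proof.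
move=> d1 d2; apply/funext => x; rewrite /four.
have c1 := dk_ci (dk_cis sg x d1); have c2 := dk_ci (dk_cis sg x d2).
rewrite (_ : (fun y => _) = fun y => a * (p1 y * cis (sg * dotp x y)) + p2 y * cis (sg * dotp x y)); last first.
  by apply/funext => y; ring.
by rewrite (cintD (ciZ a c1) c2) (cintZ a c1); ring.
Qed.

Lemma schw_mulx sg i psi : schw psi -> schw (mulx sg i psi).
Proof.
move=> h; have [a1 _ _] := sop_mul (tame_coord (R := R) i); have [b1 _ _] := sop_mul (tame_cst (R := R) (n := n) (sg%:C%C * ii)).
exact/b1/a1.
Qed.

Lemma sn_mulx sg i psi m M : `|sg| = 1 -> smooth psi -> sn m.+1 psi M -> sn m (mulx sg i psi) (2 ^+ m * M).
Proof.
move=> sg1 hp hM s sm x.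
have M0 := sn_ge0 hM.
have hx := smooth_coord (R := R) i.
rewrite /mulx (dw_cM _ _ (smoothM hx hp)) cmodM cmodM cmod_real sg1 mul1r.
have -> : cmod ii = 1 by rewrite cmodE /= expr0n expr1n add0r sqrtr1.
rewrite mul1r; pose K := wt x * (M / wt x ^+ m.+1).
have K0 : 0 <= K by rewrite !mulr_ge0 ?invr_ge0 ?wt_ge0 ?wtX_ge0.
apply: (@le_trans _ _ (wt x ^+ m * (2 ^+ m * K))).
  rewrite ler_wpM2l ?wtX_ge0//.
  apply: (@le_trans _ _ (2 ^+ size s * K)).
    apply: (leibniz_bound hx hp); rewrite ?wt_ge0 ?divr_ge0 ?wtX_ge0//.
    - by move=> s1 s1s; exact: tame_coord_bound.
    - move=> s1 s1s; rewrite ler_pdivlMr ?wtX_gt0// mulrC; apply: hM.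
      by rewrite (leq_trans s1s)// (leq_trans sm).
  by rewrite ler_wpM2r// ler_weXn2l// ler1n.
rewrite /K exprS le_eqVlt; apply/orP; left; apply/eqP; field.
by rewrite expf_neq0// gt_eqF ?wt_gt0.
Qed.

Definition mulxs sg s psi := foldr (mulx sg) psi s.

Lemma schw_mulxs sg s psi : schw psi -> schw (mulxs sg s psi).
Proof. by move=> h; elim: s => //= i s; exact: schw_mulx. Qed.

Lemma sn_mulxs sg s psi m M : `|sg| = 1 -> schw psi -> sn (m + size s) psi M ->
  sn m (mulxs sg s psi) ((2 ^+ (m + size s)) ^+ size s * M).
Proof.
move=> sg1 hp; elim: s m M => [|i s IH] m M.
  by rewrite addn0 expr0 mul1r.
rewrite /= addnS -addSn => hM; have M0 := sn_ge0 hM; have {hM} h := IH _ _ hM.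
have h2 := sn_mulx i sg1 (schw_smooth (schw_mulxs sg s hp)) h; apply: (sn_leM _ h2).
rewrite exprS -mulrA ler_wpM2r ?mulr_ge0 ?exprn_ge0//.
by rewrite ler_weXn2l ?ler1n// addSn ltnW// ltnS leq_addr.
Qed.

Lemma schw_pds i m psi : schw psi -> schw (iter m (@pd R n i) psi).
Proof. by move=> h; elim: m => //= m; have [h1 _ _] := @sop_pd R n i; exact: h1. Qed.

Lemma sn_pds i psi k m M : sn (m + k) psi M -> sn m (iter k (@pd R n i) psi) M.
Proof.
elim: k m => [|k IH] m; first by rewrite addn0.
rewrite addnS -addSn => /IH h s sm x; rewrite iterS -dw_rcons.
apply: le_trans (h (rcons s i) _ x); last by rewrite size_rcons.
by rewrite ler_wpM2r ?cmod_ge0// ler_wtX// leqnSn.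
Qed.

Lemma dw_four sg s psi : schw psi -> dw s (four sg psi) = four sg (mulxs sg s psi).
Proof.
move=> h; elim: s => //= i s IH.
rewrite /dw /= -/(dw s _) IH; apply: ispd_pd; apply: four_ispd.
by apply: schw_dk; exact: schw_mulxs.
Qed.

Lemma four_pds sg i k psi x : schw psi -> sg * sg = 1 ->
  cmod (four sg (iter k (@pd R n i) psi) x) = `|x 0 i| ^+ k * cmod (four sg psi x).
Proof.
move=> h sg1; elim: k => [|k IH]; first by rewrite expr0 mul1r.
have hk := schw_pds i k h.
rewrite iterS (four_pd sg (smooth_ispd i (schw_smooth hk)) (schw_dk _ hk)); last first.
  by apply: schw_dk; exact: (schw_pds i k.+1 h).
rewrite cmodN cmodM cmodM IH cmod_real.
have -> : cmod ii = 1 by rewrite cmodE /= expr0n expr1n add0r sqrtr1.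
have -> : `|sg * x 0 i| = `|x 0 i|.
  have s1 : `|sg| ^+ 2 = 1 by rewrite -normrX expr2 sg1 normr1.
  have : `|sg| = 1 by apply/eqP; rewrite -(@eqrXn2 _ 2) ?expr1n//; apply/eqP.
  by rewrite normrM => ->; rewrite mul1r.
by rewrite mulr1 exprS mulrA.
Qed.

(** The invariant is to be the transform of a Schwartz function; it passes to [pd] because [mulx]
    preserves the Schwartz space. Continuity follows from the boundedness of the first
    derivatives. *)
Lemma smooth_four sg psi : schw psi -> smooth (four sg psi).
Proof.
move=> h; apply: (smooth_coind (P := fun f => exists2 psi, schw psi & f = four sg psi)); last by exists psi.
move=> f [p hp ->] {f psi h}.
have hd i := four_ispd sg i (schw_dk n.+2 hp).
have hb : exists M, forall i y, cmod (four sg (mulx sg i p) y) <= M.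
  have /choice[C hC] : forall i, exists C, forall y, cmod (four sg (mulx sg i p) y) <= C.
    move=> i; have [mm [C C0 hC]] := schw_dk n.+1 (schw_mulx sg i hp).
    by exists (fbd * C); exact: four_bound.
  exists (\sum_i `|C i|) => i y; apply: le_trans (hC i y) _.
  rewrite (bigD1 i)//= (le_trans (ler_norm _))// lerDl sumr_ge0//.
have [M hM] := hb; split.
- apply: (@lip_continuous _ _ _ (fun i => reC (four sg (mulx sg i p)))).
    by move=> i y; have [] := hd i y.
  by move=> x0; exists M => i y _; exact: le_trans (Re_le_cmod _) (hM i y).
- apply: (@lip_continuous _ _ _ (fun i => imC (four sg (mulx sg i p)))).
    by move=> i y; have [] := hd i y.
  by move=> x0; exists M => i y _; exact: le_trans (Im_le_cmod _) (hM i y).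
- move=> i; exists (four sg (mulx sg i p)) => //.
  by exists (mulx sg i p) => //; exact: schw_mulx.
Qed.

Lemma sop_four sg : sg * sg = 1 -> sop (four sg).
Proof.
move=> sg2.
have sg1 : `|sg| = 1.
  have s1 : `|sg| ^+ 2 = 1 by rewrite -normrX expr2 sg2 normr1.
  by apply/eqP; rewrite -(@eqrXn2 _ 2) ?expr1n//; apply/eqP.
apply: sop_intro => [psi|a p1 p2 h1 h2|m]; first exact: smooth_four.
  by apply: four_lin; exact: schw_dk.
(* Here [n.+1] makes the integrals converge, one [m] pays for the weight, which turns into
   derivatives of the input, and one [m] for the derivatives, which turn into multiplications by
   coordinates. *)
pose m' := (n.+1 + m + m)%N.
pose A : R := (2 ^+ (n.+1 + m + m)) ^+ m.
have A0 : 0 <= A by rewrite !exprn_ge0.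
exists m', (2 ^+ m * (1 + n%:R) * (fbd * A)).
  by apply: mulr_ge0; apply: mulr_ge0; rewrite ?exprn_ge0 ?fbd_ge0 ?addr_ge0.
move=> psi M hp hM s sm x; have M0 := sn_ge0 hM.
have hg := schw_mulxs sg s hp.
have sng : sn (n.+1 + m) (mulxs sg s psi) (A * M).
  have h : sn (n.+1 + m + size s) psi M by apply: sn_le hM; rewrite /m' leq_add2l.
  apply: sn_leM (sn_mulxs sg1 hp h); rewrite ler_wpM2r//.
  apply: (@le_trans _ _ ((2 ^+ (n.+1 + m + m)) ^+ size s)).
    by apply: lerXn2r; rewrite ?nnegrE ?exprn_ge0// ler_weXn2l ?ler1n// leq_add2l.
  by apply: ler_weXn2l => //; exact/exprn_ege1/ler1n.
have B k i : (k <= m)%N -> `|x 0 i| ^+ k * cmod (four sg (mulxs sg s psi) x) <= fbd * (A * M).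
  move=> km; rewrite -four_pds//.
  have hk := schw_pds i k hg.
  apply: four_bound; [exact/smooth_cm/schw_smooth|exact: mulr_ge0|].
  apply: sn_dkb; apply: sn_pds; apply: sn_le sng.
  by rewrite leq_add2l.
rewrite dw_four//.
apply: (@le_trans _ _ (2 ^+ m * (1 + \sum_i `|x 0 i| ^+ m) * cmod (four sg (mulxs sg s psi) x))).
  by rewrite ler_wpM2r ?cmod_ge0// wtX_le.
have B0 : cmod (four sg (mulxs sg s psi) x) <= fbd * (A * M).
  apply: four_bound; [exact/smooth_cm/schw_smooth|exact: mulr_ge0|].
  by apply: sn_dkb; apply: sn_le sng; rewrite leq_addr.
have -> : 2 ^+ m * (1 + n%:R) * (fbd * A) * M = 2 ^+ m * ((1 + n%:R) * (fbd * (A * M))) by ring.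
move: B B0; move: (fbd * (A * M)) => Q B B0.
rewrite -mulrA ler_wpM2l ?exprn_ge0//.
rewrite !mulrDl !mul1r; apply: lerD => //.
rewrite mulr_suml (_ : n%:R * _ = \sum_(i < n) Q); last by rewrite sumr_const card_ord mulr_natl.
by apply: ler_sum => i _; exact: B.
Qed.

End fourier_transform.

(** * Fourier inversion *)

Section gaussian.
Context {R : realType}.

Definition gauss {n} (x : 'rV[R]_n) : R := expR (- (dotp x x / 2)).
Definition gaussC {n} (x : 'rV[R]_n) : R[i] := (gauss x)%:C%C.

Lemma gauss_ge0 n (x : 'rV[R]_n) : 0 <= gauss x. Proof. exact: expR_ge0. Qed.

Lemma sqr_norm_le_dotp n (x : 'rV[R]_n) : `|x| ^+ 2 <= dotp x x.
Proof.
have d0 : 0 <= dotp x x by apply: sumr_ge0 => i _; rewrite -expr2 sqr_ge0.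
rewrite -[leRHS](sqr_sqrtr d0); apply: lerXn2r; rewrite ?nnegrE ?sqrtr_ge0//.
exact: norm_le_enorm.
Qed.

Lemma cts_dotpxx n : continuous (fun x : 'rV[R]_n => dotp x x).
Proof. by apply: cts_sum => i; apply: ctsM; exact: cts_coord. Qed.

Lemma cts_gauss n : continuous (@gauss n).
Proof.
apply: (@cts_comp R 'rV[R]_n R (@expR R) (fun x => - (dotp x x / 2))); last exact: continuous_expR.
by apply: ctsN; apply: ctsM; [exact: cts_dotpxx|exact: cts_cst].
Qed.

(** With [K = k.+1] and [y = dotp x x / 2], the exponential of [y] is at least [(1 + y / K) ^+ K],
    while [wt x <= 2 + |x| ^+ 2 <= 2 * K * (1 + y / K)]. *)
Lemma gauss_decay n (x : 'rV[R]_n) k : wt x ^+ k * gauss x <= (2 * k.+1%:R) ^+ k.+1.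
Proof.
set K : R := k.+1%:R.
have K1 : 1 <= K by rewrite ler1n.
have K0 : 0 < K by exact: lt_le_trans K1.
apply: (@le_trans _ _ (wt x ^+ k.+1 * gauss x)).
  by rewrite ler_wpM2r ?gauss_ge0// ler_wtX.
rewrite /gauss expRN ler_pdivrMr ?expR_gt0//.
have E : expR (dotp x x / 2) = expR (dotp x x / 2 / K) ^+ k.+1.
  by rewrite -expRM_natr divfK// gt_eqF.
rewrite E -exprMn; apply: lerXn2r; rewrite ?nnegrE ?wt_ge0 ?mulr_ge0 ?expR_ge0 ?(ltW K0)//.
apply: (@le_trans _ _ (2 * K * (1 + dotp x x / 2 / K))).
  rewrite mulrDr mulr1.
  have -> : 2 * K * (dotp x x / 2 / K) = dotp x x by field; rewrite gt_eqF.
  apply: (@le_trans _ _ (2 + `|x| ^+ 2)); last by apply: lerD; [rewrite ler_peMr|exact: sqr_norm_le_dotp].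
  by rewrite /wt; have := normr_ge0 x; nra.
by rewrite ler_wpM2l ?mulr_ge0 ?(ltW K0)// expR_ge1Dx.
Qed.

Lemma cm_gaussC n : cm (@gaussC n).
Proof. by apply: cm_cts; [exact: cts_gauss|exact: cts_cst]. Qed.

Lemma dk_gaussC n k : dk k (@gaussC n).
Proof.
split; first exact: cm_gaussC.
exists ((2 * k.+1%:R) ^+ k.+1); first by rewrite exprn_ge0.
move=> x; rewrite /gaussC cmod_real ger0_norm ?gauss_ge0// ler_pdivlMr ?wtX_gt0// mulrC.
exact: gauss_decay.
Qed.

Lemma isd_dotpxx n i (x : 'rV[R]_n) : is_derive x (delta_mx 0 i) (fun x => dotp x x) (2 * x 0 i).
Proof.
apply: is_derive_val (isd_sum (index_enum 'I_n) (F := fun j (x : 'rV[R]_n) => x 0 j * x 0 j) (a := fun j => (i == j)%:R * (2 * x 0 j)) _) _.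
  by move=> j; apply: is_derive_val (isdM (isd_coord i j x) (isd_coord i j x)) _; ring.
by rewrite (bigD1 i)//= eqxx mul1r big1 ?addr0// => j ji; rewrite eq_sym (negbTE ji) mul0r.
Qed.

Lemma ispd_expR n i (f : 'rV[R]_n -> R) f' : (forall x, is_derive x (delta_mx 0 i) f (f' x)) ->
  ispd i (fun x => (expR (f x))%:C%C) (fun x => (f' x)%:C%C * (expR (f x))%:C%C).
Proof.
move=> h x; split; last first.
  by apply: is_derive_val (isd_cst 0 _ _) _; rewrite /imC !(cReM, cImM) /=; ring.
apply: is_derive_val (isd_comp (h x) (is_derive_expR _)) _.
by rewrite /reC !(cReM, cImM) /=; ring.
Qed.

Lemma ispd_gaussC n i : ispd i (@gaussC n) (fun x => (-1)%:C%C * ((x 0 i)%:C%C * gaussC x)).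
Proof.
have h (x : 'rV[R]_n) : is_derive x (delta_mx 0 i) (fun x => - (dotp x x / 2)) (- x 0 i).
  apply: is_derive_val (isdN (isdM (isd_dotpxx i x) (isd_cst 2^-1 _ _))) _.
  by rewrite mulr0 addr0; field.
have := ispd_expR h.
rewrite (_ : (fun x => _ * _) = (fun x : 'rV[R]_n => (-1)%:C%C * ((x 0 i)%:C%C * gaussC x)))//.
by apply/funext => x; apply: cplx_eq; rewrite !(cReM, cImM) /= /gauss; ring.
Qed.

(** Total mass 1 of the standard normal density. *)
Lemma gauss_integral1 : (\int[@lebesgue_measure R]_x (expR (- (x * x / 2)))%:E = (Num.sqrt (2 * pi))%:E)%E.
Proof.
have H := @integral_normal_pdf R 0 1.
rewrite (_ : (fun x => _) = (fun x => ((normal_peak 1)^-1 * normal_pdf 0 1 x)%:E)); last first.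
  apply/funext => x; rewrite normal_pdfE ?oner_eq0// mulrA mulVf ?gt_eqF ?normal_peak_gt0 ?oner_neq0// mul1r.
  by rewrite /normal_fun subr0 expr1n expr2; congr (expR _)%:E; rewrite mulNr.
under eq_integral do rewrite EFinM.
rewrite ge0_integralZl//.
- rewrite H// mule1 /normal_peak invrK expr1n mul1r mulr_natl; done.
- by apply/measurable_EFinP; exact: measurable_normal_pdf.
- by move=> x _; rewrite lee_fin normal_pdf_ge0.
- by rewrite lee_fin invr_ge0 normal_peak_ge0.
Qed.

Lemma gauss_integral_rV n : (\int[@lebesgue_rV R n]_x (gauss x)%:E = (Num.sqrt (2 * pi) ^+ n)%:E)%E.
Proof.
elim: n => [|n IH].
  rewrite expr0 /= integral_dirac//; last first.
    by apply/measurable_EFinP; apply: continuous_measurable_rV; exact: cts_gauss.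
  by rewrite diracT mul1e /gauss /dotp big_ord0 mul0r oppr0 expR0.
have mgr k : measurable_fun setT (@gauss k) by apply: continuous_measurable_rV; exact: cts_gauss.
have mg k : measurable_fun setT (fun x : 'rV[R]_k => (gauss x)%:E) by apply/measurable_EFinP; exact: mgr.
have m1 : measurable_fun setT (fun x : measurableTypeR R => (expR (- (x * x / 2)))%:E).
  apply/measurable_EFinP; apply: continuous_measurable_fun.
  apply: (@cts_comp R R R (@expR R) (fun x => - (x * x / 2))); last exact: continuous_expR.
  by apply: ctsN; apply: ctsM; [apply: ctsM => x; exact: cvg_id|exact: cts_cst].
rewrite /= /lebesgue_rV_step ge0_integral_pushforward//; [|exact: measurable_cons_rV|exact: mg|by move=> x _; rewrite lee_fin gauss_ge0].
rewrite preimage_setT.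
have E (z : measurableTypeR R * 'rV[R]_n) : gauss (cons_rV z) = expR (- (z.1 * z.1 / 2)) * gauss z.2.
  rewrite /gauss -expRD; congr expR; rewrite /dotp big_ord_recl !mxE unlift_none /= mulrDl opprD.
  congr (_ - _ / _); apply: eq_bigr => i _; rewrite !mxE liftK; done.
rewrite fubini_tonelli1//; last 2 first.
- exact: measurableT_comp (mg n.+1) (@measurable_cons_rV R n).
- by move=> x; rewrite /= lee_fin gauss_ge0.
rewrite /fubini_F.
under eq_integral => x _.
  rewrite (_ : (\int[lebesgue_rV n]_y _ = (expR (- (x * x / 2)))%:E * (Num.sqrt (2 * pi) ^+ n)%:E)%E); last first.
    rewrite -IH -(gintZl (expR_ge0 _) (mgr n) (@gauss_ge0 n)).
    by apply: eq_integral => y _; rewrite /= E.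
  over.
rewrite ge0_integralZr//.
by rewrite gauss_integral1 -EFinM -exprS.
Qed.

End gaussian.

Section inversion.
Context {R : realType} {n : nat}.
Local Notation V := 'rV[R]_n.
Local Notation L := (@lebesgue_rV R n).
Local Notation fc := (@fourier_const R n).
Implicit Types (f g psi : V -> R[i]).

Lemma dotp0l (y : V) : dotp 0 y = 0.
Proof. by rewrite /dotp big1// => i _; rewrite mxE mul0r. Qed.

Lemma dotp_scaleV (a : R) (x y : V) : a != 0 -> dotp (a^-1 *: x) (a *: y) = dotp x y.
Proof. by move=> a0; rewrite dotpZl dotpZr mulrA mulVf// mul1r. Qed.

Lemma fc_gauss : fc * cintegral (@gaussC R n) = 1.
Proof.
have -> : cintegral (@gaussC R n) = (Num.sqrt (2 * pi) ^+ n)%:C%C.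
  apply: cplx_eq; rewrite /= /Rintegral; last by rewrite integral0.
  by rewrite (gauss_integral_rV n).
rewrite /fourier_const -rmorphM.
have p0 : 0 <= 2 * pi :> R by rewrite mulr_ge0 ?pi_ge0.
have p0' : 0 < 2 * pi :> R by rewrite mulr_gt0 ?pi_gt0.
rewrite -powR12_sqrt// -powR_mulrn ?powR_ge0// -powRrM -powRD; last by rewrite (gt_eqF p0') implybT.
by rewrite [X in _ `^ X](_ : _ = 0) ?powRr0//; field.
Qed.

Lemma fourZ sg (a : R[i]) psi : dk n.+1 psi -> four sg (fun y => a * psi y) = fun x => a * four sg psi x.
Proof.
move=> d; apply/funext => x; rewrite /four.
rewrite (_ : (fun y => _) = fun y => a * (psi y * cis (sg * dotp x y))); last by apply/funext => y; rewrite mulrA.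
by rewrite (cintZ _ (dk_ci (dk_cis sg x d))) mulrCA.
Qed.

(** The transform [H] satisfies the same equation [d_i H = - x_i H] as the Gaussian, since the
    transform exchanges the two sides of it. Multiplied by [E], the reciprocal of the Gaussian, it
    has zero gradient, hence is constant, with value 1 at the origin by [fc_gauss]. *)
Lemma four_gaussC sg : sg * sg = 1 -> four sg (@gaussC R n) = @gaussC R n.
Proof.
move=> sg2; pose H := four sg (@gaussC R n).
pose E : V -> R[i] := fun x => (expR (dotp x x / 2))%:C%C.
have hH i : ispd i H (fun x => (-1)%:C%C * ((x 0 i)%:C%C * H x)).
  have := four_ispd sg i (dk_gaussC n n.+2).
  rewrite (_ : four sg (mulx sg i (@gaussC R n)) = (fun x => (-1)%:C%C * ((x 0 i)%:C%C * H x)))//.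
  have dx : dk n.+1 (fun x : V => (x 0 i)%:C%C * gaussC x) by apply: dk_mulx; exact: dk_gaussC.
  have d' := dkZ ((-1)%:C%C) dx.
  apply/funext => x; have := four_pd sg (ispd_gaussC i) (dk_gaussC n n.+1) d' x.
  rewrite (fourZ _ _ dx) => h.
  rewrite /mulx (fourZ _ _ dx).
  have -> : four sg (fun y : V => (y 0 i)%:C%C * gaussC y) x = (sg * x 0 i)%:C%C * ii * four sg gaussC x.
    apply: (mulfI (_ : (-1)%:C%C != 0 :> R[i])); first by rewrite rmorphN1 oppr_eq0 oner_eq0.
    by rewrite h rmorphN1 mulN1r.
  rewrite -/H; have -> : sg%:C%C * ii * ((sg * x 0 i)%:C%C * ii * H x) = (sg * sg)%:C%C * (ii * ii) * ((x 0 i)%:C%C * H x).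
    by rewrite !rmorphM; ring.
  rewrite sg2 rmorph1 mul1r; congr (_ * _).
  by apply: cplx_eq; rewrite ?cReM ?cImM /=; ring.
have hE i : ispd i E (fun x => (x 0 i)%:C%C * E x).
  apply: ispd_expR => x; apply: is_derive_val (isdM (isd_dotpxx i x) (isd_cst 2^-1 _ _)) _.
  by rewrite mulr0 addr0; field.
pose Q x := H x * E x.
have hQ i : ispd i Q (fun=> 0).
  have := ispd_mul (hH i) (hE i).
  rewrite (_ : (fun x => _ + _) = (fun=> 0))//.
  by apply/funext => x; rewrite rmorphN1; ring.
have Qc x : Q x = Q 0.
  apply: cplx_eq.
    by apply: (@const_coord R n (reC Q)) => i y; have [] := hQ i y.
  by apply: (@const_coord R n (imC Q)) => i y; have [] := hQ i y.
have Q0 : Q 0 = 1.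
  rewrite /Q /E /H dotp0l mul0r expR0 rmorph1 mulr1 /four.
  rewrite (eq_cint (g := @gaussC R n)) ?fc_gauss// => y.
  by rewrite dotp0l mulr0 cis0 mulr1.
apply/funext => x; have := Qc x; rewrite Q0 /Q -/H => h.
have : gaussC x * E x = 1 by rewrite /gaussC /E /gauss -rmorphM -expRD addNr expR0 rmorph1.
move=> h2; apply: (mulIf (_ : E x != 0)); last by rewrite h h2.
by apply/eqP => E0; move: h2; rewrite E0 mulr0 => /esym/eqP; rewrite oner_eq0.
Qed.

Definition cmt d (T : measurableType d) (f : T -> R[i]) :=
  measurable_fun setT (fun x => complex.Re (f x)) /\ measurable_fun setT (fun x => complex.Im (f x)).

Lemma cmtM d (T : measurableType d) (f g : T -> R[i]) : cmt f -> cmt g -> cmt (fun x => f x * g x).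
Proof.
move=> [h1 h2] [h3 h4]; split.
  by under eq_fun do rewrite cReM; apply: measurable_funB; exact: measurable_funM.
by under eq_fun do rewrite cImM; apply: measurable_funD; exact: measurable_funM.
Qed.

Lemma cmt_comp d (T : measurableType d) (phi : T -> V) f : measurable_fun setT phi -> cm f -> cmt (fun x => f (phi x)).
Proof. by move=> mp [h1 h2]; split; [exact: measurableT_comp h1 mp|exact: measurableT_comp h2 mp]. Qed.

Lemma cmt_cis d (T : measurableType d) (t : T -> R) : measurable_fun setT t -> cmt (fun x => cis (t x)).
Proof.
move=> mt; split.
  apply: (@measurableT_comp _ _ _ _ _ _ (@cos R)) => //.
  by apply: continuous_measurable_fun; exact: continuous_cos.
apply: (@measurableT_comp _ _ _ _ _ _ (@sin R)) => //.
by apply: continuous_measurable_fun; exact: continuous_sin.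
Qed.

Lemma measurable_dotp d (T : measurableType d) (f g : T -> V) : measurable_fun setT f -> measurable_fun setT g ->
  measurable_fun setT (fun x => dotp (f x) (g x)).
Proof.
move=> /measurable_fun_coordP mf /measurable_fun_coordP mg.
by apply: measurable_sum => i; apply: measurable_funM.
Qed.

Lemma measurable_addrV d (T : measurableType d) (f g : T -> V) (a b : R) : measurable_fun setT f -> measurable_fun setT g ->
  measurable_fun setT (fun x => a *: f x + b *: g x).
Proof.
move=> /measurable_fun_coordP mf /measurable_fun_coordP mg.
apply/measurable_fun_coordP => i.
rewrite (_ : (fun x => _) = fun x => a * f x 0 i + b * g x 0 i); last by apply/funext => x; rewrite !mxE.
by apply: measurable_funD; apply: measurable_funM.
Qed.

Lemma gauss_scale_ci (a : R) : a != 0 -> ci (fun x : V => gaussC (a *: x)).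
Proof.
move=> a0; rewrite (_ : (fun x => _) = fun x : V => gaussC (a *: x + 0)); last by apply/funext => x; rewrite addr0.
by apply: ci_affine => //; exact/dk_ci/dk_gaussC.
Qed.

Lemma gauss_kernel (a : R) (z : V) : 0 < a ->
  ci (fun xi => gaussC (a *: xi) * cis (1 * dotp z xi)) /\
  fc * cintegral (fun xi => gaussC (a *: xi) * cis (1 * dotp z xi)) = (a ^- n)%:C%C * gaussC (a^-1 *: z).
Proof.
move=> a0; have aN0 : a != 0 by rewrite gt_eqF.
pose h := fun eta : V => gaussC eta * cis (1 * dotp (a^-1 *: z) eta).
have hci : ci h by apply: dk_ci; apply: dk_cis; exact: dk_gaussC.
have E : (fun xi => gaussC (a *: xi) * cis (1 * dotp z xi)) = (fun xi => h (a *: xi + 0)).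
  by apply/funext => xi; rewrite /h addr0 (dotp_scaleV _ _ aN0).
rewrite E; split; first exact: (ci_affine 0 aN0 hci).
rewrite (cint_affine 0 aN0 hci) (gtr0_norm a0).
have <- : four 1 gaussC (a^-1 *: z) = gaussC (a^-1 *: z) by rewrite four_gaussC ?mulr1.
by rewrite /four mulrCA.
Qed.

Lemma gauss_le1 (y : V) : gauss y <= 1.
Proof.
rewrite /gauss expR_le1 oppr_le0 divr_ge0// (le_trans _ (sqr_norm_le_dotp _))//; exact: sqr_ge0.
Qed.

Lemma cmod_gaussC (y : V) : cmod (gaussC y) = gauss y.
Proof. by rewrite /gaussC cmod_real ger0_norm ?gauss_ge0. Qed.

Lemma gaussC_affine (a : R) (u x : V) : a != 0 -> gaussC (a^-1 *: (x - (a *: u + x))) = gaussC u.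
Proof.
move=> a0; rewrite opprD addrCA subrr addr0 scalerN scalerA mulVf// scale1r.
by rewrite /gaussC /gauss dotpNl dotpNr opprK.
Qed.

(* The inversion integral damped by [gaussC (a *: xi)]: Fubini's theorem turns it
   into the average of [psi] against the dual Gaussian. *)
Lemma inversion_eps psi (a : R) (x : V) : dk n.+1 psi -> 0 < a ->
  fc * cintegral (fun xi => four (-1) psi xi * gaussC (a *: xi) * cis (dotp x xi)) =
  fc * cintegral (fun u => psi (a *: u + x) * gaussC u).
Proof.
move=> d a0; have aN0 : a != 0 by rewrite gt_eqF.
have mpsi : cm psi by case: d.
pose K (xi y : V) := psi y * cis (-1 * dotp xi y) * (gaussC (a *: xi) * cis (1 * dotp x xi)).
have mK : cmt (fun z : V * V => K z.1 z.2).
  apply: cmtM; apply: cmtM.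
  - by apply: cmt_comp.
  - by apply: cmt_cis; apply: measurable_funM => //; apply: measurable_dotp.
  - apply: (cmt_comp (phi := fun z : V * V => a *: z.1)); last exact: cm_gaussC.
    rewrite (_ : (fun z => _) = fun z : V * V => a *: z.1 + 0 *: z.2); last by apply/funext => z; rewrite scale0r addr0.
    by apply: measurable_addrV.
  - by apply: cmt_cis; apply: measurable_funM => //; apply: measurable_dotp.
have ga := gauss_scale_ci aN0.
have mga : measurable_fun setT (fun x : V => gauss (a *: x)) by have [] := ci_cm ga.
have ig : (\int[L]_x (gauss (a *: x))%:E < +oo)%E.
  have := ci_lty ga; under eq_integral do rewrite /gaussC cmod_real ger0_norm ?gauss_ge0//.
  done.
have ip := ci_lty (dk_ci d); have mp := cm_cmod mpsi.
have [|c1 c2 FF] := @cint_Fubini R n K (fun xi => gauss (a *: xi)) (fun y => cmod (psi y))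
   mK.1 mK.2 mga mp (fun x => gauss_ge0 _) (fun y => cmod_ge0 _) _ ig ip.
  by move=> xi y; rewrite /K !cmodM !cmod_cis !mulr1 /gaussC cmod_real ger0_norm ?gauss_ge0// mulrC.
have E1 xi : four (-1) psi xi * gaussC (a *: xi) * cis (dotp x xi) = fc * cintegral (K xi).
  rewrite /four -!mulrA; congr (_ * _); rewrite mulrC -(cintZ _ (dk_ci (dk_cis (-1) xi d))).
  by apply: eq_cint => y; rewrite /K mul1r; ring.
rewrite (eq_cint E1) (cintZ _ c1) FF.
have E2 y : fc * cintegral (K^~ y) = psi y * ((a ^- n)%:C%C * gaussC (a^-1 *: (x - y))).
  have -> : cintegral (K^~ y) = cintegral (fun xi => psi y * (gaussC (a *: xi) * cis (1 * dotp (x - y) xi))).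
    apply: eq_cint => xi; rewrite /K -!mulrA; congr (_ * _).
    rewrite mulrCA; congr (_ * _); rewrite -cisD; congr cis.
    by rewrite dotpDl dotpNl (dotpC xi y); ring.
  have [k1 k2] := gauss_kernel (x - y) a0.
  by rewrite (cintZ _ k1) mulrCA k2.
rewrite -(cintZ _ c2) (eq_cint E2).
pose h y := psi y * gaussC (a^-1 *: (x - y)).
have E4 y : psi y * ((a ^- n)%:C%C * gaussC (a^-1 *: (x - y))) = (a ^- n)%:C%C * h y by rewrite /h mulrCA.
have hci : ci h.
  apply: (dk_ci (dk_le (leqnn _) _)).
  rewrite (_ : h = fun y => gaussC (a^-1 *: (x - y)) * psi y); last by apply/funext => y; rewrite mulrC.
  apply: (dk_bdM _ _ d (B := 1)).
    rewrite (_ : (fun y => _) = fun y : V => gaussC ((- a^-1) *: y + a^-1 *: x)); last first.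
      by apply/funext => y; rewrite scalerBr addrC scaleNr.
    exact: (@cmt_comp _ V (fun u => (- a^-1) *: u + a^-1 *: x) gaussC (measurable_affine_rV _ _) (@cm_gaussC R n)).
  move=> y; rewrite cmod_gaussC; exact: gauss_le1.
rewrite (eq_cint E4) (cintZ _ hci); congr (_ * _).
have := cint_affine x aN0 hci; rewrite (gtr0_norm a0) => <-.
apply: eq_cint => u; rewrite /h; congr (_ * _).
exact: gaussC_affine.
Qed.

Lemma seq_comp_cvg (h : R -> R) : {for 0, continuous h} -> (fun k : nat => h (k.+1%:R^-1)) @ \oo --> h 0.
Proof.
move=> ch; apply: (@cvg_comp _ _ _ (fun k : nat => k.+1%:R^-1 : R) h _ (nbhs (0 : R))); last exact: ch.
exact: cvg_harmonic.
Qed.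

Lemma cts_line (f : V -> R) (u x : V) : continuous f -> {for 0, continuous (fun t : R => f (t *: u + x))}.
Proof.
move=> cf.
have : continuous (fun t : R => f (t *: u + x)); last exact.
apply: (@cts_comp R R V f (fun t : R => t *: u + x)) => //.
move=> t; apply: (@continuousD R V R (fun t => t *: u) (fun=> x) t); last exact: cst_continuous.
exact: scalel_continuous.
Qed.

Lemma cvg_cstM (c : R) (u : nat -> R) : u @ \oo --> (1 : R) -> (fun k => c * u k) @ \oo --> c.
Proof.
by move=> h; rewrite -[X in _ --> X]mulr1; apply: cvgM => //; exact: cvg_cst.
Qed.

Lemma cvg_Mcst (c l : R) (u : nat -> R) : u @ \oo --> l -> (fun k => u k * c) @ \oo --> l * c.
Proof. by move=> h; exact: cvgM h (@cvg_cst _ c nat \oo _). Qed.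

Lemma cvg_eqseq (l : R) (u v : nat -> R) : u =1 v -> v @ \oo --> l -> u @ \oo --> l.
Proof. by move=> /funext ->. Qed.

(** The damping in [inversion_eps] is removed by letting [a k] tend to 0. Both sides converge by
    dominated convergence: the left one is dominated by the modulus of the transform, integrable by
    hypothesis, the right one by a multiple of the Gaussian, as [psi] is bounded. *)
Lemma fourier_inversion psi : continuous (reC psi) -> continuous (imC psi) -> dk n.+1 psi ->
  (exists B, forall x, cmod (psi x) <= B) ->
  dk n.+1 (four (-1) psi) -> four 1 (four (-1) psi) = psi.
Proof.
move=> cR cI d [B hB] d'; apply/funext => x.
pose a (k : nat) : R := k.+1%:R^-1.
have a0 k : 0 < a k by rewrite invr_gt0.
have mpsi : cm psi by case: d.
have B0 : 0 <= B by exact: le_trans (cmod_ge0 _) (hB 0).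
pose g xi := four (-1) psi xi * cis (1 * dotp x xi).
have dg : dk n.+1 g by exact: dk_cis.
have mgs k : cm (fun xi : V => gaussC (a k *: xi)).
  by apply: ci_cm; apply: gauss_scale_ci; rewrite gt_eqF.
have gcvg (xi : V) : (fun k => gauss (a k *: xi)) @ \oo --> (1 : R).
  have := seq_comp_cvg (cts_line (u := xi) (x := 0) (@cts_gauss R n)).
  rewrite scale0r addr0 {2}/gauss /dotp big1 ?mul0r ?oppr0 ?expR0; last by move=> i _; rewrite mxE mul0r.
  by under eq_fun do rewrite addr0.
have hgR xi : (fun k => complex.Re (g xi * gaussC (a k *: xi))) @ \oo --> complex.Re (g xi).
  rewrite (_ : (fun k => _) = fun k => complex.Re (g xi) * gauss (a k *: xi)); first exact: cvg_cstM.
  by apply/funext => k; rewrite cReM /= mulr0 subr0.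
have hgI xi : (fun k => complex.Im (g xi * gaussC (a k *: xi))) @ \oo --> complex.Im (g xi).
  rewrite (_ : (fun k => _) = fun k => complex.Im (g xi) * gauss (a k *: xi)); first exact: cvg_cstM.
  by apply/funext => k; rewrite cImM /= mulr0 add0r.
have [L1 L2] := @cint_cvg R n (fun k xi => g xi * gaussC (a k *: xi)) g (fun xi => cmod (g xi))
  (fun k => cmM (ci_cm (dk_ci dg)) (mgs k)) (ci_cm (dk_ci dg))
  hgR hgI
  (cm_cmod (ci_cm (dk_ci dg)))
  ltac:(by move=> k xi; rewrite cmodM cmod_gaussC ler_piMr ?cmod_ge0 ?gauss_le1)
  (ci_lty (dk_ci dg)).
have dG := dk_gaussC (R := R) n n.+1.
have mG := ci_cm (dk_ci dG).
have mu k : cm (fun u => psi (a k *: u + x)).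
  exact: (@cmt_comp _ V (fun u => a k *: u + x) psi (measurable_affine_rV _ _) mpsi).
have iBG : (\int[L]_x (B * gauss x)%:E < +oo)%E.
  rewrite gintZl//; [|by case: mG|exact: gauss_ge0].
  by rewrite (gauss_integral_rV n) -EFinM ltry.
have cu (f : V -> R) (u : V) : continuous f -> (fun k => f (a k *: u + x)) @ \oo --> f x.
  by move=> cf; have := seq_comp_cvg (cts_line (u := u) (x := x) cf); rewrite scale0r add0r.
have hpR u : (fun k => complex.Re (psi (a k *: u + x) * gaussC u)) @ \oo --> complex.Re (psi x * gaussC u).
  rewrite (_ : (fun k => _) = fun k => reC psi (a k *: u + x) * gauss u); last first.
    by apply/funext => k; rewrite cReM /= mulr0 subr0.
  by rewrite cReM /= mulr0 subr0; exact: cvg_Mcst (cu (reC psi) u cR).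
have hpI u : (fun k => complex.Im (psi (a k *: u + x) * gaussC u)) @ \oo --> complex.Im (psi x * gaussC u).
  rewrite (_ : (fun k => _) = fun k => imC psi (a k *: u + x) * gauss u); last first.
    by apply/funext => k; rewrite cImM /= mulr0 add0r.
  by rewrite cImM /= mulr0 add0r; exact: cvg_Mcst (cu (imC psi) u cI).
have [M1 M2] := @cint_cvg R n (fun k u => psi (a k *: u + x) * gaussC u) (fun u => psi x * gaussC u) (fun u => B * gauss u)
  (fun k => cmM (mu k) mG) (cmM (cm_cst _) mG)
  hpR hpI
  ltac:(by apply: measurable_funM => //; case: mG)
  ltac:(by move=> k u; rewrite cmodM cmod_gaussC ler_wpM2r ?gauss_ge0)
  iBG.
have fcR : complex.Im fc = 0 by [].
have fc0 : fc != 0.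
  by apply/eqP => E; have := fc_gauss; rewrite E mul0r => /esym/eqP; rewrite oner_eq0.
have E k : cintegral (fun xi => g xi * gaussC (a k *: xi)) = cintegral (fun u => psi (a k *: u + x) * gaussC u).
  apply: (mulfI fc0); apply: etrans (inversion_eps x d (a0 k)).
  apply: (congr1 (fun z => fc * z)); apply: eq_cint => xi.
  rewrite /g mul1r; exact: mulrAC.
have -> : four 1 (four (-1) psi) x = fc * cintegral g by [].
have -> : cintegral g = cintegral (fun u : V => psi x * gaussC u).
  apply: cplx_eq.
    apply: (@cvg_unique _ (@norm_hausdorff R R) _ _ _ _ L1).
    exact: cvg_eqseq (fun k => congr1 (@complex.Re R) (E k)) M1.
  apply: (@cvg_unique _ (@norm_hausdorff R R) _ _ _ _ L2).
  exact: cvg_eqseq (fun k => congr1 (@complex.Im R) (E k)) M2.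
by rewrite (cintZ _ (dk_ci dG)) mulrCA fc_gauss mulr1.
Qed.

End inversion.

(** * Compactly supported functions *)

Section cutoffs.
Context {R : realType} {n : nat}.
Local Notation V := 'rV[R]_n.
Implicit Types (f g psi m : V -> R[i]) (s : seq 'I_n).

Lemma pd_local0 (U : set V) i f : open U -> (forall x, U x -> f x = 0) -> forall x, U x -> pd i f x = 0.
Proof.
move=> oU f0 x Ux.
have h (g : V -> R) : (forall y, U y -> g y = 0) -> 'D_(delta_mx 0 i) g x = 0.
  move=> g0; rewrite (@near_eq_derive R V R g (cst 0) x _) ?derive_cst//.
  have : nbhs x U by exact: open_nbhs_nbhs.
  by apply: filterS => y Uy; rewrite g0.
by apply: cplx_eq; rewrite /pd /= h// => y Uy; rewrite /reC /imC f0.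
Qed.

Lemma dw_local0 (U : set V) s f : open U -> (forall x, U x -> f x = 0) -> forall x, U x -> dw s f x = 0.
Proof.
move=> oU f0; elim: s => [|i s IH]; first by rewrite dw_nil.
by rewrite dw_cons; exact: pd_local0.
Qed.

Lemma open_far (rho : R) : open [set x : V | rho < `|x|].
Proof.
rewrite (_ : [set x : V | _] = (fun x : V => `|x|) @^-1` [set t | rho < t]); last by [].
have /continuousP := @cts_norm R n; apply; exact: open_gt.
Qed.

Lemma dw_far (rho : R) s f : (forall x, rho < `|x| -> f x = 0) -> forall x, rho < `|x| -> dw s f x = 0.
Proof.
have H := @dw_local0 [set y : V | rho < `|y|] s f (@open_far rho).
by move=> h x xr; rewrite (H h x xr).
Qed.

Lemma closed_cball_rV (rho : R) : closed [set x : V | `|x| <= rho].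
Proof.
rewrite (_ : [set x : V | _] = ~` [set x : V | rho < `|x|]); first exact/open_closedC/open_far.
by apply/seteqP; split => x /=; rewrite leNgt => /negP.
Qed.

Lemma compact_cball (rho : R) : compact [set x : V | `|x| <= rho].
Proof.
apply: bounded_closed_compact.
  exists rho; split; first exact: num_real.
  by move=> M rM x /= xr; exact: le_trans xr (ltW rM).
exact: closed_cball_rV.
Qed.

Lemma cts_bounded_cball (f : V -> R) (rho : R) : continuous f -> exists M, forall x, `|x| <= rho -> `|f x| <= M.
Proof.
move=> cf.
have cK : compact (f @` [set x : V | `|x| <= rho]).
  apply: (@continuous_compact V R f); last exact: compact_cball.
  by apply: continuous_subspaceT.
have [M [_ hM]] := compact_bounded cK.
exists (M + 1) => x xr; apply: (hM (M + 1)); first by rewrite ltrDl.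
by exists x.
Qed.

(** A support radius passes through products and dilations more easily than a compact closure;
    [test_functionP] identifies the two notions. *)
Definition cc f := smooth f /\ exists rho : R, forall x, rho < `|x| -> f x = 0.

Lemma cc_smooth f : cc f -> smooth f. Proof. by case. Qed.

Lemma cc_dw s f : cc f -> cc (dw s f).
Proof.
move=> [sf [rho hr]]; split; first exact: smooth_dw.
by exists rho => x; exact: dw_far.
Qed.

Lemma cc_bounded f : cc f -> exists2 M, 0 <= M & forall x, cmod (f x) <= M.
Proof.
move=> [sf [rho hr]].
have [M1 h1] := cts_bounded_cball rho (smooth_ctsRe sf).
have [M2 h2] := cts_bounded_cball rho (smooth_ctsIm sf).
exists (Num.max 0 (M1 + M2)); first by rewrite le_max lexx.
move=> x; rewrite le_max; case: (ltP rho `|x|) => xr; first by rewrite hr// cmod0 lexx.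
by apply/orP; right; apply: le_trans (cmod_le_ReIm _) _; apply: lerD; [exact: h1|exact: h2].
Qed.

Lemma cc_dw_bounded f (m : nat) : cc f -> exists2 C, 0 <= C & forall s, (size s <= m)%N -> forall x, cmod (dw s f x) <= C.
Proof.
move=> hf.
have /choice[B hB] : forall s, exists C, 0 <= C /\ forall x, cmod (dw s f x) <= C.
  by move=> s; have [C C0 hC] := cc_bounded (cc_dw s hf); exists C.
have [M hM] := words_bound B m.
exists M; first by apply: le_trans (hM [::] _) => //; have [] := hB [::].
by move=> s sm x; apply: le_trans (hM _ sm); have [_] := hB s; apply.
Qed.

Lemma cc_tame f : cc f -> tame 0 f.
Proof.
move=> hf; split; first exact: cc_smooth.
move=> m; have [C C0 hC] := cc_dw_bounded m hf; exists C => // s sm x.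
by rewrite expr0 mulr1; exact: hC.
Qed.

Lemma cc_schw f : cc f -> schw f.
Proof.
move=> hf; split; first exact: cc_smooth.
move=> m; have [C C0 hC] := cc_dw_bounded m hf; have [sf [rho hr]] := hf.
exists ((1 + `|rho|) ^+ m * C) => s sm x; case: (ltP rho `|x|) => xr.
  rewrite (dw_far _ hr xr) cmod0 mulr0.
  by rewrite mulr_ge0// exprn_ge0// addr_ge0.
apply: ler_pM; [exact: wtX_ge0|exact: cmod_ge0| |exact: hC].
apply: lerXn2r; rewrite ?nnegrE ?wt_ge0 ?addr_ge0//.
by rewrite lerD2l (le_trans xr)// ler_norm.
Qed.

Lemma cc_mul f g : smooth g -> cc f -> cc (fun x => g x * f x).
Proof.
move=> sg [sf [rho hr]]; split; first exact: smoothM.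
by exists rho => x xr; rewrite (hr _ xr) mulr0.
Qed.

Lemma cc_add f g : cc f -> cc g -> cc (fun x => f x + g x).
Proof.
move=> [sf [rho hr]] [sg [rho' hr']]; split; first exact: smoothD.
by exists (Num.max rho rho') => x; rewrite gt_max => /andP[h1 h2]; rewrite (hr _ h1) (hr' _ h2) addr0.
Qed.

Lemma cc_scale (a : R) f : 0 < a -> cc f -> cc (fun x => f (a *: x)).
Proof.
move=> a0 [sf [rho hr]]; split; first exact: smooth_scale.
exists (rho / a) => x xr; apply: hr.
by rewrite normrZ gtr0_norm// mulrC -ltr_pdivrMr.
Qed.

Lemma test_functionP f : test_function f <-> cc f.
Proof.
split=> [[sf cK]|[sf [rho hr]]]; split => //.
  have [M [_ hM]] := compact_bounded cK.
  exists (M + 1) => x; apply: contraPP => /eqP fx; apply/negP; rewrite -leNgt.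
  by apply: (hM (M + 1)); [rewrite ltrDl|exact: subset_closure].
apply: bounded_closed_compact; last exact: closed_closure.
exists rho; split; first exact: num_real.
move=> M rM x /= xcl; apply: le_trans (ltW rM).
have : closure [set x | f x != 0] `<=` [set x : V | `|x| <= rho].
  rewrite closureE => y; apply; split; first exact: closed_cball_rV.
  by move=> z /= fz; rewrite leNgt; apply/negP => /hr fz0; rewrite fz0 eqxx in fz.
by apply.
Qed.

Lemma dw_scale s (a : R) f : smooth f -> dw s (fun x => f (a *: x)) = fun x => (a ^+ size s)%:C%C * dw s f (a *: x).
Proof.
move=> sf; elim: s => [|i s IH]; first by apply/funext => x; rewrite expr0 mul1r.
have sd := smooth_dw s sf.
rewrite dw_cons IH (pd_mul i (smooth_cst _) (smooth_scale a sd)) pd_cst (pd_scale i a sd).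
by apply/funext => x; rewrite mul0r add0r mulrA exprSr -rmorphM.
Qed.

End cutoffs.

(** * Multiplier operators and their kernels *)

Section multiplier_operators.
Context {R : realType} {n : nat}.
Local Notation V := 'rV[R]_n.
Local Notation L := (@lebesgue_rV R n).
Local Notation fc := (@fourier_const R n).
Implicit Types (f g psi m : V -> R[i]).

Lemma sgN1 : (-1) * (-1) = 1 :> R. Proof. by rewrite mulrNN mulr1. Qed.

Lemma schw_four sg psi : sg * sg = 1 -> schw psi -> schw (four sg psi).
Proof. by move=> h hp; have [H _ _] := sop_four (n := n) h; exact: H. Qed.

Lemma schw_bounded psi : schw psi -> exists B, forall x, cmod (psi x) <= B.
Proof.
move=> [_ /(_ 0)[M hM]]; exists M => x.
by have := hM [::] (leqnn _) x; rewrite expr0 mul1r.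
Qed.

Lemma four1K psi : schw psi -> four 1 (four (-1) psi) = psi.
Proof.
move=> hp; have sp := schw_smooth hp.
apply: fourier_inversion (smooth_ctsRe sp) (smooth_ctsIm sp) (schw_dk _ hp) (schw_bounded hp) _.
exact/schw_dk/(schw_four sgN1 hp).
Qed.

(** The transpose of [m(D)]: duality reverses the order, so the inverse transform comes first (see
    [multiplierE]). Composing two such operators meets [four 1 (four (-1) _)], the order covered by
    [four1K]. *)
Definition Tm m psi := four (-1) (fun x => m x * four 1 psi x).

Lemma schw_tame_mul k m psi : tame k m -> schw psi -> schw (fun x => m x * psi x).
Proof. by move=> hm hp; have [H _ _] := sop_mul hm; exact: H. Qed.

Lemma sop_Tm k m : tame k m -> sop (Tm m).
Proof.
move=> hm; exact: (sop_comp (sop_comp (sop_four (mulr1 1)) (sop_mul hm)) (sop_four sgN1)).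
Qed.

Lemma schw_Tm k m psi : tame k m -> schw psi -> schw (Tm m psi).
Proof. by move=> hm hp; have [H _ _] := sop_Tm hm; exact: H. Qed.

Lemma Tm_comp k m m' psi : tame k m' -> schw psi -> Tm m (Tm m' psi) = Tm (fun x => m x * m' x) psi.
Proof.
move=> hm hp; rewrite /Tm four1K; last exact: (schw_tame_mul hm (schw_four (mulr1 1) hp)).
by congr four; apply/funext => x; rewrite mulrA.
Qed.

Lemma Tm_lin k k' (a : R[i]) m m' psi : tame k m -> tame k' m' -> schw psi ->
  Tm (fun x => a * m x + m' x) psi = fun x => a * Tm m psi x + Tm m' psi x.
Proof.
move=> hm hm' hp; have h4 := schw_four (mulr1 1) hp.
rewrite /Tm -(four_lin _ _ (schw_dk _ (schw_tame_mul hm h4)) (schw_dk _ (schw_tame_mul hm' h4))).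
by congr four; apply/funext => x; rewrite mulrDl mulrA.
Qed.

(** Multiplication by [- i x_i], the effect of differentiating [four (-1)] under the integral. *)
Definition mulxi i m : V -> R[i] := fun x => ((-1)%:C%C * ii) * (x 0 i)%:C%C * m x.

Lemma pd_four i m : schw m -> ispd i (four (-1) m) (four (-1) (mulxi i m)).
Proof.
move=> hm; rewrite (_ : mulxi i m = mulx (-1) i m); first exact: four_ispd (schw_dk _ hm).
by apply/funext => x; rewrite /mulxi /mulx mulrA.
Qed.

Lemma pd_Tm k i m psi : tame k m -> schw psi -> pd i (Tm m psi) = Tm (mulxi i m) psi.
Proof.
move=> hm hp; rewrite /Tm (ispd_pd (pd_four i (schw_tame_mul hm (schw_four (mulr1 1) hp)))).
by congr four; apply/funext => x; rewrite /mulxi mulrA.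
Qed.

Lemma smooth_mulxi_factor i : smooth (fun x : V => ((-1)%:C%C * ii) * (x 0 i)%:C%C).
Proof. exact: (smoothM (smooth_cst _) (smooth_coord i)). Qed.

Lemma cc_mulxi i m : cc m -> cc (mulxi i m).
Proof. by move=> hm; apply: cc_mul hm; exact: smooth_mulxi_factor. Qed.

Lemma multiplierE (m : V -> R) u psi : multiplier m u psi = u (Tm (fun x => (m x)%:C%C) psi).
Proof. by rewrite /multiplier /dfourier_inv /dmul /dfourier fourierE fourier_invE. Qed.

(** One constant [fc] for each of the two transforms in [Tm], so that [Tm m] is exactly convolution
    with this function. *)
Definition ker m : V -> R[i] := fun z => fc * four (-1) m z.

Lemma schw_ker m : schw m -> schw (ker m).
Proof.
move=> hm; rewrite (_ : ker m = fun z => fc * four (-1) m z + 0); last by apply/funext => z; rewrite addr0.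
exact: schwD (schw_four sgN1 hm) schw0.
Qed.

Lemma ispd_ker i m : schw m -> ispd i (ker m) (ker (mulxi i m)).
Proof.
move=> hm.
have := ispd_mul (ispd_cst (R := R) (n := n) i fc) (pd_four i hm).
by congr ispd; apply/funext => x; rewrite mul0r add0r.
Qed.

Lemma cmt_kernel m psi (x : V) : cm m -> cm psi ->
  cmt (fun z : V * V => (m z.1 * cis (-1 * dotp x z.1)) * (psi z.2 * cis (1 * dotp z.1 z.2))).
Proof.
move=> hm hp; apply: cmtM; apply: cmtM.
- exact: (cmt_comp (phi := fst) _ hm).
- by apply: cmt_cis; apply: measurable_funM => //; apply: measurable_dotp.
- exact: (cmt_comp (phi := snd) _ hp).
- by apply: cmt_cis; apply: measurable_funM => //; apply: measurable_dotp.
Qed.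

(** Fubini's theorem once both transforms are written out: the double integrand is dominated by
    [|m xi| * |psi y|], and the two exponentials combine into the one at [x - y]. *)
Lemma Tm_ker m psi x : dk n.+1 m -> dk n.+1 psi ->
  Tm m psi x = cintegral (fun y => psi y * ker m (x - y)).
Proof.
move=> dm dp.
pose K (xi y : V) := (m xi * cis (-1 * dotp x xi)) * (psi y * cis (1 * dotp xi y)).
have mm := ci_cm (dk_ci dm); have mp := ci_cm (dk_ci dp).
have mK := cmt_kernel x mm mp.
have Kb xi y : cmod (K xi y) <= cmod (m xi) * cmod (psi y).
  by rewrite /K !cmodM !cmod_cis !mulr1.
have [c1 c2 FF] := @cint_Fubini R n K (fun xi => cmod (m xi)) (fun y => cmod (psi y))
   mK.1 mK.2 (cm_cmod mm) (cm_cmod mp) (fun xi => cmod_ge0 _) (fun y => cmod_ge0 _) Kb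
   (ci_lty (dk_ci dm)) (ci_lty (dk_ci dp)).
have E1 xi : m xi * four 1 psi xi * cis (-1 * dotp x xi) = fc * cintegral (K xi).
  rewrite /four; have -> : cintegral (K xi) = _ := cintZ _ (dk_ci (dk_cis 1 xi dp)).
  move: (cintegral _) (m xi) (cis _) => I a b; ring.
have E2 y : fc * (fc * cintegral (K^~ y)) = psi y * ker m (x - y).
  have -> : cintegral (K^~ y) = psi y * cintegral (fun xi => m xi * cis (-1 * dotp (x - y) xi)).
    rewrite -(cintZ _ (dk_ci (dk_cis (-1) (x - y) dm))); apply: eq_cint => xi.
    have -> : cis (-1 * dotp (x - y) xi) = cis (-1 * dotp x xi) * cis (1 * dotp xi y).
      rewrite -cisD; congr cis.
      by rewrite dotpDl dotpNl (dotpC xi y); ring.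
    rewrite /K; move: (m xi) (psi y) (cis _) (cis _) => b1 b2 b3 b4; ring.
  rewrite /ker /four; move: (cintegral _) (psi y) => I b; ring.
rewrite /Tm {1}/four (eq_cint E1) (cintZ _ c1) FF.
rewrite -(cintZ _ c2) -(cintZ _ (ciZ fc c2)); exact: eq_cint.
Qed.

Lemma ker_scale m (a : R) z : 0 < a -> dk n.+1 m ->
  ker (fun x => m (a *: x)) z = (a ^- n)%:C%C * ker m (a^-1 *: z).
Proof.
move=> a0 dm; have aN0 : a != 0 by rewrite gt_eqF.
pose h := fun eta : V => m eta * cis (-1 * dotp (a^-1 *: z) eta).
have hci : ci h by apply/dk_ci/dk_cis.
have := cint_affine 0 aN0 hci; rewrite (gtr0_norm a0) => E.
rewrite /ker /four -/h (_ : cintegral _ = (a ^- n)%:C%C * cintegral h).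
  by move: (cintegral h) (_%:C)%C => I b; ring.
rewrite -E; apply: eq_cint => xi; by rewrite /h addr0 (dotp_scaleV _ _ aN0).
Qed.

Lemma kerZ (c : R[i]) m : dk n.+1 m -> ker (fun x => c * m x) = fun z => c * ker m z.
Proof. by move=> dm; apply/funext => z; rewrite /ker fourZ// mulrCA. Qed.

Definition kL1 m : R := fine (\int[L]_z (cmod (ker m z))%:E)%E.

Lemma kL1E m : schw m -> (\int[L]_z (cmod (ker m z))%:E = (kL1 m)%:E)%E.
Proof.
move=> hm; rewrite fineK// ge0_fin_numE; first exact/ci_lty/dk_ci/schw_dk/schw_ker.
by apply: integral_ge0 => z _; rewrite lee_fin cmod_ge0.
Qed.

Lemma kL1_ge0 m : 0 <= kL1 m.
Proof. by apply/fine_ge0/integral_ge0 => z _; rewrite lee_fin cmod_ge0. Qed.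

(** Dilating the symbol replaces the kernel [k z] by [a ^- n * k (a^-1 *: z)], whose modulus has the
    same integral. *)
Lemma kL1_scale m (a : R) : 0 < a -> schw m -> kL1 (fun x => m (a *: x)) = kL1 m.
Proof.
move=> a0 hm; have aN0 : a^-1 != 0 by rewrite invr_neq0// gt_eqF.
have mk : measurable_fun setT (fun z => cmod (ker m z)) := cm_cmod (smooth_cm (schw_smooth (schw_ker hm))).
apply: (congr1 fine).
transitivity (\int[L]_z ((a ^- n)%:E * (cmod (ker m (a^-1 *: z + 0)))%:E))%E.
  apply: eq_integral => z _; rewrite addr0 (ker_scale _ a0 (schw_dk _ hm)) cmodM cmod_real.
  by rewrite ger0_norm ?invr_ge0 ?exprn_ge0 ?ltW.
have an0 : 0 <= a ^- n by rewrite invr_ge0 exprn_ge0// ltW.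
have nn z : (0 <= (cmod (ker m z))%:E)%E by rewrite lee_fin cmod_ge0.
have mk2 : measurable_fun setT (fun z => (cmod (ker m z))%:E) by exact/measurable_EFinP.
rewrite ge0_integralZl//; last first.
  apply: (@measurableT_comp _ _ _ _ _ _ (fun z : V => (cmod (ker m z))%:E)) => //.
  exact: measurable_affine_rV.
have := ge0_integral_affine_rV 0 aN0 mk2 nn; move=> ->.
rewrite muleA -EFinM gtr0_norm ?invr_gt0// exprVn invrK mulVf ?mul1e//.
by rewrite expf_neq0// gt_eqF.
Qed.

Lemma kL1Z (c : R[i]) m : schw m -> kL1 (fun x => c * m x) = cmod c * kL1 m.
Proof.
move=> hm; rewrite /kL1 kerZ; last exact: schw_dk.
have mk : measurable_fun setT (fun z => cmod (ker m z)) := cm_cmod (smooth_cm (schw_smooth (schw_ker hm))).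
under eq_integral do rewrite cmodM.
by rewrite gintZl// ?cmod_ge0// => [|x]; [rewrite kL1E|exact: cmod_ge0].
Qed.

End multiplier_operators.

(** * Density of test functions, and convolution *)

Section density.
Context {R : realType} {n : nat}.
Local Notation V := 'rV[R]_n.
Implicit Types (f g psi chi : V -> R[i]).

Definition cutoff chi (delta : R) := [/\ cc chi, 0 < delta & forall x, `|x| < delta -> chi x = 1].

Lemma smooth_compl chi (a : R) : smooth chi -> smooth (fun x => 1 + (-1) * chi (a *: x)).
Proof. by move=> h; exact: (smoothD (smooth_cst 1) (smoothM (smooth_cst (-1)) (smooth_scale a h))). Qed.

Lemma compl_bound chi (m : nat) : cc chi -> exists2 A, 0 <= A & forall (a : R) s x, 0 < a -> a <= 1 ->
  (size s <= m)%N -> cmod (dw s (fun x => 1 + (-1) * chi (a *: x)) x) <= A.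
Proof.
move=> hc; have [C C0 hC] := cc_dw_bounded m hc.
have [_ /(_ m)[D D0 hD]] := tame_cst (R := R) (n := n) 1.
exists (D + C); first exact: addr_ge0.
move=> a s x a0 a1 sm; have sc := cc_smooth hc.
rewrite (dw_add s (smooth_cst 1) (smoothM (smooth_cst (-1)) (smooth_scale a sc))).
rewrite (dw_cM s (-1) (smooth_scale a sc)) (dw_scale s a sc).
apply: le_trans (cmodD _ _) _; apply: lerD.
  by have := hD s sm x; rewrite expr0 mulr1.
rewrite mulN1r cmodN cmodM cmod_real ger0_norm ?exprn_ge0 ?(ltW a0)//.
apply: le_trans (hC s sm (a *: x)).
by rewrite ler_piMl ?cmod_ge0// exprn_ile1// (ltW a0).
Qed.

(** The product and its derivatives vanish for [|x| < delta / a]; elsewhere one extra power of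
    weight on [psi] is worth [a / delta]. The condition [a <= 1] keeps the derivatives of the
    dilated cutoff bounded. *)
Lemma compl_sn chi delta psi (m : nat) : cutoff chi delta -> schw psi ->
  exists2 K, 0 <= K & forall a : R, 0 < a -> a <= 1 ->
    sn m (fun x => (1 + (-1) * chi (a *: x)) * psi x) (K * a).
Proof.
move=> [hc d0 h1] [sp hp]; have [A A0 hA] := compl_bound m hc; have [M hM] := hp m.+1.
have M0 := sn_ge0 hM.
exists (2 ^+ m * (A * M) / delta); first by rewrite divr_ge0 ?(ltW d0)// mulr_ge0 ?exprn_ge0// mulr_ge0.
move=> a a0 a1 s sm x; have sc := smooth_compl a (cc_smooth hc).
case: (ltP `|x| (delta / a)) => xd.
  rewrite (@dw_local0 R n (ball (0 : V) (delta / a)) s).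
  - by rewrite cmod0 mulr0 mulr_ge0 ?(ltW a0)// divr_ge0 ?(ltW d0)// mulr_ge0 ?exprn_ge0// mulr_ge0.
  - exact: ball_open.
  - move=> y; rewrite -ball_normE /= sub0r normrN => yd.
    rewrite h1 ?mulr1 ?subrr ?mul0r//.
    by rewrite normrZ gtr0_norm// mulrC -ltr_pdivlMr.
  - by rewrite -ball_normE /= sub0r normrN.
have w0 := wt_gt0 x.
apply: (@le_trans _ _ (wt x ^+ m * (2 ^+ size s * (A * (M * wt x ^- m.+1))))).
  rewrite ler_wpM2l ?wtX_ge0//; apply: (leibniz_bound sc sp A0).
  - by rewrite mulr_ge0 ?wtVX_ge0.
  - by move=> s1 h; apply: hA => //; exact: leq_trans h sm.
  - move=> s1 h; rewrite ler_pdivlMr ?wtX_gt0// mulrC; apply: hM.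
    exact: leq_trans h (leq_trans sm (leqnSn _)).
apply: (@le_trans _ _ (wt x ^+ m * (2 ^+ m * (A * (M * wt x ^- m.+1))))).
  rewrite ler_wpM2l ?wtX_ge0// ler_wpM2r ?mulr_ge0 ?wtVX_ge0//.
  by rewrite ler_weXn2l// ler1n.
have -> : wt x ^+ m * (2 ^+ m * (A * (M * wt x ^- m.+1))) = 2 ^+ m * (A * M) * (wt x)^-1.
  by rewrite exprS; field; rewrite expf_neq0 gt_eqF.
rewrite -!mulrA !ler_wpM2l ?exprn_ge0//.
rewrite -[X in _ <= X]invrK lef_pV2 ?posrE ?invr_gt0 ?mulr_gt0 ?invr_gt0//.
rewrite invfM invrK; apply: le_trans xd _.
by rewrite /wt lerDr.
Qed.

(** The truncation [psi * chi (a *: _)] is killed by [u], and the remainder tends to 0 in the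
    Schwartz space with [a]. *)
Lemma stemp_density u chi delta : cutoff chi delta -> stemp u -> (forall psi, cc psi -> u psi = 0) ->
  forall psi, schw psi -> u psi = 0.
Proof.
move=> hcut [ul uc] u0 psi hp; have [hc _ _] := hcut.
apply: cmod_eq0; apply/eqP; rewrite eq_le cmod_ge0 andbT; apply/ler_addgt0Pr => eps e0; rewrite add0r.
have [m [d [d0 hd]]] := uc _ e0.
have [K K0 hK] := compl_sn m hcut hp.
(* Keeps the seminorm bound [K * a] of the remainder below the threshold [d] of continuity. *)
pose a : R := Num.min 1 (d / (K + 1)).
have K1 : 0 < K + 1 by rewrite ltr_wpDl.
have a0 : 0 < a by rewrite lt_min ltr01 divr_gt0.
have a1 : a <= 1 by rewrite ge_min lexx.
have hs := smooth_compl a (cc_smooth hc).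
have cg : cc (fun x => psi x * chi (a *: x)) := cc_mul (schw_smooth hp) (cc_scale a0 hc).
pose f := fun x => (1 + (-1) * chi (a *: x)) * psi x.
have fE : f = fun x => (-1) * (psi x * chi (a *: x)) + psi x by apply/funext => x; rewrite /f; ring.
have hf : schw f by rewrite fE; exact: schwD (cc_schw cg) hp.
have -> : u psi = u f by rewrite fE (ul _ _ _ (cc_schw cg) hp) (u0 _ cg) mulr0 add0r.
apply/ltW/hd => //.
apply: sn_leM (hK a a0 a1).
apply: (@le_trans _ _ ((K + 1) * a)); first by rewrite ler_wpM2r ?(ltW a0)// lerDl.
by rewrite mulrC -ler_pdivlMr// ge_min lexx orbT.
Qed.

End density.

(** * Functions of polynomial growth and their convolutions *)

Section growth_functions.
Context {R : realType} {n : nat}.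
Local Notation V := 'rV[R]_n.
Local Notation L := (@lebesgue_rV R n).
Local Notation e i := (delta_mx 0 i : V).
Implicit Types (f g h k psi m chi : V -> R[i]).

(** This growth is what a Morrey bound provides ([mor_pg]) and what makes a function a tempered
    distribution ([stemp_pg]). *)
Definition pg h := cm h /\ (\int[L]_x (cmod (h x) * wt x ^- n.+1)%:E < +oo)%E.

Definition pgI h : R := fine (\int[L]_x (cmod (h x) * wt x ^- n.+1)%:E)%E.

Lemma measurable_pg h : cm h -> measurable_fun setT (fun x => cmod (h x) * wt x ^- n.+1).
Proof. by move=> mh; apply: measurable_funM; [exact: cm_cmod|exact: measurable_wtV]. Qed.

Lemma pgZ_lty h (C : R) : pg h -> 0 <= C -> (\int[L]_x (C * (cmod (h x) * wt x ^- n.+1))%:E < +oo)%E.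
Proof.
move=> [mh ih] C0; have p0 x : 0 <= cmod (h x) * wt x ^- n.+1 by rewrite mulr_ge0 ?cmod_ge0 ?wtVX_ge0.
by rewrite (gintZl C0 (measurable_pg mh) p0) lte_mul_pinfty.
Qed.

Lemma pgZ_fine h (C : R) : pg h -> 0 <= C -> (\int[L]_x (C * (cmod (h x) * wt x ^- n.+1))%:E = (C * pgI h)%:E)%E.
Proof.
move=> [mh ih] C0; have p0 x : 0 <= cmod (h x) * wt x ^- n.+1 by rewrite mulr_ge0 ?cmod_ge0 ?wtVX_ge0.
rewrite (gintZl C0 (measurable_pg mh) p0) EFinM fineK//.
by rewrite ge0_fin_numE// integral_ge0// => x _; rewrite lee_fin.
Qed.

Lemma pg_dom h g (C : R) : (forall x, cmod (g x) <= C * wt x ^- n.+1) ->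
  forall x, cmod (h x * g x) <= C * (cmod (h x) * wt x ^- n.+1).
Proof. by move=> hg x; rewrite cmodM mulrCA ler_wpM2l ?cmod_ge0. Qed.

Lemma ci_pg h g (C : R) : pg h -> cm g -> 0 <= C -> (forall x, cmod (g x) <= C * wt x ^- n.+1) ->
  ci (fun x => h x * g x).
Proof.
move=> hh mg C0 hg; have [mh _] := hh.
apply: (ci_dom (cmM mh mg) _ (pg_dom h hg) (pgZ_lty hh C0)).
by apply: measurable_funM => //; exact: measurable_pg.
Qed.

Lemma cint_pg h g (C : R) : pg h -> cm g -> 0 <= C -> (forall x, cmod (g x) <= C * wt x ^- n.+1) ->
  cmod (cintegral (fun x => h x * g x)) <= 2 * (C * pgI h).
Proof.
move=> hh mg C0 hg; have [mh _] := hh.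
have mC : measurable_fun setT (fun x => C * (cmod (h x) * wt x ^- n.+1)).
  by apply: measurable_funM => //; exact: measurable_pg.
apply: le_trans (cmod_cint_le (ci_pg hh mg C0 hg) mC (pg_dom h hg) (pgZ_lty hh C0)) _.
by rewrite (pgZ_fine hh C0).
Qed.

Lemma pgI_ge0 h : 0 <= pgI h.
Proof. by apply/fine_ge0/integral_ge0 => x _; rewrite lee_fin mulr_ge0 ?cmod_ge0 ?wtVX_ge0. Qed.

Lemma ci_pg_dk h g : pg h -> dk n.+1 g -> ci (fun x => h x * g x).
Proof. by move=> hh [mg [C C0 hC]]; exact: (ci_pg hh mg C0 hC). Qed.

Lemma stemp_pg h : pg h -> stemp (fun psi => cintegral (fun x => h x * psi x)).
Proof.
move=> hh; split.
  move=> a p1 p2 h1 h2.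
  have c1 := ci_pg_dk hh (schw_dk n.+1 h1); have c2 := ci_pg_dk hh (schw_dk n.+1 h2).
  rewrite -(cintZ a c1) -(cintD (ciZ a c1) c2); apply: eq_cint => x.
  by rewrite mulrDr mulrCA.
move=> eps e0; have P0 := pgI_ge0 h.
have Q0 : 0 < 2 * (pgI h + 1) by rewrite mulr_gt0// ltr_wpDl.
pose d := eps / (2 * (pgI h + 1)).
have d0 : 0 < d by exact: divr_gt0.
exists n.+1, d; split => // psi hp hsn.
apply: le_lt_trans (cint_pg hh (smooth_cm (schw_smooth hp)) (ltW d0) (sn_dkb hsn)) _.
rewrite (_ : eps = 2 * (d * (pgI h + 1))).
  by rewrite ltr_pM2l// ltr_pM2l// ltrDl.
by rewrite mulrCA /d divfK// gt_eqF.
Qed.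

Lemma stemp_sub (u v : functional R n) : stemp u -> stemp v -> stemp (fun psi => u psi - v psi).
Proof.
move=> [ul uc] [vl vc]; split.
  by move=> a p1 p2 h1 h2; rewrite (ul _ _ _ h1 h2) (vl _ _ _ h1 h2); ring.
move=> eps e0; have e2 : 0 < eps / 2 by rewrite divr_gt0.
have [m1 [d1 [d10 H1]]] := uc _ e2; have [m2 [d2 [d20 H2]]] := vc _ e2.
exists (maxn m1 m2), (Num.min d1 d2); split; first by rewrite lt_min d10 d20.
move=> psi hp hs; rewrite [eps]splitr; apply: le_lt_trans (cmodB _ _) _; apply: ltrD.
  by apply: (H1 _ hp); apply: sn_le (leq_maxl m1 m2) (sn_leM _ hs); rewrite ge_min lexx.
by apply: (H2 _ hp); apply: sn_le (leq_maxr m1 m2) (sn_leM _ hs); rewrite ge_min lexx orbT.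
Qed.

(** Extends the identity in [represents] from compactly supported functions to Schwartz ones, which
    is where [Tm] takes its values. *)
Lemma stemp_ext chi delta u v : cutoff chi delta -> stemp u -> stemp v ->
  (forall psi, cc psi -> u psi = v psi) -> forall psi, schw psi -> u psi = v psi.
Proof.
move=> hc su sv huv psi hp; apply/eqP; rewrite -subr_eq0; apply/eqP.
apply: (stemp_density hc (stemp_sub su sv)) hp => p hp; by rewrite huv// subrr.
Qed.

(** The argument is [x - y] and not [y - x]: this is the transpose of the convolution in [Tm_ker],
    acting on [h] instead of [psi]. *)
Definition convk h k : V -> R[i] := fun y => cintegral (fun x => h x * k (x - y)).

Lemma cm_shift k (y : V) : cm k -> cm (fun x => k (x - y)).
Proof.
move=> hk; apply: (cmt_comp (phi := fun x : V => x - y) _ hk).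
rewrite (_ : (fun x => _) = fun x : V => 1 *: x + (- y)); last by apply/funext => x; rewrite scale1r.
exact: measurable_affine_rV.
Qed.

Lemma shift_bound k (C : R) : (forall x, cmod (k x) <= C * wt x ^- n.+1) -> forall x y,
  cmod (k (x - y)) <= C * wt y ^+ n.+1 * wt x ^- n.+1.
Proof.
move=> hC x y; have C0 : 0 <= C.
  by have := le_trans (cmod_ge0 _) (hC 0); rewrite pmulr_lge0// wtVX_gt0.
apply: le_trans (hC _) _; rewrite -mulrA ler_wpM2l//.
by have := wt_peetre x (- y) n.+1; rewrite wtN.
Qed.

Lemma ci_conv h k y : pg h -> dk n.+1 k -> ci (fun x => h x * k (x - y)).
Proof.
move=> hh [mk [C C0 hC]].
apply: (ci_pg (C := C * wt y ^+ n.+1) hh (cm_shift y mk)).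
  by rewrite mulr_ge0 ?wtX_ge0.
by move=> x; exact: shift_bound.
Qed.

Lemma conv_bound h k : pg h -> dk n.+1 k -> exists2 D, 0 <= D & forall y, cmod (convk h k y) <= D * wt y ^+ n.+1.
Proof.
move=> hh [mk [C C0 hC]]; exists (2 * (C * pgI h)); first by rewrite mulr_ge0// mulr_ge0// pgI_ge0.
move=> y; have Cy : 0 <= C * wt y ^+ n.+1 by rewrite mulr_ge0 ?wtX_ge0.
apply: le_trans (cint_pg hh (cm_shift y mk) Cy (fun x => shift_bound hC x y)) _.
by rewrite le_eqVlt; apply/orP; left; apply/eqP; ring.
Qed.

(** The sign compensates for the reflection in [k (x - y)], whose derivative in [y] is minus that of
    [k]. *)
Definition dmulc i m : V -> R[i] := fun x => (-1) * mulxi i m x.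

Lemma cc_dmulc i m : cc m -> cc (dmulc i m).
Proof. by move=> hm; apply: (cc_mul (smooth_cst (-1))); exact: cc_mulxi. Qed.

Lemma ispd_reflect i k k' (x : V) : ispd i k k' -> ispd i (fun y => k (x - y)) (fun y => (-1) * k' (x - y)).
Proof.
move=> hk; have := ispd_scale (-1) (ispd_shift x hk).
by congr ispd; apply/funext => y; rewrite scaleN1r// rmorphN1.
Qed.

(** Differentiation falls on the kernel and stays among kernels of compactly supported symbols; this
    makes [smooth_conv] a coinduction. *)
Lemma conv_ispd h m i : pg h -> cc m -> ispd i (convk h (ker m)) (convk h (ker (dmulc i m))).
Proof.
move=> hh hm; have sm := cc_schw hm; have sm' := cc_schw (cc_dmulc i hm).
have dk' := schw_dk n.+1 (schw_ker sm'); have [mk' [C C0 hC]] := dk'.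
apply: (@cint_ispd R n i (fun y x => h x * ker m (x - y)) (fun y x => h x * ker (dmulc i m) (x - y))).
- move=> x.
  have := ispd_mul (ispd_cst i (h x)) (ispd_reflect x (ispd_ker i sm)).
  congr ispd; apply/funext => y; rewrite mul0r add0r; congr (_ * _).
  by rewrite /dmulc (kerZ _ (schw_dk _ (cc_schw (cc_mulxi i hm)))).
- by move=> y; apply: (ci_conv _ hh); exact/schw_dk/schw_ker.
(* A displacement of [y0] by less than 1 at most doubles its weight, hence the dominating
   constant. *)
- move=> y0; pose D := C * (2 * wt y0) ^+ n.+1.
  have w0 : 0 <= 2 * wt y0 by rewrite mulr_ge0 ?wt_ge0.
  have D0 : 0 <= D by rewrite mulr_ge0// exprn_ge0.
  exists (fun x => D * (cmod (h x) * wt x ^- n.+1)); split.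
  + by apply: measurable_funM => //; apply: measurable_pg; case: hh.
  + exact: pgZ_lty.
  + move=> t x t1; rewrite cmodM mulrCA ler_wpM2l ?cmod_ge0//.
    apply: le_trans (shift_bound hC _ _) _.
    rewrite /D ler_wpM2r ?wtVX_ge0// ler_wpM2l//.
    by apply: lerXn2r; rewrite ?nnegrE ?wt_ge0//; exact: wt_line.
Qed.

Lemma conv_cts h m : pg h -> cc m -> continuous (reC (convk h (ker m))) /\ continuous (imC (convk h (ker m))).
Proof.
move=> hh hm; have hd i := conv_ispd i hh hm.
have hb : exists2 D, 0 <= D & forall i y, cmod (convk h (ker (dmulc i m)) y) <= D * wt y ^+ n.+1.
  have /choice[D hD] : forall i, exists D, 0 <= D /\ forall y, cmod (convk h (ker (dmulc i m)) y) <= D * wt y ^+ n.+1.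
    move=> i; have [D D0 hD] := conv_bound hh (schw_dk n.+1 (schw_ker (cc_schw (cc_dmulc i hm)))).
    by exists D.
  exists (\sum_i D i); first by apply: sumr_ge0 => i _; have [] := hD i.
  move=> i y; have [D0 h1] := hD i; apply: le_trans (h1 y) _.
  rewrite ler_wpM2r ?wtX_ge0// (bigD1 i)//= lerDl; apply: sumr_ge0 => j _; by have [] := hD j.
have [D D0 {}hb] := hb.
have hloc (x0 y : V) : `|y - x0| <= 1 -> D * wt y ^+ n.+1 <= D * (2 + `|x0|) ^+ n.+1.
  move=> yx; rewrite ler_wpM2l//; apply: lerXn2r; rewrite ?nnegrE ?wt_ge0 ?addr_ge0//.
  rewrite /wt (_ : 2 = 1 + 1)// -addrA lerD2l.
  by rewrite -[y in `|y|](subrK x0) (le_trans (ler_normD _ _))// lerD2r.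
split.
- apply: (lip_continuous (f' := fun i => reC (convk h (ker (dmulc i m))))).
    by move=> i y; have [] := hd i y.
  move=> x0; exists (D * (2 + `|x0|) ^+ n.+1) => i y yx.
  apply: le_trans (hloc x0 y yx); exact: le_trans (Re_le_cmod _) (hb i y).
- apply: (lip_continuous (f' := fun i => imC (convk h (ker (dmulc i m))))).
    by move=> i y; have [] := hd i y.
  move=> x0; exists (D * (2 + `|x0|) ^+ n.+1) => i y yx.
  apply: le_trans (hloc x0 y yx); exact: le_trans (Im_le_cmod _) (hb i y).
Qed.

Lemma smooth_conv h m : pg h -> cc m -> smooth (convk h (ker m)).
Proof.
move=> hh hm.
apply: (smooth_coind (P := fun f => exists2 m, cc m & f = convk h (ker m))); last by exists m.
move=> f [m' hm' ->]; have [c1 c2] := conv_cts hh hm'; split => // i.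
exists (convk h (ker (dmulc i m'))); first exact: conv_ispd.
by exists (dmulc i m') => //; exact: cc_dmulc.
Qed.

Lemma cmt_conv h k psi : cm h -> cm k -> cm psi ->
  cmt (fun z : V * V => h z.1 * (k (z.1 - z.2) * psi z.2)).
Proof.
move=> hh hk hp; apply: cmtM; last apply: cmtM.
- exact: (cmt_comp (phi := fst) _ hh).
- apply: (cmt_comp (phi := fun z : V * V => z.1 - z.2) _ hk).
  rewrite (_ : (fun z => _) = fun z : V * V => 1 *: z.1 + (-1) *: z.2); last by apply/funext => z; rewrite scale1r scaleN1r.
  by apply: measurable_addrV.
- exact: (cmt_comp (phi := snd) _ hp).
Qed.

(** Fubini's theorem moves the operator from the Schwartz function to [h]. *)
Lemma conv_pairing h m psi : pg h -> cc m -> schw psi ->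
  ci (fun y => convk h (ker m) y * psi y) /\
  cintegral (fun x => h x * Tm m psi x) = cintegral (fun y => convk h (ker m) y * psi y).
Proof.
move=> hh hm hp; have sm := cc_schw hm.
have dkk := schw_dk n.+1 (schw_ker sm); have [mk [C C0 hC]] := dkk; have [mh ih] := hh.
have mp := smooth_cm (schw_smooth hp).
pose K (x y : V) := h x * (ker m (x - y) * psi y).
have mK := cmt_conv mh mk mp.
(* Half of this decay absorbs the growth [wt y ^+ n.+1] of the translated kernel, the other half
   makes the integral in [y] converge. *)
have [_ [M M0 hM]] := schw_dk (n.+1 + n.+1) hp.
have dG2 (y : V) : C * wt y ^+ n.+1 * cmod (psi y) <= C * M * wt y ^- n.+1.
  rewrite -!mulrA ler_wpM2l// mulrC -ler_pdivlMr ?wtX_gt0//.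
  apply: le_trans (hM y) _; rewrite exprD invfM mulrA; exact: lexx.
have mG2 : measurable_fun setT (fun y : V => C * wt y ^+ n.+1 * cmod (psi y)).
  apply: measurable_funM; last exact: cm_cmod.
  apply: measurable_funM => //; apply: continuous_measurable_rV.
  by apply: ctsX; exact: continuous_wt.
have G20 (y : V) : 0 <= C * wt y ^+ n.+1 * cmod (psi y) by rewrite !mulr_ge0 ?wtX_ge0 ?cmod_ge0.
have iG2 : (\int[L]_y (C * wt y ^+ n.+1 * cmod (psi y))%:E < +oo)%E.
  have iw : (\int[L]_x (C * M * wt x ^- n.+1)%:E < +oo)%E.
    rewrite gintZl//; [|exact: mulr_ge0|exact: measurable_wtV|by move=> x; exact: wtVX_ge0].
    rewrite lte_mul_pinfty ?lee_fin ?mulr_ge0//; exact: wt_integral_lty.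
  apply: le_lt_trans iw; apply: ge0_le_integral => //.
  - by move=> x _; rewrite lee_fin.
  - exact/measurable_EFinP.
  - by apply/measurable_EFinP; apply: measurable_funM => //; exact: measurable_wtV.
  - by move=> y _; rewrite lee_fin.
have Kb x y : cmod (K x y) <= cmod (h x) * wt x ^- n.+1 * (C * wt y ^+ n.+1 * cmod (psi y)).
  have -> : cmod (h x) * wt x ^- n.+1 * (C * wt y ^+ n.+1 * cmod (psi y)) = cmod (h x) * ((C * wt y ^+ n.+1 * wt x ^- n.+1) * cmod (psi y)) by ring.
  rewrite /K (cmodM (h x)) (cmodM (ker m (x - y))).
  rewrite ler_wpM2l ?cmod_ge0// ler_wpM2r ?cmod_ge0//.
  exact: shift_bound hC x y.
have [c1 c2 FF] := @cint_Fubini R n K _ _ mK.1 mK.2 (measurable_pg mh) mG2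
   (fun x => mulr_ge0 (cmod_ge0 _) (wtVX_ge0 _ _)) G20 Kb ih iG2.
have E1 x : cintegral (K x) = h x * Tm m psi x.
  rewrite (Tm_ker x (schw_dk _ sm) (schw_dk _ hp)) -cintZ.
    by apply: eq_cint => y; rewrite /K; congr (h x * _); exact: mulrC.
  have [B hB] := schw_bounded (schw_ker sm).
  rewrite (_ : (fun y => _) = fun y => ker m (x - y) * psi y); last by apply/funext => y; exact: mulrC.
  apply: (dk_ci (dk_bdM _ (B := B) _ (schw_dk n.+1 hp))); last by move=> y; exact: hB.
  apply: (cmt_comp (phi := fun y : V => x - y) _ mk).
  rewrite (_ : (fun y => _) = fun y : V => (-1) *: y + x); last by apply/funext => y; rewrite scaleN1r addrC.
  exact: measurable_affine_rV.
have E2 y : cintegral (K^~ y) = convk h (ker m) y * psi y.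
  rewrite mulrC -(cintZ _ (ci_conv y hh dkk)); apply: eq_cint => x.
  by rewrite /K mulrA mulrC.
split; first by rewrite -(funext E2).
by rewrite -(eq_cint E1) FF (eq_cint E2).
Qed.

End growth_functions.

(** * Morrey bounds *)

Section morrey_bounds.
Context {R : realType} {n : nat}.
Local Notation V := 'rV[R]_n.
Local Notation L := (@lebesgue_rV R n).
Variables (p q : R).
Hypothesis q1 : 1 < q.
Hypothesis qp : q <= p.
Implicit Types (F G : V -> \bar R) (A B : R).

Lemma q_gt0 : 0 < q. Proof. exact: lt_trans q1. Qed.
Lemma q_neq0 : q != 0. Proof. by rewrite gt_eqF// q_gt0. Qed.
Lemma p_gt0 : 0 < p. Proof. exact: lt_le_trans q_gt0 qp. Qed.

(** The inverse of the volume factor of the Morrey norm on a ball of radius [rho], after taking q-th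
    powers. *)
Definition vv (rho : R) : R := (rho ^+ n * @vol1 R n) `^ (1 - q / p).

Lemma vv_ge0 rho : 0 <= vv rho. Proof. exact: powR_ge0. Qed.

(** The Morrey bound by [A], raised to the power [q] ball by ball, so that integrals are estimated
    without roots or suprema. For [A >= 0] and nonnegative [F] it amounts to
    [morrey_norm p q F <= A], by [morrey_norm_le] and [morrey_norm_mor]. *)
Definition mor A F := forall (c : V) rho, 0 < rho ->
  (\int[L]_(y in eball c rho) (F y `^ q) <= (A `^ q * vv rho)%:E)%E.

Lemma vol_gt0 rho : 0 < rho -> 0 < rho ^+ n * @vol1 R n.
Proof. by move=> r0; rewrite mulr_gt0 ?exprn_gt0// vol1_gt0. Qed.

Lemma morrey_norm_le A F : 0 <= A -> (forall y, (0 <= F y)%E) -> mor A F ->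
  (morrey_norm p q F <= A%:E)%E.
Proof.
move=> A0 F0 hF; apply: ge_ereal_sup => _ [[c rho] /= r0 <-].
rewrite lebesgue_eball//=; have b0 := vol_gt0 r0; set b := _ * vol1 in b0 *.
under eq_integral do rewrite gee0_abs//.
have := hF c rho r0; rewrite /vv -/b.
have I0 : (0 <= \int[L]_(y in eball c rho) F y `^ q)%E by apply: integral_ge0 => y _; exact: poweR_ge0.
move: (\int[L]_(y in eball c rho) _)%E I0 => [t| |]//; rewrite !lee_fin => t0 ht.
have hq : t `^ q^-1 <= A * b `^ (q^-1 - p^-1).
  apply: (@le_trans _ _ ((A `^ q * b `^ (1 - q / p)) `^ q^-1)).
    by apply: ge0_ler_powR; rewrite ?nnegrE ?invr_ge0 ?(ltW q_gt0)// mulr_ge0 ?powR_ge0.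
  rewrite powRM ?powR_ge0// -!powRrM mulfV ?q_neq0// powRr1//.
  by rewrite (_ : (1 - q / p) / q = q^-1 - p^-1)//; field; rewrite q_neq0 gt_eqF// p_gt0.
apply: le_trans (ler_wpM2l (powR_ge0 _ _) hq) _.
rewrite mulrCA -powRD; last by apply/implyP => _; rewrite gt_eqF.
by rewrite (_ : _ + _ = 0) ?powRr0 ?mulr1//; ring.
Qed.

Lemma morrey_norm_mor A F : 0 <= A -> (forall y, (0 <= F y)%E) -> (morrey_norm p q F <= A%:E)%E -> mor A F.
Proof.
move=> A0 F0 hF c rho r0.
have : (((fine (L (eball c rho)) `^ (p^-1 - q^-1))%:E *
     (\int[L]_(y in eball c rho) (`|F y| `^ q)) `^ q^-1) <= A%:E)%E.
  by apply: le_trans hF; apply: ereal_sup_ubound; exists (c, rho).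
rewrite lebesgue_eball//= /vv; have b0 := vol_gt0 r0; set b := _ * vol1 in b0 *.
under eq_integral do rewrite gee0_abs//.
have I0 : (0 <= \int[L]_(y in eball c rho) F y `^ q)%E by apply: integral_ge0 => y _; exact: poweR_ge0.
move: (\int[L]_(y in eball c rho) _)%E I0 => [t| |]//; last first.
  by rewrite poweRyr ?invr_neq0 ?q_neq0// gt0_muley ?lte_fin ?powR_gt0.
rewrite !lee_fin => t0 ht.
have hq : t `^ q^-1 <= A * b `^ (q^-1 - p^-1).
  have := ler_wpM2l (powR_ge0 b (q^-1 - p^-1)) ht; rewrite mulrA -powRD; last by apply/implyP => _; rewrite gt_eqF.
  by rewrite (_ : _ + _ = 0) ?powRr0 ?mul1r 1?mulrC//; ring.
have -> : t = (t `^ q^-1) `^ q by rewrite -powRrM mulVf ?q_neq0// powRr1.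
have -> : A `^ q * b `^ (1 - q / p) = (A * b `^ (q^-1 - p^-1)) `^ q.
  rewrite powRM ?powR_ge0// -powRrM; congr (_ * _ `^ _).
  by field; rewrite q_neq0 gt_eqF// p_gt0.
by apply: ge0_ler_powR; rewrite ?nnegrE ?powR_ge0 ?(ltW q_gt0)// mulr_ge0 ?powR_ge0.
Qed.

Lemma le_poweR (x y : \bar R) (a : R) : 0 <= a -> (0 <= x)%E -> (x <= y)%E -> (x `^ a <= y `^ a)%E.
Proof.
move=> a0; move: x y => [x| |] [y| |]//; rewrite ?lee_fin => x0 xy.
- by apply: ge0_ler_powR; rewrite ?nnegrE//; exact: le_trans xy.
- have [->|aN0] := eqVneq a 0; first by rewrite !poweRe0.
  by rewrite poweRyr// leey.
Qed.

Lemma measurable_eball_powR F c rho : measurable_fun setT F -> measurable_fun (eball c rho) (fun y => (F y `^ q)%E).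
Proof.
move=> mF; apply: measurable_funTS.
by apply: (measurableT_comp (measurable_poweR q)).
Qed.

Lemma mor_mono A F G : measurable_fun setT F -> measurable_fun setT G ->
  (forall y, (0 <= F y)%E) -> (forall y, (F y <= G y)%E) -> mor A G -> mor A F.
Proof.
move=> mF mG F0 FG hG c rho r0; apply: le_trans (hG c rho r0).
apply: ge0_le_integral => //; first exact: measurable_eball.
- by move=> y _; exact: poweR_ge0.
- exact: measurable_eball_powR.
- exact: measurable_eball_powR.
- by move=> y _; apply: le_poweR => //; exact: ltW q_gt0.
Qed.

Lemma mor_le A B F : 0 <= A -> A <= B -> mor A F -> mor B F.
Proof.
move=> A0 AB hF c rho r0; apply: le_trans (hF c rho r0) _.
rewrite lee_fin ler_wpM2r ?vv_ge0//; apply: ge0_ler_powR; rewrite ?nnegrE ?(ltW q_gt0)//.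
exact: le_trans AB.
Qed.

Lemma powR_add_le (x y a : R) : 0 <= x -> 0 <= y -> 0 <= a -> (x + y) `^ a <= 2 `^ a * (x `^ a + y `^ a).
Proof.
move=> x0 y0 a0; wlog xy : x y x0 y0 / x <= y.
  by move=> H; case: (leP x y) => [|/ltW] h; [exact: H|rewrite addrC [X in _ * X]addrC; exact: H].
apply: (@le_trans _ _ ((2 * y) `^ a)).
  by apply: ge0_ler_powR; rewrite ?nnegrE ?addr_ge0 ?mulr_ge0// mulrDl mul1r lerD2r.
by rewrite powRM// ler_wpM2l ?powR_ge0// lerDr powR_ge0.
Qed.

Lemma poweR_add_le (x y : \bar R) (a : R) : 0 < a -> (0 <= x)%E -> (0 <= y)%E ->
  ((x + y) `^ a <= (2 `^ a)%:E * (x `^ a + y `^ a))%E.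
Proof.
move=> a0; have aN0 : a != 0 by rewrite gt_eqF.
have p2 : (0 < (2 `^ a)%:E :> \bar R)%E by rewrite lte_fin powR_gt0.
move: x y => [x| |] [y| |]//; rewrite ?lee_fin => x0 y0.
- by apply: powR_add_le => //; exact: ltW.
- by rewrite addey// poweRyr// addey ?poweR_EFin// gt0_muley.
- by rewrite addye// poweRyr// addye ?poweR_EFin// gt0_muley.
- by rewrite addye// poweRyr// addye// gt0_muley.
Qed.

(** Two equal terms count at most as a second factor 2 inside the power, as [a >= 1]; with the 2 of
    [powR_add_le] this makes the constant 4 of [mor_add] and [lr_add]. *)
Lemma powR_two (a B : R) : 1 <= a -> 0 <= B -> 2 `^ a * (B `^ a + B `^ a) <= (4 * B) `^ a.
Proof.
move=> a1 B0; have -> : 4 = 2 * 2 :> R by ring.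
rewrite !powRM// -mulrA ler_wpM2l ?powR_ge0//.
rewrite (_ : B `^ a + B `^ a = 2 * B `^ a); last by ring.
by rewrite ler_wpM2r ?powR_ge0// le1r_powR// ler1n.
Qed.

Lemma mor_add A B F G : 0 <= A -> 0 <= B -> measurable_fun setT F -> measurable_fun setT G ->
  (forall y, (0 <= F y)%E) -> (forall y, (0 <= G y)%E) -> mor A F -> mor B G ->
  mor (4 * (A + B)) (fun y => (F y + G y)%E).
Proof.
move=> A0 B0 mF mG F0 G0 hF hG c rho r0.
have mE := measurable_eball c rho.
have m1 := @measurable_eball_powR F c rho mF; have m2 := @measurable_eball_powR G c rho mG.
apply: (@le_trans _ _ (\int[L]_(y in eball c rho) ((2 `^ q)%:E * (F y `^ q + G y `^ q)))%E).
  apply: ge0_le_integral => //.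
  - by move=> y _; exact: poweR_ge0.
  - by apply: measurable_eball_powR; exact: emeasurable_funD.
  - by apply: emeasurable_funM => //; exact: emeasurable_funD.
  - by move=> y _; apply: poweR_add_le => //; exact: q_gt0.
rewrite ge0_integralZl//; last 2 first.
- exact: emeasurable_funD.
- by move=> y _; rewrite adde_ge0 ?poweR_ge0.
rewrite ge0_integralD//; [|by move=> y _; exact: poweR_ge0|by move=> y _; exact: poweR_ge0].
apply: (@le_trans _ _ ((2 `^ q)%:E * ((A + B) `^ q * vv rho + (A + B) `^ q * vv rho)%:E)%E).
  rewrite lee_pmul2l ?fin_numE ?lte_fin ?powR_gt0// EFinD; apply: leeD.
    by apply: (@mor_le A (A + B) F A0 _ hF) => //; rewrite lerDl.
  by apply: (@mor_le B (A + B) G B0 _ hG) => //; rewrite lerDr.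
rewrite -EFinM lee_fin -mulrDl mulrA ler_wpM2r ?vv_ge0//.
by apply: powR_two; [exact: ltW|exact: addr_ge0].
Qed.

Lemma morZ A (a : R) F : 0 <= A -> 0 <= a -> measurable_fun setT F -> (forall y, (0 <= F y)%E) -> mor A F ->
  mor (a * A) (fun y => (a%:E * F y)%E).
Proof.
move=> A0 a0 mF F0 hF c rho r0.
have E y : ((a%:E * F y) `^ q = (a `^ q)%:E * F y `^ q)%E by rewrite poweRM.
under eq_integral do rewrite E.
rewrite ge0_integralZl//; last 4 first.
- exact: measurable_eball.
- exact: measurable_eball_powR.
- by move=> y _; exact: poweR_ge0.
- by rewrite lee_fin powR_ge0.
rewrite powRM// -mulrA EFinM.
by apply: lee_wpmul2l; [rewrite lee_fin powR_ge0|exact: hF].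
Qed.

Lemma mor0 A F : 0 <= A -> (forall y, F y = 0%E) -> mor A F.
Proof.
move=> A0 hF c rho r0; rewrite (eq_integral (fun=> 0%E)); last by move=> y _; rewrite hF poweR0r// q_neq0.
by rewrite integral0 lee_fin mulr_ge0 ?powR_ge0.
Qed.

End morrey_bounds.

(** * Convolution on Morrey spaces *)

Section convolution_bound.
Context {R : realType} {n : nat}.
Local Notation V := 'rV[R]_n.
Local Notation L := (@lebesgue_rV R n).
Variables (p q : R).
Hypothesis q1 : 1 < q.
Hypothesis qp : q <= p.
Implicit Types (h k m : V -> R[i]) (A B : R).
Local Notation mor := (mor p q).
Local Notation vv := (@vv R n p q).

Let q0 : 0 < q. Proof. exact: q_gt0. Qed.
Let qN0 : q != 0. Proof. exact: q_neq0. Qed.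

(** Young's inequality in tangent form: the convex function [a ^ q] lies above its tangent at
    [t]. *)
Lemma young_powR (a t : R) : 0 <= a -> 0 <= t -> q * t `^ (q - 1) * a <= a `^ q + (q - 1) * t `^ q.
Proof.
move=> a0 t0; have q10 : 0 < q - 1 by rewrite subr_gt0.
have q1N : q - 1 != 0 by rewrite gt_eqF.
have := @conjugate_powR R a (t `^ (q - 1)) q (q / (q - 1)) a0 (powR_ge0 _ _) q0 (divr_gt0 q0 q10) _.
rewrite -powRrM (_ : (q - 1) * (q / (q - 1)) = q); last by rewrite mulrC divfK.
have -> : q^-1 + (q / (q - 1))^-1 = 1 by field; rewrite qN0 q1N.
move=> /(_ erefl) h.
have -> : q * t `^ (q - 1) * a = q * (a * t `^ (q - 1)) by ring.
apply: le_trans (ler_wpM2l (ltW q0) h) _.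
rewrite le_eqVlt; apply/orP; left; apply/eqP; field; by rewrite qN0 q1N.
Qed.

(** Jensen's inequality for a measure [k] that is not normalized: [K] only bounds its mass, whence
    the factor [K ^ (q - 1)]. *)
Lemma jensen_powR (a k : V -> R) (K I : R) : measurable_fun setT a -> measurable_fun setT k ->
  (forall x, 0 <= a x) -> (forall x, 0 <= k x) -> 0 < K ->
  (\int[L]_x (k x)%:E <= K%:E)%E -> (\int[L]_x (a x * k x)%:E = I%:E)%E ->
  ((I `^ q)%:E <= (K `^ (q - 1))%:E * \int[L]_x (a x `^ q * k x)%:E)%E.
Proof.
move=> ma mk a0 k0 K0 hk hI.
have I0 : 0 <= I by rewrite -lee_fin -hI; apply: integral_ge0 => x _; rewrite lee_fin mulr_ge0.
(* [x ^ q] lies above its tangent at [t], the mean of [a] against [k / K]. *)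
pose t := I / K; have t0 : 0 <= t by rewrite divr_ge0// ltW.
have IE : I = t * K by rewrite /t divfK// gt_eqF.
have maq : measurable_fun setT (fun x => a x `^ q) by exact: measurableT_comp (measurable_powR q) ma.
have J0 : (0 <= \int[L]_x (a x `^ q * k x)%:E)%E.
  by apply: integral_ge0 => x _; rewrite lee_fin mulr_ge0 ?powR_ge0.
have c0 : 0 <= q * t `^ (q - 1) by rewrite mulr_ge0 ?powR_ge0 ?ltW.
have d0 : 0 <= (q - 1) * t `^ q by rewrite mulr_ge0 ?powR_ge0// subr_ge0 ltW.
have key : ((q * t `^ (q - 1) * I)%:E <= \int[L]_x (a x `^ q * k x)%:E + ((q - 1) * t `^ q * K)%:E)%E.
  have mak : measurable_fun setT (fun x => a x * k x) by exact: measurable_funM.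
  have m1 : measurable_fun setT (fun x => (a x `^ q * k x)%:E) by apply/measurable_EFinP; exact: measurable_funM.
  have m2 : measurable_fun setT (fun x => ((q - 1) * t `^ q * k x)%:E) by apply/measurable_EFinP; exact: measurable_funM.
  have : (\int[L]_x (q * t `^ (q - 1) * (a x * k x))%:E <=
         \int[L]_x ((a x `^ q * k x)%:E + ((q - 1) * t `^ q * k x)%:E))%E.
    apply: ge0_le_integral => //.
    - by move=> x _; rewrite lee_fin mulr_ge0// mulr_ge0.
    - by apply/measurable_EFinP; exact: measurable_funM.
    - exact: emeasurable_funD.
    - move=> x _; rewrite -EFinD lee_fin mulrA -mulrDl ler_wpM2r//.
      exact: young_powR.
  rewrite (gintZl c0 mak); last by move=> x; rewrite mulr_ge0.
  rewrite hI -EFinM => /le_trans; apply.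
  rewrite ge0_integralD//; [|by move=> x _; rewrite lee_fin mulr_ge0 ?powR_ge0|by move=> x _; rewrite lee_fin mulr_ge0].
  rewrite (gintZl d0 mk k0) leeD2l// EFinM; apply: lee_wpmul2l hk.
  by rewrite lee_fin.
have p0 : 0 < K `^ (q - 1) by rewrite powR_gt0.
move: J0 key; case: (\int[L]_x _)%E => [j| |]//; last first.
  by move=> _ _; rewrite gt0_muley ?lte_fin// leey.
rewrite -EFinD -EFinM !lee_fin => j0.

have E1 : t `^ (q - 1) * t = t `^ q by rewrite mulrC mulr_powRB1.
rewrite IE (_ : q * t `^ (q - 1) * (t * K) = q * (t `^ (q - 1) * t) * K); last by ring.
rewrite E1 (_ : q * t `^ q * K = t `^ q * K + (q - 1) * t `^ q * K); last by ring.
rewrite lerD2r => hj.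
rewrite powRM ?(ltW K0)// -(mulr_powRB1 (ltW K0) q0) mulrA mulrC.
by rewrite ler_wpM2l ?powR_ge0.
Qed.

Lemma measurable_powR_comp d (T : measurableType d) (f : T -> R) : measurable_fun setT f ->
  measurable_fun setT (fun x => f x `^ q).
Proof. by move=> mf; exact: measurableT_comp (measurable_powR q) mf. Qed.

Lemma integral_shift (F : V -> \bar R) (z : V) : measurable_fun setT F -> (forall x, 0 <= F x)%E ->
  (\int[L]_y F (y + z)%R = \int[L]_y F y)%E.
Proof.
move=> mF F0; have := ge0_integral_affine_rV z (oner_neq0 R) mF F0.
rewrite normr1 expr1n invr1 mul1e => <-.
by apply: eq_integral => y _; rewrite scale1r.
Qed.

Lemma measurable_shift_rV (z : V) : measurable_fun setT (fun y : V => y + z).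
Proof.
rewrite (_ : (fun y => _) = fun y : V => 1 *: y + z); last by apply/funext => y; rewrite scale1r.
exact: measurable_affine_rV.
Qed.

Lemma integral_eball_shift (F : V -> \bar R) c rho (z : V) : measurable_fun setT F -> (forall x, 0 <= F x)%E ->
  (\int[L]_(y in eball c rho) F (y + z)%R = \int[L]_(y in eball (c + z) rho) F y)%E.
Proof.
move=> mF F0; rewrite integral_mkcond [RHS]integral_mkcond.
have E : eball c rho = (fun y => y + z) @^-1` eball (c + z) rho by rewrite eball_trans addrK.
rewrite -[RHS](integral_shift z); last 2 first.
- by apply/(measurable_restrictT _ _).1; [exact: measurable_eball|exact: measurable_funTS].
- by move=> x; apply: erestrict_ge0.
apply: eq_integral => y _; rewrite !patchE E.
suff -> : (y \in (fun y => y + z) @^-1` eball (c + z) rho) = (y + z \in eball (c + z) rho) by [].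
by apply/idP/idP; rewrite !inE.
Qed.

(** With [z = x - y] as the new variable and the integrals exchanged, the inner one is that of [F]
    over the translated ball [eball (c + z) rho], bounded by [M] for every [z]. It is the uniformity
    of Morrey bounds in the centre that enters here. *)
Lemma tonelli_eball (F k : V -> R) c rho (M : R) : measurable_fun setT F -> measurable_fun setT k ->
  (forall x, 0 <= F x) -> (forall x, 0 <= k x) -> 0 <= M ->
  (forall z, \int[L]_(y in eball (c + z) rho) (F y)%:E <= M%:E)%E ->
  (\int[L]_(y in eball c rho) \int[L]_x (F x * k (x - y))%:E <= \int[L]_z (M * k z)%:E)%E.
Proof.
move=> mF mk F0 k0 M0 hM.
have mFE : measurable_fun setT (fun y => (F y)%:E) by exact/measurable_EFinP.
have E1 y : (\int[L]_x (F x * k (x - y))%:E = \int[L]_z (F (z + y) * k z)%:E)%E.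
  rewrite -(integral_shift y).
  - by apply: eq_integral => z _; rewrite addrK.
  - apply/measurable_EFinP/measurable_funM => //.
    exact: measurableT_comp mk (measurable_shift_rV (- y)).
  - by move=> x; rewrite lee_fin mulr_ge0.
under eq_integral do rewrite E1.
rewrite integral_mkcond.
pose I (y : V) : R := \1_(eball c rho) y.
have mI : measurable_fun setT I by apply: measurable_indic; exact: measurable_eball.
have I0 y : 0 <= I y by rewrite /I indicE.
have E2 y : ((fun y => \int[L]_z (F (z + y) * k z)%:E) \_ (eball c rho) y = \int[L]_z (I y * (F (z + y) * k z))%:E)%E.
  rewrite patchE /I indicE; case: (y \in eball c rho) => /=.
    by apply: eq_integral => z _; rewrite mul1r.
  by rewrite integral0_eq// => z _; rewrite mul0r.
under eq_integral do rewrite E2.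
pose f (w : V * V) := (I w.1 * (F (w.2 + w.1) * k w.2))%:E.
have f0 w : (0 <= f w)%E by rewrite lee_fin !mulr_ge0.
have mf : measurable_fun setT f.
  apply/measurable_EFinP; apply: measurable_funM; first exact: measurableT_comp mI measurable_fst.
  apply: measurable_funM; last exact: measurableT_comp mk measurable_snd.
  apply: (measurableT_comp mF).
  rewrite (_ : (fun w => _) = fun w : V * V => 1 *: w.2 + 1 *: w.1); last by apply/funext => w; rewrite !scale1r.
  by apply: measurable_addrV.
rewrite (@fubini_tonelli _ _ V V R L L f mf f0).
apply: ge0_le_integral => //.
- by move=> z _; apply: integral_ge0.
- by apply: (@measurable_fun_fubini_tonelli_G _ _ V V R L f).
- by apply/measurable_EFinP; exact: measurable_funM.
move=> z _; rewrite mulrC EFinM.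
apply: (@le_trans _ _ ((k z)%:E * \int[L]_(y in eball (c + z) rho) (F y)%:E)%E); last first.
  by apply: lee_wpmul2l; [rewrite lee_fin|exact: hM].
rewrite le_eqVlt; apply/orP; left; apply/eqP.
rewrite -(integral_eball_shift c rho z mFE) => [|x]; last by rewrite lee_fin.
have mFz : measurable_fun setT (fun y : V => F (y + z)) by exact: measurableT_comp mF (measurable_shift_rV z).
have kz := k0 z.
rewrite -ge0_integralZl//; last 3 first.
- exact: measurable_eball.
- by apply: measurable_funTS; apply/measurable_EFinP.
- by move=> y _; rewrite lee_fin.
rewrite [RHS]integral_mkcond; apply: eq_integral => y _.
rewrite patchE /f /I /= indicE; case: (y \in eball c rho) => /=.
  by rewrite mul1r mulrC addrC EFinM.
by rewrite mul0r.
Qed.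

Lemma vv_le (rho : R) : 0 < rho -> vv rho <= 1 + rho ^+ n * @vol1 R n.
Proof.
move=> r0; rewrite /vv; have := vol_gt0 (n := n) r0; move: (_ * _) => b b0.
have p0 := p_gt0 q1 qp.
have e0 : 0 <= 1 - q / p by rewrite subr_ge0 ler_pdivrMr// mul1r.
have e1 : 1 - q / p <= 1 by rewrite gerBl divr_ge0// ltW.
case: (leP b 1) => b1.
  apply: (@le_trans _ _ 1); last by rewrite lerDl ltW.
  have b01 : 0 < b <= 1 by rewrite b0 b1.
  by have := ger_powR b01 e0; rewrite powRr0.
apply: (@le_trans _ _ b); last by rewrite lerDr.
by apply: ler1_powR => //; exact: ltW.
Qed.

(** The bound [t <= 1 + t ^ q] compares the integral of [|h|] over a ball with the volume plus the
    Morrey bound. As [1 - q / p] lies between 0 and 1, both are of order [2 ^+ (n * k)] at radius of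
    order [2 ^+ k], and [growth_integral] applies. *)
Lemma mor_pg A h : cm h -> mor A (fun y => (cmod (h y))%:E) -> pg h.
Proof.
move=> mh hA; split=> //.
pose D := n.+1%:R ^+ n * @vol1 R n.
have D0 : 0 < D by exact: vol_gt0.
have Aq : 0 <= A `^ q by exact: powR_ge0.
apply: (@growth_integral R n (fun x => cmod (h x)) (D + A `^ q * (1 + D)) n (cm_cmod mh) (fun x => cmod_ge0 _)) => k.
pose rho : R := n.+1%:R * 2 ^+ k.
have r0 : 0 < rho by rewrite mulr_gt0 ?exprn_gt0.
have vE : rho ^+ n * @vol1 R n = D * 2 ^+ (n * k) by rewrite /rho /D exprMn -exprM (mulnC k); ring.
have mE := @measurable_eball R n 0 rho.
have mhE : measurable_fun (eball (0 : V) rho) (fun x => (cmod (h x))%:E).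
  by apply: measurable_funTS; apply/measurable_EFinP; exact: cm_cmod.
have mhq : measurable_fun (eball (0 : V) rho) (fun x => ((cmod (h x))%:E `^ q)%E).
  by apply: measurable_eball_powR; apply/measurable_EFinP; exact: cm_cmod.
apply: (@le_trans _ _ (\int[L]_(x in eball (0%R : V) rho) (cmod (h x))%:E)%E).
  apply: ge0_subset_integral => //.
  - exact: ball_measurable.
  - by move=> x _; rewrite lee_fin cmod_ge0.
  - exact: ball_le_eball.
apply: (@le_trans _ _ (\int[L]_(x in eball (0%R : V) rho) (1 + (cmod (h x))%:E `^ q))%E).
  apply: ge0_le_integral => //.
  - by move=> x _; rewrite lee_fin cmod_ge0.
  - exact: emeasurable_funD.
  - move=> x _; rewrite poweR_EFin -EFinD lee_fin.
    case: (leP (cmod (h x)) 1) => hx; first by apply: le_trans hx _; rewrite lerDl powR_ge0.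
    apply: (@le_trans _ _ (cmod (h x) `^ q)); last by rewrite lerDr.
    by apply: le1r_powR; exact: ltW.
rewrite ge0_integralD//; last by move=> x _; exact: poweR_ge0.
rewrite integral_cst// mul1e.
apply: (@le_trans _ _ ((D * 2 ^+ (n * k))%:E + (A `^ q * vv rho)%:E)%E).
  by rewrite -vE -(lebesgue_eball (0 : V) r0); apply: leeD => //; exact: hA.
rewrite -EFinD lee_fin.
have e1 : 1 <= 2 ^+ (n * k) :> R by apply: exprn_ege1; rewrite ler1n.
apply: (@le_trans _ _ (D * 2 ^+ (n * k) + A `^ q * (1 + D * 2 ^+ (n * k)))).
  by rewrite lerD2l ler_wpM2l// -vE vv_le.
rewrite [X in _ <= X]mulrDl lerD2l -mulrA ler_wpM2l// mulrDl mul1r lerD2r//.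
Qed.

(** Jensen's inequality bounds the q-th power of the convolution by [C * J y], where [J] averages
    [|h| ^ q] against the modulus of the translated kernel; [tonelli_eball] then reduces to the
    Morrey bound of [h] on translated balls. The factors [K ^ (q - 1)] and [K] combine to [K ^ q]. A
    positive [K] stands in for [kL1 m], which may vanish. *)
Lemma mor_conv A K h m : 0 <= A -> cm h -> mor A (fun y => (cmod (h y))%:E) -> cc m -> 0 < K -> kL1 m <= K ->
  mor (2 * K * A) (fun y => (cmod (convk h (ker m) y))%:E).
Proof.
move=> A0 mh hA hm K0 hK c rho r0.
have hh := mor_pg mh hA; have sm := cc_schw hm; have sk := schw_ker sm.
have dkk := schw_dk n.+1 sk.
have mk := cm_cmod (smooth_cm (schw_smooth sk)).
have mhq := measurable_powR_comp (cm_cmod mh).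
have hq0 x : 0 <= cmod (h x) `^ q by exact: powR_ge0.
pose J y := (\int[L]_x (cmod (h x) `^ q * cmod (ker m (x - y)))%:E)%E.
have mJ : measurable_fun setT J.
  pose fJ (w : V * V) := (cmod (h w.2) `^ q * cmod (ker m (w.2 - w.1)))%:E.
  apply: (@measurable_fun_fubini_tonelli_F _ _ V V R L fJ); last first.
    move=> w; rewrite /fJ lee_fin mulr_ge0 ?cmod_ge0//.
  apply/measurable_EFinP; apply: measurable_funM; first exact: measurableT_comp mhq measurable_snd.
  apply: (measurableT_comp mk).
  rewrite (_ : (fun w => _) = fun w : V * V => 1 *: w.2 + (-1) *: w.1); last by apply/funext => w; rewrite scale1r scaleN1r.
  by apply: measurable_addrV.
have J0 y : (0 <= J y)%E by apply: integral_ge0 => x _; rewrite lee_fin mulr_ge0 ?cmod_ge0.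
have [cR cI] := conv_cts hh hm.
have mc : measurable_fun setT (fun y => cmod (convk h (ker m) y)) := cm_cmod (cm_cts cR cI).
pose C := 2 `^ q * K `^ (q - 1).
have C0 : 0 <= C by rewrite mulr_ge0 ?powR_ge0.
have key y : ((cmod (convk h (ker m) y))%:E `^ q <= C%:E * J y)%E.
  have ck := ci_conv y hh dkk.
  have b1 := cmod_cint ck; have b2 := ci_lty ck.
  have ms : measurable_fun setT (fun x : V => cmod (ker m (x - y))) := measurableT_comp mk (measurable_shift_rV (- y)).
  have [I hI] : exists I, (\int[L]_x (cmod (h x) * cmod (ker m (x - y)))%:E = I%:E)%E.
    exists (fine (\int[L]_x (cmod (h x) * cmod (ker m (x - y)))%:E)%E); rewrite fineK//.
    rewrite ge0_fin_numE; last by apply: integral_ge0 => x _; rewrite lee_fin mulr_ge0 ?cmod_ge0.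
    by move: b2; under eq_integral do rewrite cmodM.
  have hks : (\int[L]_x (cmod (ker m (x - y)))%:E <= K%:E)%E.
    rewrite (integral_shift (F := fun x => (cmod (ker m x))%:E)) ?kL1E// => [|x]; last by rewrite lee_fin cmod_ge0.
    exact/measurable_EFinP.
  have := jensen_powR (cm_cmod mh) ms (fun x => cmod_ge0 _) (fun x => cmod_ge0 _) K0 hks hI.
  rewrite -/(J y) => hJ.
  rewrite poweR_EFin.
  have I0 : 0 <= I by rewrite -lee_fin -hI; apply: integral_ge0 => x _; rewrite lee_fin mulr_ge0 ?cmod_ge0.
  have hcI : cmod (convk h (ker m) y) <= 2 * I.
    rewrite -lee_fin; apply: le_trans b1 _.
    by under eq_integral do rewrite cmodM; rewrite hI.
  apply: (@le_trans _ _ ((2 `^ q)%:E * (I `^ q)%:E)%E).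
    rewrite -EFinM lee_fin -powRM//; apply: ge0_ler_powR; rewrite ?nnegrE ?cmod_ge0 ?mulr_ge0//.
    exact: ltW.
  by rewrite /C EFinM -muleA; apply: lee_wpmul2l => //; rewrite lee_fin powR_ge0.
apply: (@le_trans _ _ (\int[L]_(y in eball c rho) (C%:E * J y))%E).
  apply: ge0_le_integral => //.
  - exact: measurable_eball.
  - by move=> y _; exact: poweR_ge0.
  - by apply: measurable_eball_powR; exact/measurable_EFinP.
  - by apply: emeasurable_funM => //; exact: measurable_funTS.
rewrite ge0_integralZl//; last 2 first.
- exact: measurable_eball.
- exact: measurable_funTS.
have Av0 : 0 <= A `^ q * vv rho by rewrite mulr_ge0 ?powR_ge0.
apply: (@le_trans _ _ (C%:E * (K * (A `^ q * vv rho))%:E)%E).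
  apply: lee_wpmul2l; first by rewrite lee_fin.
  apply: (@le_trans _ _ (\int[L]_z ((A `^ q * vv rho) * cmod (ker m z))%:E)%E).
    apply: (@tonelli_eball (fun x => cmod (h x) `^ q) (fun x => cmod (ker m x))) => //.
    - by move=> x; exact: cmod_ge0.
    - by move=> z; exact: hA.
  rewrite gintZl//; last by move=> x; exact: cmod_ge0.
  rewrite kL1E// -EFinM lee_fin mulrC ler_wpM2r//.
rewrite -EFinM lee_fin /C !powRM ?mulr_ge0 ?(ltW K0)//.
rewrite -(mulr_powRB1 (ltW K0) q0) le_eqVlt; apply/orP; left; apply/eqP; ring.
Qed.

End convolution_bound.

(** * Mixed norms *)

Section sequence_norm.
Context {R : realType}.
Implicit Types (a b : nat -> R) (r : \bar R) (t : R).

Definition lr r a : \bar R :=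
  if r is r0%:E then ((\sum_(1 <= j <oo) (a j `^ r0)%:E) `^ r0^-1)%E
  else ereal_sup [set (a j)%:E | j in [set j : nat | (1 <= j)%N]].

Lemma nneseries_le_term (u : nat -> \bar R) k j : (k <= j)%N -> (forall i, 0 <= u i)%E ->
  (u j <= \sum_(k <= i <oo) u i)%E.
Proof.
move=> kj u0.
have u0' : forall i, (k <= i)%N -> xpredT i -> (0%R <= u i)%E by move=> i _ _; exact: u0.
apply: le_trans (nneseries_lim_ge j.+1 u0').
by rewrite big_nat_recr//= leeDr// sume_ge0.
Qed.

Lemma nneseries_le_bound (u : nat -> R) k (M : R) : (forall i, 0 <= u i) ->
  (forall N, \sum_(k <= i < N) u i <= M) -> (\sum_(k <= i <oo) (u i)%:E <= M%:E)%E.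
Proof.
move=> u0 hM; apply: lime_le.
  by apply: is_cvg_nneseries => i _ _; rewrite lee_fin.
by apply: nearW => N; rewrite sumEFin lee_fin.
Qed.

Lemma lee_fin_powR (x y : R) : (0 <= (x `^ y)%:E)%E.
Proof. by rewrite lee_fin powR_ge0. Qed.

Lemma lr_lexp (r0 : R) a t : 1 <= r0 -> 0 <= t -> (\sum_(1 <= j <oo) (a j `^ r0)%:E <= (t `^ r0)%:E)%E ->
  (lr r0%:E a <= t%:E)%E.
Proof.
move=> r1 t0 h; have r0gt : 0 < r0 by exact: lt_le_trans r1.
rewrite -[t in X in (_ <= X)%E](powRr1 t0) -[X in _ `^ X](@mulfV _ r0) ?gt_eqF// powRrM -poweR_EFin.
apply: le_poweR => //; first by rewrite invr_ge0 ltW.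
by apply: nneseries_ge0 => i _ _; rewrite lee_fin powR_ge0.
Qed.

Lemma lexp_lr (r0 : R) a t : 1 <= r0 -> 0 <= t -> (lr r0%:E a <= t%:E)%E ->
  (\sum_(1 <= j <oo) (a j `^ r0)%:E <= (t `^ r0)%:E)%E.
Proof.
move=> r1 t0; have r0gt : 0 < r0 by exact: lt_le_trans r1.
have r0N : r0^-1 != 0 by rewrite invr_neq0// gt_eqF.
rewrite /lr; have S0 : (0 <= \sum_(1 <= j <oo) (a j `^ r0)%:E)%E.
  by apply: nneseries_ge0 => i _ _; rewrite lee_fin powR_ge0.
move: (\sum_(1 <= j <oo) _)%E S0 => [x| |]//; last by rewrite poweRyr.
rewrite poweR_EFin !lee_fin => x0 h.
rewrite -[x](powRr1 x0) -[X in _ `^ X <= _](@mulVf _ r0) ?gt_eqF// powRrM.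
by apply: ge0_ler_powR; rewrite ?nnegrE ?powR_ge0 ?(ltW r0gt).
Qed.

Lemma lr_ge0 r a : (1 <= r)%E -> (forall j, 0 <= a j) -> (0 <= lr r a)%E.
Proof.
case: r => [r0| |]// r1 a0; first exact: poweR_ge0.
apply: le_trans (_ : (a 1%N)%:E <= _)%E; first by rewrite lee_fin.
by apply: ereal_sup_ubound; exists 1%N.
Qed.

Lemma lr_ge r a j : (1 <= r)%E -> (forall j, 0 <= a j) -> (1 <= j)%N -> ((a j)%:E <= lr r a)%E.
Proof.
move=> r1 a0 j1; have := lr_ge0 r1 a0; case: r r1 => [r0| |]// r1 l0; last first.
  by apply: ereal_sup_ubound; exists j.
move E : (lr r0%:E a) l0 => [t| |]// t0; last exact: leey.
have h : (lr r0%:E a <= t%:E)%E by rewrite E.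
rewrite lee_fin in r1; have := lexp_lr r1 t0 h; have r0gt : 0 < r0 by exact: lt_le_trans r1.
have hj := @nneseries_le_term (fun i => (a i `^ r0)%:E) 1 j j1 (fun i => lee_fin_powR (a i) r0).
move=> /(le_trans hj).
rewrite !lee_fin => h2.
rewrite leNgt; apply/negP => /(gt0_ltr_powR r0gt) h3.
by have := h3 t0 (a0 j); rewrite ltNge h2.
Qed.

Lemma lr_mono r a b : (1 <= r)%E -> (forall j, 0 <= a j) -> (forall j, (1 <= j)%N -> a j <= b j) -> (lr r a <= lr r b)%E.
Proof.
move=> r1 a0 ab; case: r r1 => [r0| |]// r1; last first.
  apply: ge_ereal_sup => _ [j j1 <-]; apply: (@le_trans _ _ (b j)%:E); first by rewrite lee_fin ab.
  by apply: ereal_sup_ubound; exists j.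
rewrite lee_fin in r1; have r0gt : 0 < r0 by exact: lt_le_trans r1.
apply: le_poweR; first by rewrite invr_ge0 ltW.
  by apply: nneseries_ge0 => i _ _; rewrite lee_fin powR_ge0.
pose b' j := if (1 <= j)%N then b j else a j.
have -> : (\sum_(1 <= j <oo) (b j `^ r0)%:E = \sum_(1 <= j <oo) (b' j `^ r0)%:E)%E.
  congr (lim (_ @ \oo)); apply/funext => k; apply: eq_big_nat => i /andP[i1 _].
  by rewrite /b' i1.
apply: lee_nneseries => [i _ _|i _]; first by rewrite lee_fin powR_ge0.
have abi : a i <= b' i by rewrite /b'; case: ifP => // /ab.
rewrite lee_fin; apply: ge0_ler_powR; rewrite ?nnegrE ?(ltW r0gt)//.
exact: le_trans abi.
Qed.

Lemma lr_add r a b : (1 <= r)%E -> (forall j, 0 <= a j) -> (forall j, 0 <= b j) ->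
  (lr r (fun j => (a j + b j)%R) <= 4%:E * (lr r a + lr r b))%E.
Proof.
move=> r1 a0 b0; have la := lr_ge0 r1 a0; have lb := lr_ge0 r1 b0.
have p4 : (0 < 4%:E :> \bar R)%E by rewrite lte_fin.
move Ea : (lr r a) la => [ta| |]// ta0; last by rewrite addye ?gt0_muley ?leey// -ltNye (lt_le_trans _ lb).
move Eb : (lr r b) lb => [tb| |]// tb0; last by rewrite addey ?gt0_muley ?leey.
rewrite -EFinD -EFinM.
rewrite !lee_fin in ta0 tb0.
case: r r1 Ea Eb => [r0| |]// r1 Ea Eb; last first.
  apply: ge_ereal_sup => _ [j j1 <-]; rewrite lee_fin.
  have ha : a j <= ta by rewrite -lee_fin -Ea; apply: ereal_sup_ubound; exists j.
  have hb : b j <= tb by rewrite -lee_fin -Eb; apply: ereal_sup_ubound; exists j.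
  apply: (@le_trans _ _ (ta + tb)); first exact: lerD.
  by rewrite ler_peMl ?addr_ge0// ler1n.
rewrite lee_fin in r1; have r0gt : 0 < r0 by exact: lt_le_trans r1.
have hta : (lr r0%:E a <= ta%:E)%E by rewrite Ea.
have htb : (lr r0%:E b <= tb%:E)%E by rewrite Eb.
have Sa := lexp_lr r1 ta0 hta; have Sb := lexp_lr r1 tb0 htb.
apply: lr_lexp => //; first by rewrite mulr_ge0// addr_ge0.
apply: (@le_trans _ _ (\sum_(1 <= j <oo) ((2 `^ r0)%:E * ((a j `^ r0)%:E + (b j `^ r0)%:E)))%E).
  apply: lee_nneseries => [i _ _|i _]; first by rewrite lee_fin powR_ge0.
  by rewrite -EFinD -EFinM lee_fin; apply: powR_add_le => //; exact: ltW.
have pa i : (0 <= (a i `^ r0)%:E)%E by rewrite lee_fin powR_ge0.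
have pb i : (0 <= (b i `^ r0)%:E)%E by rewrite lee_fin powR_ge0.
rewrite nneseriesZl; last by move=> i _; rewrite adde_ge0.
rewrite nneseriesD//.
apply: (@le_trans _ _ ((2 `^ r0)%:E * ((ta + tb) `^ r0 + (ta + tb) `^ r0)%:E)%E); last first.
  by rewrite -EFinM lee_fin; apply: powR_two => //; exact: addr_ge0.
apply: lee_wpmul2l; first by rewrite lee_fin powR_ge0.
rewrite EFinD; apply: leeD.
  apply: le_trans Sa _; rewrite lee_fin; apply: ge0_ler_powR; rewrite ?nnegrE ?addr_ge0 ?(ltW r0gt)//.
  by rewrite lerDl.
apply: le_trans Sb _; rewrite lee_fin; apply: ge0_ler_powR; rewrite ?nnegrE ?addr_ge0 ?(ltW r0gt)//.
by rewrite lerDr.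
Qed.

Definition geo (x : R) (N j : nat) : R := if (j < N)%N then 0 else x ^+ (j - N).

Lemma geo_ge0 x N j : 0 <= x -> 0 <= geo x N j.
Proof. by move=> x0; rewrite /geo; case: ifP => // _; exact: exprn_ge0. Qed.

Lemma geo_le1 x N j : 0 <= x -> x <= 1 -> geo x N j <= 1.
Proof. by move=> x0 x1; rewrite /geo; case: ifP => // _; exact: exprn_ile1. Qed.

Lemma geo_sum0 x N M : (1 - x) * \sum_(0 <= j < M) geo x N j = 1 - x ^+ (M - N).
Proof.
elim: M => [|M IH]; first by rewrite big_geq// mulr0 sub0n expr0 subrr.
rewrite big_nat_recr//= mulrDr IH /geo; case: (ltnP M N) => h.
  have -> : (M - N = 0)%N by apply/eqP; rewrite subn_eq0 ltnW.
  have -> : (M.+1 - N = 0)%N by apply/eqP; rewrite subn_eq0.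
  by rewrite mulr0 addr0.
by rewrite subSn// exprS; ring.
Qed.

Lemma geo_sum x N k M : 0 <= x -> x < 1 -> \sum_(k <= j < M) geo x N j <= (1 - x)^-1.
Proof.
move=> x0 x1; have d0 : 0 < 1 - x by rewrite subr_gt0.
apply: (@le_trans _ _ (\sum_(0 <= j < M) geo x N j)).
  case: (leqP k M) => kM; last by rewrite big_geq ?(ltnW kM)//; apply: sumr_ge0 => i _; exact: geo_ge0.
  by rewrite [X in _ <= X](@big_cat_nat _ _ _ k)//= lerDr; apply: sumr_ge0 => i _; exact: geo_ge0.
by rewrite -(ler_pM2l d0) geo_sum0 mulfV ?gt_eqF// gerBl exprn_ge0.
Qed.

Lemma powR_le_id (x a : R) : 0 <= x -> x <= 1 -> 1 <= a -> x `^ a <= x.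
Proof.
move=> x0 x1 a1; move: x0; rewrite le_eqVlt => /predU1P[<-|x0].
  by rewrite powR0// gt_eqF// (lt_le_trans _ a1).
by apply: ge1r_powR => //; rewrite x0 x1.
Qed.

(** Terms of [[0, 1]] decrease when raised to a power [a >= 1], so the plain geometric series bounds
    the sum for every exponent. *)
Lemma geo_pow_sum x N k (a : R) : 0 <= x -> x < 1 -> 1 <= a ->
  (\sum_(k <= j <oo) (geo x N j `^ a)%:E <= ((1 - x)^-1)%:E)%E.
Proof.
move=> x0 x1 a1; apply: nneseries_le_bound => [i|M]; first exact: powR_ge0.
apply: le_trans (geo_sum N k M x0 x1); apply: ler_sum => i _.
by apply: powR_le_id; [exact: geo_ge0|apply: geo_le1 => //; exact: ltW|].
Qed.

(** The geometric series of ratio 2/3 has sum 3, and [3 <= 3 ^ r0]: the constant does not depend on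
    [r]. *)
Lemma lr_geo r a t N : (1 <= r)%E -> (forall j, 0 <= a j) -> 0 <= t ->
  (forall j, (1 <= j)%N -> a j <= t * geo (2 / 3) N j) -> (lr r a <= (3 * t)%:E)%E.
Proof.
move=> r1 a0 t0 h.
have x0 : 0 <= 2 / 3 :> R by rewrite divr_ge0.
have x1 : 2 / 3 < 1 :> R by lra.
have k0 j := geo_ge0 N j x0.
apply: le_trans (lr_mono r1 a0 h) _.
case: r r1 => [r0| |]// r1; last first.
  apply: ge_ereal_sup => _ [j j1 <-]; rewrite lee_fin mulrC ler_wpM2r//.
  by apply: le_trans (geo_le1 N j x0 (ltW x1)) _; rewrite ler1n.
rewrite lee_fin in r1; have r0gt : 0 < r0 by exact: lt_le_trans r1.
apply: lr_lexp => //; first by rewrite mulr_ge0.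
have E i : ((t * geo (2 / 3) N i) `^ r0)%:E = ((t `^ r0)%:E * (geo (2 / 3) N i `^ r0)%:E)%E.
  by rewrite powRM.
rewrite (eq_eseriesr (fun i _ => E i)) nneseriesZl; last by move=> i _; rewrite lee_fin powR_ge0.
apply: (@le_trans _ _ ((t `^ r0)%:E * 3%:E)%E).
  apply: lee_wpmul2l; first by rewrite lee_fin powR_ge0.
  apply: le_trans (geo_pow_sum N 1 x0 x1 r1) _; rewrite lee_fin le_eqVlt.
  by apply/orP; left; apply/eqP; field.
rewrite -EFinM lee_fin powRM// mulrC ler_wpM2r ?powR_ge0//.
by apply: le1r_powR; rewrite ?ler1n.
Qed.

End sequence_norm.

Section mixed_norm.
Context {R : realType} {n : nat}.
Local Notation V := 'rV[R]_n.
Local Notation L := (@lebesgue_rV R n).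
Variables (p q : R).
Hypothesis q1 : 1 < q.
Hypothesis qp : q <= p.
Implicit Types (r : \bar R).
Local Notation mor := (mor p q).
Local Notation vv := (@vv R n p q).

Lemma lr_funE s r (g : nat -> V -> R[i]) x : (1 <= r)%E ->
  lr_fun s r g x = lr r (fun j => 2 `^ (j%:R * s) * cmod (g j x)).
Proof.
case: r => [r0| |]// r1; rewrite /lr_fun /lr; congr poweR.
apply: eq_eseriesr => j _.
by rewrite powRM ?cmod_ge0 ?powR_ge0// -powRrM -mulrA (mulrC r0) mulrA.
Qed.

Lemma eseries_from1 (u : nat -> \bar R) : (\sum_(1 <= j <oo) u j = \sum_(0 <= j <oo | (j \in [pred j : nat | 1 <= j]%N)) u j)%E.
Proof. by congr (lim (_ @ \oo)); apply/funext => k; rewrite (big_nat_widenl _ 0). Qed.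

Lemma measurable_lr r (a : nat -> V -> R) : (1 <= r)%E -> (forall j x, 0 <= a j x) ->
  (forall j, measurable_fun setT (a j)) -> measurable_fun setT (fun x => lr r (a^~ x)).
Proof.
case: r => [r0| |]// r1 a0 ma; rewrite /lr.
  apply: (measurableT_comp (measurable_poweR r0^-1)).
  under eq_fun do rewrite eseries_from1.
  apply: ge0_emeasurable_sum => [k x _ _|k _]; first exact: lee_fin_powR.
  by apply/measurable_EFinP; exact: measurableT_comp (measurable_powR r0) (ma k).
rewrite (_ : (fun x => _) = fun x => esups ((fun j x => (a j x)%:E)^~ x) 1).
  by apply: measurable_fun_esups => k; exact/measurable_EFinP.
by apply/funext => x; rewrite /esups /=; congr ereal_sup.
Qed.

(* The pieces decay geometrically from [N] on, so each is bounded by the q-th power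
   sum [S] of the pieces weighted by [(3 / 2) ^ (j - N)]; this replaces Minkowski's
   inequality for infinite sums. *)
Lemma mor_lr r (b : nat -> V -> R) (N : nat) (tau : R) : (1 <= r)%E -> 0 <= tau ->
  (forall j x, 0 <= b j x) -> (forall j, measurable_fun setT (b j)) ->
  (forall j x, (j < N)%N -> b j x = 0) ->
  (forall j, (N <= j)%N -> mor (tau * (2^-1) ^+ (j - N)) (fun x => (b j x)%:E)) ->
  mor (12 * tau) (fun x => lr r (b^~ x)).
Proof.
move=> r1 tau0 b0 mb bN hb c rho rho0.
have q0 := q_gt0 q1.
(* The ratio 3/2 lies strictly between 1 and 2: its inverse 2/3 enters [lr_geo] with the factor 3,
   and its product 3/4 with the decay 1/2 of the pieces has a geometric series of sum 4. Hence
   [12 = 3 * 4]. *)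
pose w j : R := (3 / 2) ^+ (j - N).
have w0 j : 0 < w j by rewrite exprn_gt0.
pose S x := (\sum_(0 <= j <oo) ((w j * b j x) `^ q)%:E)%E.
have S0 x : (0 <= S x)%E by apply: nneseries_ge0 => i _ _; exact: lee_fin_powR.
have mu j : measurable_fun setT (fun x => ((w j * b j x) `^ q)%:E).
  apply/measurable_EFinP; apply: (measurableT_comp (measurable_powR q)).
  exact: measurable_funM.
have key x : (lr r (b^~ x) `^ q <= (3 `^ q)%:E * S x)%E.
  have p3 : (0 < (3 `^ q)%:E :> \bar R)%E by rewrite lte_fin powR_gt0.
  move ES : (S x) (S0 x) => [si| |]// si0; last by rewrite gt0_muley ?leey.
  rewrite lee_fin in si0.
  pose t := si `^ q^-1; have t0 : 0 <= t by exact: powR_ge0.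
  have hb1 j : b j x <= t * geo (2 / 3) N j.
    rewrite /geo; case: ltnP => jN; first by rewrite bN// mulr0.
    have : (((w j * b j x) `^ q)%:E <= si%:E)%E.
      rewrite -ES; apply: (@nneseries_le_term _ (fun j => ((w j * b j x) `^ q)%:E)) => // i.
      exact: lee_fin_powR.
    rewrite lee_fin => h.
    have : w j * b j x <= t.
      have wb0 : 0 <= w j * b j x by rewrite mulr_ge0 ?(ltW (w0 j)).
      rewrite -[X in X <= _](powRr1 wb0) -[X in _ `^ X <= _](@mulfV _ q) ?gt_eqF// powRrM.
      by apply: ge0_ler_powR; rewrite ?nnegrE ?powR_ge0 ?invr_ge0 ?(ltW q0).
    rewrite mulrC -ler_pdivlMr// => /le_trans; apply.
    by rewrite /w -exprVn invf_div.
  have h3 := lr_geo r1 (fun j => b0 j x) t0 (fun j _ => hb1 j).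
  apply: (@le_trans _ _ ((3 * t)%:E `^ q)%E).
    by apply: le_poweR => //; [exact: ltW|exact: lr_ge0].
  rewrite poweR_EFin -EFinM lee_fin powRM//.
  by rewrite /t -powRrM mulVf ?gt_eqF// powRr1.
have mE := @measurable_eball R n c rho.
apply: (@le_trans _ _ (\int[L]_(x in eball c rho) ((3 `^ q)%:E * S x))%E).
  apply: ge0_le_integral => //.
  - by move=> y _; exact: poweR_ge0.
  - by apply: measurable_eball_powR; exact: measurable_lr.
  - apply: emeasurable_funM => //; apply: measurable_funTS.
    by apply: ge0_emeasurable_sum => [k x _ _|k _]; [exact: lee_fin_powR|exact: mu].
rewrite ge0_integralZl//; last first.
  apply: measurable_funTS.
  by apply: ge0_emeasurable_sum => [k x _ _|k _]; [exact: lee_fin_powR|exact: mu].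
rewrite integral_nneseries//; last 2 first.
- by move=> j; apply: measurable_funTS; exact: mu.
- by move=> j x _; exact: lee_fin_powR.
have v0 : 0 <= vv rho by exact: vv_ge0.
have tv0 : 0 <= tau `^ q * vv rho by rewrite mulr_ge0 ?powR_ge0.
have hj j : (\int[L]_(x in eball c rho) ((w j * b j x) `^ q)%:E <= (tau `^ q * vv rho)%:E * (geo (3 / 4) N j `^ q)%:E)%E.
  rewrite /geo; case: ltnP => jN.
    rewrite (eq_integral (fun=> 0%E)); last by move=> x _; rewrite bN// mulr0 powR0// gt_eqF.
    by rewrite integral0 mule_ge0 ?lee_fin ?powR_ge0.
  under eq_integral do rewrite (powRM _ (ltW (w0 j)) (b0 j _)) EFinM.
  rewrite ge0_integralZl//; last 3 first.
  - have mbj : measurable_fun setT (fun x => (b j x)%:E) by exact/measurable_EFinP.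
    exact: measurable_eball_powR mbj.
  - by move=> x _; exact: lee_fin_powR.
  - exact: lee_fin_powR.
  apply: le_trans (lee_wpmul2l _ (hb j jN c rho rho0)) _; first exact: lee_fin_powR.
  rewrite -!EFinM lee_fin powRM ?exprn_ge0 ?invr_ge0//.
  have -> : (3 / 4) ^+ (j - N) = w j * 2^-1 ^+ (j - N).
    by rewrite /w -exprMn; congr (_ ^+ _); field.
  rewrite [X in _ <= _ * X]powRM ?(ltW (w0 j)) ?exprn_ge0 ?invr_ge0//.
  by rewrite le_eqVlt; apply/orP; left; apply/eqP; ring.
apply: (@le_trans _ _ ((3 `^ q)%:E * ((tau `^ q * vv rho)%:E * 4%:E))%E); last first.
  rewrite -!EFinM lee_fin powRM// (_ : 12 = 3 * 4 :> R); last by ring.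
  rewrite powRM// (_ : 3 `^ q * (tau `^ q * vv rho * 4) = 4 * (3 `^ q * tau `^ q * vv rho)); last by ring.
  rewrite (_ : 3 `^ q * 4 `^ q * tau `^ q * vv rho = 4 `^ q * (3 `^ q * tau `^ q * vv rho)); last by ring.
  rewrite ler_wpM2r//; first by rewrite !mulr_ge0 ?powR_ge0.
  by apply: le1r_powR; rewrite ?ler1n// ltW.
apply: lee_wpmul2l; first exact: lee_fin_powR.
apply: (@le_trans _ _ (\sum_(0 <= j <oo) ((tau `^ q * vv rho)%:E * (geo (3 / 4) N j `^ q)%:E))%E).
  apply: lee_nneseries => [i _ _|i _]; last exact: hj.
  by apply: integral_ge0 => x _; exact: lee_fin_powR.
rewrite nneseriesZl; last by move=> i _; exact: lee_fin_powR.
apply: lee_wpmul2l; first by rewrite lee_fin.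
have x0 : 0 <= 3 / 4 :> R by rewrite divr_ge0.
have x1 : 3 / 4 < 1 :> R by lra.
apply: le_trans (geo_pow_sum N 0 x0 x1 (ltW q1)) _; rewrite lee_fin le_eqVlt.
by apply/orP; left; apply/eqP; field.
Qed.

End mixed_norm.

(** * Littlewood-Paley pieces *)

Section littlewood_paley.
Context {R : realType} {n : nat}.
Local Notation V := 'rV[R]_n.
Variable phi : V -> R.
Hypothesis hphi : LP_generator phi.
Implicit Types (x : V).

Lemma eball0 x (rho : R) : eball 0 rho x <-> enorm x < rho.
Proof. by rewrite /eball /= subr0. Qed.

Lemma phi1 x : enorm x < 2 -> phi x = 1.
Proof.
move=> hx; have [_ /(_ x)/andP[h1 h2]] := hphi.
apply/eqP; rewrite eq_le; apply/andP; split.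
  by apply: le_trans h2 _; rewrite indicE; case: (_ \in _).
by apply: le_trans h1; rewrite indicE mem_set//; exact/eball0.
Qed.

Lemma phi0 x : 3 <= enorm x -> phi x = 0.
Proof.
move=> hx; have [_ /(_ x)/andP[h1 h2]] := hphi.
apply/eqP; rewrite eq_le; apply/andP; split; last by apply: le_trans h1; rewrite indicE.
by apply: le_trans h2 _; rewrite indicE memNset// => /eball0; rewrite ltNge hx.
Qed.

Definition Phi (N : nat) : V -> R[i] := fun x => (phi (2 ^- N *: x))%:C%C.
Definition P (j : nat) : V -> R[i] := fun x => (phi_ phi j x)%:C%C.

Lemma two_pow_gt0 N : 0 < 2 ^- N :> R. Proof. by rewrite invr_gt0 exprn_gt0. Qed.

Lemma enorm_two N x : enorm (2 ^- N *: x) = 2 ^- N * enorm x.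
Proof. by rewrite enormZ gtr0_norm ?two_pow_gt0. Qed.

Lemma cc_phi : cc (fun x => (phi x)%:C%C).
Proof.
have [/schwartz_schw[sp _] _] := hphi; split => //; exists 3 => x hx.
by rewrite phi0// (le_trans (ltW hx))// norm_le_enorm.
Qed.

Lemma cc_Phi N : cc (Phi N).
Proof. exact: cc_scale (two_pow_gt0 N) cc_phi. Qed.

Lemma P0E : P 0 = Phi 0.
Proof. by apply/funext => x; rewrite /P /Phi /= expr0 invr1 scale1r. Qed.

Lemma PSE k : P k.+1 = fun x => Phi k.+1 x + (-1) * Phi k x.
Proof. by apply/funext => x; rewrite /P /Phi /= rmorphB mulN1r. Qed.

Lemma PhiSE k : Phi k.+1 = fun x => 1 * P k.+1 x + Phi k x.
Proof. by apply/funext => x; rewrite PSE; ring. Qed.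

Lemma cc_P j : cc (P j).
Proof.
case: j => [|k]; first by rewrite P0E; exact: cc_Phi.
rewrite PSE; apply: (cc_add (cc_Phi k.+1)).
exact: (cc_mul (smooth_cst (-1)) (cc_Phi k)).
Qed.

Lemma Phi_eq1 N x : enorm x < 2 * 2 ^+ N -> Phi N x = 1.
Proof.
move=> hx; rewrite /Phi phi1// enorm_two mulrC ltr_pdivrMr// exprn_gt0//.
Qed.

Lemma Phi_eq0 N x : 3 * 2 ^+ N <= enorm x -> Phi N x = 0.
Proof.
move=> hx; rewrite /Phi phi0// enorm_two mulrC ler_pdivlMr// exprn_gt0//.
Qed.

Lemma two_pow_le (j k : nat) : (j <= k)%N -> 2 ^+ j <= 2 ^+ k :> R.
Proof. by move=> jk; rewrite ler_weXn2l// ler1n. Qed.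

Lemma P_eq0_far j x : 3 * 2 ^+ j <= enorm x -> P j x = 0.
Proof.
case: j => [|k] hx; first by rewrite P0E; exact: Phi_eq0.
have hk : 3 * 2 ^+ k <= enorm x.
  by apply: le_trans hx; rewrite ler_wpM2l// two_pow_le.
by rewrite PSE (Phi_eq0 hx) (Phi_eq0 hk) mulr0 addr0.
Qed.

(** For [enorm x < 2 ^+ j] both dilates of [phi] in [P j] are equal to 1. *)
Lemma P_eq0_near j x : (0 < j)%N -> enorm x < 2 ^+ j -> P j x = 0.
Proof.
case: j => // k _ hx.
have h1 : enorm x < 2 * 2 ^+ k by rewrite -exprS.
have h2 : enorm x < 2 * 2 ^+ k.+1.
  apply: lt_le_trans hx _; rewrite ler_peMl ?exprn_ge0// ler1n//.
by rewrite PSE (Phi_eq1 h1) (Phi_eq1 h2) mulr1 subrr.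
Qed.

(** [P j] vanishes outside [enorm x < 3 * 2 ^+ j], which lies inside [enorm x < 2 * 2 ^+ N], where
    [Phi N] is 1. *)
Lemma Phi_P_low N j : (j < N)%N -> (fun x => Phi N x * P j x) = P j.
Proof.
move=> jN; apply/funext => x; case: (ltP (enorm x) (2 * 2 ^+ N)) => hx.
  by rewrite (Phi_eq1 hx) mul1r.
rewrite P_eq0_far ?mulr0//; apply: le_trans hx.
have h : 2 ^+ j.+1 <= 2 ^+ N :> R by exact: two_pow_le.
rewrite exprS in h; have e0 : 0 < 2 ^+ j :> R by rewrite exprn_gt0.
lra.
Qed.

(** [Phi N] vanishes from [3 * 2 ^+ N] on, while [P j] vanishes below [2 ^+ j >= 4 * 2 ^+ N]. With
    [Phi_P_low], this leaves the indices [N] and [N.+1] as the middle pieces. *)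
Lemma Phi_P_high N j x : (N.+2 <= j)%N -> Phi N x * P j x = 0.
Proof.
move=> Nj; case: (ltP (enorm x) (3 * 2 ^+ N)) => hx; last by rewrite (Phi_eq0 hx) mul0r.
rewrite P_eq0_near ?mulr0//; first exact: leq_trans Nj.
apply: lt_le_trans hx _; apply: (@le_trans _ _ (2 ^+ N.+2)); last exact: two_pow_le.
have e0 : 0 < 2 ^+ N :> R by rewrite exprn_gt0.
rewrite !exprS; lra.
Qed.

(** Lets [TLM_smooth_sum] view a partial sum as [Phi N (D)] applied to the next partial sum. *)
Lemma Phi_Phi N : (fun x => Phi N.+1 x * Phi N x) = Phi N.
Proof.
apply/funext => x; case: (ltP (enorm x) (2 * 2 ^+ N.+1)) => hx.
  by rewrite (Phi_eq1 hx) mul1r.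
rewrite (_ : Phi N x = 0) ?mulr0//; apply: Phi_eq0; apply: le_trans hx.
have e0 : 0 < 2 ^+ N :> R by rewrite exprn_gt0.
rewrite exprS; lra.
Qed.

(** The factor [n.+1] converts the sup norm of [cutoff] into the Euclidean norm in which [phi] is
    described. *)
Lemma phi_cutoff : cutoff (fun x => (phi x)%:C%C) n.+1%:R^-1.
Proof.
split; [exact: cc_phi|by rewrite invr_gt0|move=> x hx].
rewrite phi1//; apply: le_lt_trans (enorm_le_norm x) _.
apply: (@lt_trans _ _ 1); last by rewrite ltr1n.
by rewrite mulrC -ltr_pdivlMr// div1r.
Qed.

Lemma kL1_Phi N : kL1 (Phi N) = kL1 (fun x => (phi x)%:C%C).
Proof. exact: kL1_scale (two_pow_gt0 N) (cc_schw cc_phi). Qed.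

End littlewood_paley.

(** * Functionals given by functions with a Morrey bound *)

Section representation.
Context {R : realType} {n : nat}.
Local Notation V := 'rV[R]_n.
Local Notation L := (@lebesgue_rV R n).
Variables (p q : R).
Hypothesis q1 : 1 < q.
Hypothesis qp : q <= p.
Implicit Types (h m psi chi : V -> R[i]) (H : functional R n) (A B K : R).

(** Unlike in [represents], the pairing holds on all Schwartz functions, so [H] may be composed with
    [Tm]. The bound [A] makes the pairing converge and carries the constants that the tail estimate
    needs. *)
Definition mrep A h H := [/\ cm h, 0 <= A, mor p q A (fun y => (cmod (h y))%:E) &
  forall psi, schw psi -> H psi = cintegral (fun x => h x * psi x)].

Lemma pg_loc_int h : pg h -> locally_integrableC h.
Proof.
move=> [mh ih]; have [m1 m2] := mh; split => // K cK.
have mK : measurable K.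
  apply: closed_measurable_rV; apply: compact_closed cK; exact: norm_hausdorff.
have [M [_ hM]] := compact_bounded cK.
pose D : R := (1 + (`|M| + 1)) ^+ n.+1.
have D0 : 0 <= D by rewrite exprn_ge0// !addr_ge0.
have hD x : K x -> cmod (h x) <= D * (cmod (h x) * wt x ^- n.+1).
  move=> Kx; rewrite mulrCA ler_peMr ?cmod_ge0// ler_pdivlMr ?wtX_gt0// mul1r.
  apply: lerXn2r; rewrite ?nnegrE ?wt_ge0 ?addr_ge0// lerD2l.
  by apply: (hM (`|M| + 1)) => //; rewrite ltr_pwDr// ler_norm.
have := pgZ_lty (conj mh ih) D0; apply: le_lt_trans.
have mf : measurable_fun setT (fun x => (D * (cmod (h x) * wt x ^- n.+1))%:E).
  by apply/measurable_EFinP; apply: measurable_funM => //; exact: measurable_pg.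
have f0 x : (0 <= (D * (cmod (h x) * wt x ^- n.+1))%:E)%E.
  by rewrite lee_fin mulr_ge0// mulr_ge0 ?cmod_ge0 ?wtVX_ge0.
apply: (@le_trans _ _ (\int[L]_(x in K) (D * (cmod (h x) * wt x ^- n.+1))%:E)%E).
  apply: ge0_le_integral => //.
  - by move=> x _; rewrite lee_fin cmod_ge0.
  - by apply: measurable_funTS; apply/measurable_EFinP; exact: cm_cmod.
  - exact: measurable_funTS.
exact: ge0_subset_integral.
Qed.

Lemma mrep_pg A h H : mrep A h H -> pg h.
Proof. by move=> [mh A0 hA _]; exact: (mor_pg q1 qp mh hA). Qed.

Lemma mrep_represents A h H : mrep A h H -> represents h H.
Proof.
move=> hm; split; first exact: pg_loc_int (mrep_pg hm).
by have [_ _ _ e] := hm; move=> psi /test_functionP hp; apply: e; exact: cc_schw.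
Qed.

(** The Morrey bound makes pairing with [h] tempered, and two tempered functionals that agree on
    test functions agree on Schwartz ones. *)
Lemma represents_mrep chi delta A h H : cutoff chi delta -> stemp H -> 0 <= A ->
  mor p q A (fun y => (cmod (h y))%:E) -> represents h H -> mrep A h H.
Proof.
move=> hc sH A0 hA [[m1 m2 _] e]; have mh : cm h by split.
split => //; apply: (stemp_ext hc sH (stemp_pg (mor_pg q1 qp mh hA))) => psi hp.
by apply: e; exact/test_functionP.
Qed.

Lemma mrep_ext A h H H' : (forall psi, schw psi -> H psi = H' psi) -> mrep A h H -> mrep A h H'.
Proof. by move=> HH [mh A0 hA e]; split => // psi hp; rewrite -HH// e. Qed.

Lemma mrep_le A B h H : A <= B -> mrep A h H -> mrep B h H.
Proof.
move=> AB [mh A0 hA e]; split => //; first exact: le_trans AB.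
exact: (mor_le q1 A0 AB hA).
Qed.

Lemma mrep_conv A K h m H : mrep A h H -> cc m -> 0 < K -> kL1 m <= K ->
  mrep (2 * K * A) (convk h (ker m)) (fun psi => H (Tm m psi)).
Proof.
move=> hm cm' K0 hK; have hh := mrep_pg hm; have [mh A0 hA e] := hm.
have [c1 c2] := conv_cts hh cm'.
split.
- exact: cm_cts.
- by rewrite !mulr_ge0// ltW.
- exact: (mor_conv q1 qp A0 mh hA cm' K0 hK).
- move=> psi hp; rewrite e; last exact: schw_Tm (cc_tame cm') hp.
  by have [] := conv_pairing hh cm' hp.
Qed.

Lemma cmodEm h : cm h -> measurable_fun setT (fun y => (cmod (h y))%:E).
Proof. by move=> mh; apply/measurable_EFinP; exact: cm_cmod. Qed.

Lemma mrep_add A B h h' H H' : mrep A h H -> mrep B h' H' ->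
  mrep (4 * (A + B)) (fun x => h x + h' x) (fun psi => H psi + H' psi).
Proof.
move=> hm hm'; have hh := mrep_pg hm; have hh' := mrep_pg hm'.
have [mh A0 hA e] := hm; have [mh' B0 hB e'] := hm'.
split.
- exact: cmD.
- by rewrite mulr_ge0// addr_ge0.
- have c0 (g : V -> R[i]) (y : V) : (0 <= (cmod (g y))%:E)%E by rewrite lee_fin cmod_ge0.
  have mm := cmodEm mh; have mm' := cmodEm mh'.
  have := mor_add q1 A0 B0 mm mm' (c0 h) (c0 h') hA hB.
  apply: (mor_mono q1 (cmodEm (cmD mh mh')) (emeasurable_funD mm mm') (c0 _)) => y.
  by rewrite -EFinD lee_fin cmodD.
- move=> psi hp; rewrite e// e'// -cintD.
  + by apply: eq_cint => x; rewrite mulrDl.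
  + exact: ci_pg_dk hh (schw_dk _ hp).
  + exact: ci_pg_dk hh' (schw_dk _ hp).
Qed.

Lemma mrepZ A (c : R[i]) h H : mrep A h H -> mrep (cmod c * A) (fun x => c * h x) (fun psi => c * H psi).
Proof.
move=> hm; have hh := mrep_pg hm; have [mh A0 hA e] := hm; split.
- exact: (cmM (cm_cst c) mh).
- by rewrite mulr_ge0 ?cmod_ge0.
- have c0 (y : V) : (0 <= (cmod (h y))%:E)%E by rewrite lee_fin cmod_ge0.
  have := morZ A0 (cmod_ge0 c) (cmodEm mh) c0 hA.
  rewrite (_ : (fun y => _ * _)%E = fun y => (cmod (c * h y))%:E)//.
  by apply/funext => y; rewrite cmodM EFinM.
- move=> psi hp; rewrite e// -cintZ; last exact: ci_pg_dk hh (schw_dk _ hp).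
  by apply: eq_cint => x; rewrite mulrA.
Qed.

Lemma mrep0 A H : 0 <= A -> (forall psi, schw psi -> H psi = 0) -> mrep A (fun=> 0) H.
Proof.
move=> A0 h0; split => //.
- exact: cm_cst.
- by apply: (@mor0 R n p q q1 A _ A0) => y; rewrite cmod0.
- move=> psi hp; rewrite h0//; apply: cplx_eq; rewrite /= /Rintegral integral0_eq// => x _.
    by rewrite /reC mul0r.
  by rewrite /imC mul0r.
Qed.

(** [T] is chosen before the scale [X]: [smooth_decay] takes a scale depending on [j], and a single
    [T] has to serve for all [j]. *)
Lemma mrep_sum (I : Type) (a : I -> R) (l : seq I) : exists2 T, 0 <= T &
  forall (X : R) (h : I -> V -> R[i]) (H : I -> functional R n), 0 <= X ->
    (forall i, mrep (a i * X) (h i) (H i)) ->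
    mrep (T * X) (fun x => \sum_(i <- l) h i x) (fun psi => \sum_(i <- l) H i psi).
Proof.
elim: l => [|i l [T T0 IH]].
  exists 0 => // X h H X0 _; rewrite mul0r.
  rewrite (_ : (fun x => _) = fun=> 0); last by apply/funext => x; rewrite big_nil.
  by apply: mrep0 => // psi _; rewrite big_nil.
exists (4 * (`|a i| + T)); first by rewrite mulr_ge0// addr_ge0.
move=> X h H X0 hm; have hi := hm i.
have {}hi : mrep (`|a i| * X) (h i) (H i) by apply: mrep_le hi; rewrite ler_wpM2r// ler_norm.
have := mrep_add hi (IH X h H X0 hm).
rewrite -mulrDl mulrA.
rewrite (_ : (fun x => h i x + _) = fun x => \sum_(i <- i :: l) h i x); last by apply/funext => x; rewrite big_cons.
by apply: mrep_ext => psi _; rewrite big_cons.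
Qed.

End representation.

(** * The norm through its Littlewood-Paley pieces *)

Section spaces.
Context {R : realType} {n : nat}.
Local Notation V := 'rV[R]_n.
Local Notation L := (@lebesgue_rV R n).
Variable phi : V -> R.
Variables (p q s : R) (r : \bar R).
Hypothesis hphi : LP_generator phi.
Hypothesis q1 : 1 < q.
Hypothesis qp : q <= p.
Hypothesis r1 : (1 <= r)%E.
Implicit Types (h m psi : V -> R[i]) (H u v w : functional R n) (A B K : R).
Local Notation mrep := (@mrep R n p q).
Local Notation mor := (@mor R n p q).
Local Notation P := (P phi).
Local Notation Phi := (Phi phi).
Local Notation TLMn := (TLM_norm phi p q r s).

Definition wgt (j : nat) : R := 2 `^ (j%:R * s).

Lemma wgt_gt0 j : 0 < wgt j. Proof. exact: powR_gt0. Qed.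
Lemma wgt_ge0 j : 0 <= wgt j. Proof. exact/ltW/wgt_gt0. Qed.
Lemma wgt0 : wgt 0 = 1. Proof. by rewrite /wgt mul0r powRr0. Qed.

Definition wcm (g : nat -> V -> R[i]) (j : nat) (x : V) : R := wgt j * cmod (g j x).

Lemma wcm_ge0 g j x : 0 <= wcm g j x.
Proof. by rewrite mulr_ge0 ?wgt_ge0 ?cmod_ge0. Qed.

Lemma measurable_wcm g j : cm (g j) -> measurable_fun setT (wcm g j).
Proof. by move=> mg; apply: measurable_funM => //; exact: cm_cmod. Qed.

Definition lrw (g : nat -> V -> R[i]) (x : V) : \bar R := lr r (wcm g ^~ x).

Lemma lrw_ge0 g x : (0 <= lrw g x)%E.
Proof. by apply: lr_ge0 => // j; exact: wcm_ge0. Qed.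

Lemma measurable_lrw g : (forall j, cm (g j)) -> measurable_fun setT (lrw g).
Proof.
by move=> mg; apply: measurable_lr => //; [exact: wcm_ge0|move=> j; exact: measurable_wcm].
Qed.

Lemma morrey_norm_ge0 (F : V -> \bar R) : (0 <= morrey_norm p q F)%E.
Proof.
apply: (@le_trans _ _ ((fine (L (eball (0 : V) 1)) `^ (p^-1 - q^-1))%:E *
     (\int[L]_(y in eball (0%R : V) 1%R) (`|F y| `^ q)) `^ q^-1)%E).
  by rewrite mule_ge0 ?poweR_ge0// lee_fin powR_ge0.
by apply: ereal_sup_ubound; exists (0, 1) => //=.
Qed.

Lemma TLM_norm_ge0 u : (0 <= TLMn u)%E.
Proof.
by apply: le_ereal_inf_tmp => _ [g _ <-]; rewrite adde_ge0 ?morrey_norm_ge0.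
Qed.

(** The constants [A j] only certify that each piece is a function; the size of the norm comes from
    [B0] and [B]. *)
Lemma TLM_norm_le u (g : nat -> V -> R[i]) (A : nat -> R) B0 B : 0 <= B0 -> 0 <= B ->
  (forall j, mrep (A j) (g j) (fun psi => u (Tm (P j) psi))) ->
  mor B0 (fun x => (cmod (g 0%N x))%:E) -> mor B (lrw g) -> (TLMn u <= (B0 + B)%:E)%E.
Proof.
move=> B00 B0' hg h0 hl.
apply: (@le_trans _ _ (morrey_norm p q (fun x => (cmod (g 0%N x))%:E) + morrey_norm p q (lr_fun s r g))%E).
  apply: ereal_inf_lbound; exists g => // j /=.
  have [li e] := mrep_represents q1 qp (hg j).
  by split => // psi hp; rewrite multiplierE; exact: e.
rewrite EFinD; apply: leeD.
  by apply: (morrey_norm_le q1 qp) => // y; rewrite lee_fin cmod_ge0.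
rewrite (_ : lr_fun s r g = lrw g); last by apply/funext => x; exact: lr_funE.
by apply: (morrey_norm_le q1 qp) => // y; exact: lrw_ge0.
Qed.

Lemma stemp_Tm u k m : tame k m -> stemp u -> stemp (fun psi => u (Tm m psi)).
Proof. by move=> hm su; exact: stemp_sop su (sop_Tm hm). Qed.

(** A family close to the infimum. A single weighted piece is bounded by the [l^r] norm, whence the
    factor [(wgt j)^-1]; the zeroth piece is bounded by the first summand of the norm, and
    [wgt 0 = 1]. *)
Lemma TLM_data u B : stemp u -> (TLMn u < B%:E)%E -> exists g : nat -> V -> R[i],
  [/\ 0 <= B, forall j, mrep ((wgt j)^-1 * B) (g j) (fun psi => u (Tm (P j) psi)) & mor B (lrw g)].
Proof.
move=> su hu.
have B0 : 0 <= B by rewrite -lee_fin; exact: le_trans (TLM_norm_ge0 u) (ltW hu).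
have [_ [g hg <-] hlt] := ereal_inf_lt hu.
have c0 (h : V -> R[i]) (y : V) : (0 <= (cmod (h y))%:E)%E by rewrite lee_fin cmod_ge0.
have mg j : cm (g j) by have [[m1 m2 _] _] := hg j.
have h0 : mor B (fun x => (cmod (g 0%N x))%:E).
  apply: (morrey_norm_mor q1 qp) => //; apply: le_trans (ltW hlt).
  by rewrite leeDl ?morrey_norm_ge0.
have hl : mor B (lrw g).
  apply: (morrey_norm_mor q1 qp) => //; first by move=> y; exact: lrw_ge0.
  rewrite (_ : lrw g = lr_fun s r g); last by apply/funext => x; rewrite lr_funE.
  by apply: le_trans (ltW hlt); rewrite leeDr ?morrey_norm_ge0.
exists g; split => // j.
have iw0 : 0 <= (wgt j)^-1 by rewrite invr_ge0 wgt_ge0.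
apply: (represents_mrep q1 qp (phi_cutoff hphi)).
- exact: stemp_Tm (cc_tame (cc_P hphi j)) su.
- exact: mulr_ge0.
- case: j iw0 => [|j] iw0; first by rewrite wgt0 invr1 mul1r.
  have hb : mor B (fun y => (wcm g j.+1 y)%:E).
    apply: (mor_mono q1 _ (measurable_lrw mg) _ _ hl).
    + by apply/measurable_EFinP; exact: measurable_wcm.
    + by move=> y; rewrite lee_fin wcm_ge0.
    + by move=> y; apply: (@lr_ge _ r (wcm g ^~ y) j.+1 r1) => // k; exact: wcm_ge0.
  have w0 y : (0 <= (wcm g j.+1 y)%:E)%E by rewrite lee_fin wcm_ge0.
  have mw : measurable_fun setT (fun y => (wcm g j.+1 y)%:E) by apply/measurable_EFinP; exact: measurable_wcm.
  have := morZ B0 iw0 mw w0 hb.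
  rewrite (_ : (fun y => _ * _)%E = fun y => (cmod (g j.+1 y))%:E)//.
  by apply/funext => y; rewrite -EFinM /wcm mulrA mulVf ?mul1r// gt_eqF ?wgt_gt0.
- have [li e] := hg j; split => // psi hp; rewrite -e// multiplierE//.
Qed.

Lemma stempD u psi1 psi2 : stemp u -> schw psi1 -> schw psi2 -> u (fun x => psi1 x + psi2 x) = u psi1 + u psi2.
Proof.
move=> [ul _] h1 h2; rewrite (_ : (fun x => _) = fun x => 1 * psi1 x + psi2 x); last first.
  by apply/funext => x; rewrite mul1r.
by rewrite ul// mul1r.
Qed.

Lemma stemp0 u : stemp u -> u (fun=> 0) = 0.
Proof.
move=> [ul _]; have := ul (-1) _ _ (@schw0 R n) (@schw0 R n).
rewrite (_ : (fun x => _) = fun=> 0); last by apply/funext => x; rewrite mulr0 addr0.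
by rewrite mulN1r addNr.
Qed.

Lemma Tm0 m psi : (forall x, m x = 0) -> Tm m psi = fun=> 0.
Proof.
move=> m0; apply/funext => x; rewrite /Tm {1}/four (_ : cintegral _ = 0) ?mulr0//.
apply: cplx_eq; rewrite /= /Rintegral integral0_eq// => y _.
  by rewrite /reC m0 !mul0r.
by rewrite /imC m0 !mul0r.
Qed.

Lemma ker0 m : (forall x, m x = 0) -> ker m = fun=> 0.
Proof.
move=> m0; apply/funext => z; rewrite /ker /four.
have -> : cintegral (fun y => m y * cis (-1 * dotp z y)) = 0; last by rewrite !mulr0.
apply: cplx_eq; rewrite /= /Rintegral integral0_eq// => y _.
  by rewrite /reC m0 !mul0r.
by rewrite /imC m0 !mul0r.
Qed.

Lemma convk0 h y : convk h (fun=> 0) y = 0.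
Proof.
apply: cplx_eq; rewrite /= /Rintegral integral0_eq// => x _.
  by rewrite /reC mulr0.
by rewrite /imC mulr0.
Qed.

Lemma Tm_Phi_succ u N psi : stemp u -> schw psi ->
  u (Tm (Phi N.+1) psi) = u (Tm (Phi N) psi) + u (Tm (P N.+1) psi).
Proof.
move=> [ul _] hp; have tP := cc_tame (cc_P hphi N.+1); have tF := cc_tame (cc_Phi hphi N).
rewrite (_ : Tm (Phi N.+1) psi = fun x => 1 * Tm (P N.+1) psi x + Tm (Phi N) psi x); last first.
  by rewrite -(Tm_lin 1 tP tF hp) -PhiSE.
by rewrite (ul _ _ _ (schw_Tm tP hp) (schw_Tm tF hp)) mul1r addrC.
Qed.

(** Telescoping, as [P j.+1] is [Phi j.+1 - Phi j]. *)
Lemma sum_P u N psi : stemp u -> schw psi -> \sum_(0 <= j < N.+1) u (Tm (P j) psi) = u (Tm (Phi N) psi).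
Proof.
move=> su hp; elim: N => [|N IH]; first by rewrite big_nat1 P0E.
rewrite (Tm_Phi_succ N su hp) -IH; exact: big_nat_recr.
Qed.

(** The bound [B] is not controlled in [N]; for the smoothness of partial sums it is enough that
    each of them is a Morrey function. *)
Lemma mrep_Phi u (g : nat -> V -> R[i]) (A : nat -> R) N : stemp u ->
  (forall j, mrep (A j) (g j) (fun psi => u (Tm (P j) psi))) ->
  exists B h, mrep B h (fun psi => u (Tm (Phi N) psi)).
Proof.
move=> su hg; elim: N => [|N [B [h IH]]]; first by exists (A 0%N), (g 0%N); rewrite -P0E.
exists (4 * (A N.+1 + B)), (fun x => g N.+1 x + h x).
apply: mrep_ext (mrep_add q1 qp (hg N.+1) IH) => psi hp.
rewrite (Tm_Phi_succ N su hp); exact: addrC.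
Qed.

(** Only the pieces [j < M] survive, and each is the convolution of [h] with the kernel of the
    compactly supported symbol [m * P j]. *)
Lemma finite_TLM w H h m A (M : nat) : stemp w -> mrep A h H -> cc m ->
  (forall psi, schw psi -> w psi = H (Tm m psi)) ->
  (forall j x, (M <= j)%N -> m x * P j x = 0) -> (TLMn w < +oo)%E.
Proof.
move=> sw hm ccm hw mP.
pose mj j := fun x => m x * P j x.
have cmj j : cc (mj j) by apply: (cc_mul (cc_smooth ccm)); exact: cc_P.
pose g j := convk h (ker (mj j)).
pose Aj j := 2 * (kL1 (mj j) + 1) * A.
have hg j : mrep (Aj j) (g j) (fun psi => w (Tm (P j) psi)).
  have k1 : 0 < kL1 (mj j) + 1 by rewrite ltr_wpDl ?kL1_ge0.
  have k2 : kL1 (mj j) <= kL1 (mj j) + 1 by rewrite lerDl.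
  apply: mrep_ext (mrep_conv q1 qp hm (cmj j) k1 k2) => psi hp.
  have tP := cc_tame (cc_P hphi j).
  by rewrite (hw _ (schw_Tm tP hp)) (Tm_comp m tP hp).
have A0 : 0 <= A by case: hm.
have Aj0 j : 0 <= Aj j by rewrite !mulr_ge0 ?addr_ge0 ?kL1_ge0.
have g0 j x : (M <= j)%N -> g j x = 0.
  by move=> Mj; rewrite /g ker0 ?convk0// => y; exact: mP.
(* [lr] starts at index 1, so the zeroth piece may be replaced by 0; this meets the vanishing below
   [N = 1] that [mor_lr] asks for. *)
pose b j x : R := if (j < 1)%N then 0 else wcm g j x.
(* The factors [2 ^+ j] make the finitely many nonzero pieces fit the geometric decay demanded by
   [mor_lr]. *)
pose tau := \sum_(j < M) (wgt j * Aj j) * 2 ^+ j.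
have tau0 : 0 <= tau by apply: sumr_ge0 => j _; rewrite mulr_ge0 ?exprn_ge0// mulr_ge0 ?wgt_ge0.
have mg j : cm (g j) by have [] := hg j.
have b0 j x : 0 <= b j x by rewrite /b; case: ifP => // _; exact: wcm_ge0.
have mb j : measurable_fun setT (b j).
  have -> : b j = (if (j < 1)%N then fun=> 0 else wcm g j) by apply/funext => x; rewrite /b; case: ifP.
  by case: ifP => // _; exact: measurable_wcm.
have hb : mor (12 * tau) (fun x => lr r (b^~ x)).
  apply: (mor_lr q1 (N := 1)) => //; first by move=> j x j1; rewrite /b j1.
  move=> j j1; case: (ltnP j M) => jM; last first.
    apply: (@mor0 R n p q q1); first by rewrite mulr_ge0// exprn_ge0// invr_ge0.
    by move=> x; rewrite /b /wcm g0// cmod0 mulr0; case: ifP.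
  have [_ _ hj _] := hg j.
  have c0 (y : V) : (0 <= (cmod (g j y))%:E)%E by rewrite lee_fin cmod_ge0.
  have := morZ (Aj0 j) (wgt_ge0 j) (cmodEm (mg j)) c0 hj.
  rewrite (_ : (fun y => _ * _)%E = fun x => (b j x)%:E); last first.
    by apply/funext => x; rewrite /b ltnNge j1 /= /wcm EFinM.
  apply: (mor_le q1); first by rewrite mulr_ge0 ?wgt_ge0.
  rewrite exprVn ler_pdivlMr ?exprn_gt0//.
  apply: (@le_trans _ _ (wgt j * Aj j * 2 ^+ j)).
    apply: (ler_wpM2l (mulr_ge0 (wgt_ge0 j) (Aj0 j))); apply: two_pow_le; exact: leq_subr.
  rewrite /tau (bigD1 (Ordinal jM))//= lerDl; apply: sumr_ge0 => i _.
  by rewrite mulr_ge0 ?exprn_ge0// mulr_ge0 ?wgt_ge0.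
have hl : mor (12 * tau) (lrw g).
  apply: (mor_mono q1 (measurable_lrw mg) _ (lrw_ge0 g) _ hb).
    by apply: measurable_lr.
  move=> y; apply: lr_mono => // [j|j j1]; first exact: wcm_ge0.
  by rewrite /b ltnNge j1.
have [_ _ h0 _] := hg 0%N.
have t12 : 0 <= 12 * tau by rewrite mulr_ge0.
apply: le_lt_trans (TLM_norm_le (Aj0 0%N) t12 hg h0 hl) _.
exact: ltry.
Qed.

Lemma dmulx_ann i m x (c : R[i]) : m x * c = 0 -> dmulc i m x * c = 0.
Proof. by move=> h; rewrite /dmulc /mulxi -!mulrA h !mulr0. Qed.

Definition dmulcs (l : seq 'I_n) m := foldr (@dmulc R n) m l.

Lemma cc_dmulcs l m : cc m -> cc (dmulcs l m).
Proof. by move=> hm; elim: l => //= i l IH; exact: cc_dmulc. Qed.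

Lemma dw_convk l h m : pg h -> cc m -> dw l (convk h (ker m)) = convk h (ker (dmulcs l m)).
Proof.
move=> hh hm; elim: l => [|i l IH]; first exact: erefl.
rewrite dw_cons IH.
exact: ispd_pd (conv_ispd i hh (cc_dmulcs l hm)).
Qed.

Lemma TLM_smooth_sum u N v : stemp u -> (TLMn u < +oo)%E ->
  (forall psi, schw psi -> v psi = u (Tm (Phi N) psi)) -> TLM_smooth phi p q r s v.
Proof.
move=> su hu hv.
have [B hB] : exists B : R, (TLMn u < B%:E)%E.
  move: hu (TLM_norm_ge0 u); case: (TLMn u) => [t| |]// _ _.
  by exists (t + 1); rewrite lte_fin ltrDl.
have [g [B0 hg _]] := TLM_data su hB.
(* One index beyond [N]: by [Phi_Phi] the partial sum is [Phi N (D)] applied to this [H], already a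
   Morrey function, and is therefore a convolution with a Schwartz kernel. *)
have [A [h hm]] := mrep_Phi N.+1 su hg.
have hh := mrep_pg q1 qp hm.
set H := (fun psi => u (Tm (Phi N.+1) psi)) in hm.
have cF := cc_Phi hphi N.
have hH psi : schw psi -> u (Tm (Phi N) psi) = H (Tm (Phi N) psi).
  by move=> hp; rewrite /H (Tm_comp _ (cc_tame cF) hp) Phi_Phi.
have sH : stemp H by exact: stemp_Tm (cc_tame (cc_Phi hphi N.+1)) su.
clearbody H.
have ann l j x : (N.+2 <= j)%N -> dmulcs l (Phi N) x * P j x = 0.
  by move=> Nj; elim: l => [|i l IH] /=; [exact: Phi_P_high|exact: dmulx_ann].
(* The partial sum (empty word) and all its derivatives together: each is a convolution of the same
   [h] with the kernel of a symbol that annihilates [P j] for [j >= N.+2], so [finite_TLM]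
   applies. *)
have gen l w : stemp w -> (forall psi, schw psi -> w psi = H (Tm (dmulcs l (Phi N)) psi)) ->
    TLM phi p q r s w /\ represents (convk h (ker (dmulcs l (Phi N)))) w.
  move=> sw hw; have cl := cc_dmulcs l cF; split.
    split; first exact/tempered_stemp.
    exact: (finite_TLM sw hm cl hw (ann l)).
  have k1 : 0 < kL1 (dmulcs l (Phi N)) + 1 by rewrite ltr_wpDl ?kL1_ge0.
  have k2 : kL1 (dmulcs l (Phi N)) <= kL1 (dmulcs l (Phi N)) + 1 by rewrite lerDl.
  apply: (mrep_represents q1 qp); apply: mrep_ext (mrep_conv q1 qp hm cl k1 k2) => psi hp.
  by rewrite hw.
(* [v] is known on Schwartz functions only; temperedness is transported along this agreement. *)
have stemp_eq (w w' : functional R n) : (forall psi, schw psi -> w psi = w' psi) -> stemp w' -> stemp w.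
  move=> e [wl wc]; split.
    by move=> a p1 p2 h1 h2; rewrite !e//; [exact: wl|exact: schwD].
  move=> eps e0; have [k [d [d0 K]]] := wc eps e0; exists k, d; split => // psi hp hs.
  by rewrite e//; exact: K.
have hv' psi : schw psi -> v psi = H (Tm (dmulcs [::] (Phi N)) psi) by move=> hp; rewrite (_ : dmulcs [::] (Phi N) = Phi N)// (hv _ hp) (hH _ hp).
have sv : stemp v by apply: stemp_eq hv' _; exact: stemp_Tm (cc_tame cF) sH.
have [hT hR] := gen [::] v sv hv'.
split => //; exists (convk h (ker (Phi N))); split => //.
  exact: smooth_conv.
move=> alpha; rewrite mderiv_word dw_convk//.
pose w : functional R n := fun psi => H (Tm (dmulcs (word_of alpha) (Phi N)) psi).
have sw : stemp w by exact: stemp_Tm (cc_tame (cc_dmulcs _ cF)) sH.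
by have [h1 h2] := gen (word_of alpha) w sw (fun psi _ => erefl); exists w.
Qed.

End spaces.

(** * Recovering a function from its gradient *)

Section inverse_gradient.
Context {R : realType} {n : nat}.
Local Notation V := 'rV[R]_n.
Variable phi : V -> R.
Hypothesis hphi : LP_generator phi.
Implicit Types (psi f m : V -> R[i]) (u v w : functional R n) (x : V).
Local Notation P := (P phi).
Local Notation Phi := (Phi phi).

Lemma stempN u : stemp u -> stemp (fun psi => - u psi).
Proof.
move=> su; have := stemp_sub (stemp_sub su su) su.
by congr stemp; apply/funext => psi; rewrite subrr sub0r.
Qed.

Lemma cc_ci f : cc f -> ci f. Proof. by move=> h; exact/dk_ci/schw_dk/cc_schw. Qed.

Lemma cc_parts i f psi : smooth f -> cc psi ->
  cintegral (fun x => pd i f x * psi x) = - cintegral (fun x => f x * pd i psi x).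
Proof.
move=> sf hp.
have c1 : cc (fun x => pd i f x * psi x) := cc_mul (smooth_pd i sf) hp.
have c2 : cc (fun x => f x * pd i psi x) := cc_mul sf (cc_dw [:: i] hp).
have c3 : cc (fun x => f x * psi x) := cc_mul sf hp.
have h := ispd_mul (smooth_ispd i sf) (smooth_ispd i (cc_smooth hp)).
have := int_pd0 h (schw_dk _ (cc_schw c3)) (schw_dk _ (cc_schw (cc_add c1 c2))).
rewrite (cintD (cc_ci c1) (cc_ci c2)) => /eqP; rewrite addr_eq0 => /eqP; exact.
Qed.

(** [v] and [w] are obtained independently and linked only by [f] and its classical derivative.
    Integration by parts gives the identity on test functions, and density extends it. *)
Lemma derivative_rep i v w f : stemp v -> stemp w -> smooth f -> represents f v ->
  represents (pd i f) w -> forall psi, schw psi -> w psi = - v (pd i psi).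
Proof.
move=> sv sw sf [_ ev] [_ ew].
apply: (stemp_ext (phi_cutoff hphi) sw (stempN (stemp_sop sv (sop_pd i)))) => psi hp.
have e1 := ew _ ((test_functionP _).2 hp).
have e2 := ev _ ((test_functionP _).2 (cc_dw [:: i] hp)).
rewrite e1 (cc_parts i sf hp); apply: (congr1 (fun z => - z)); exact: esym e2.
Qed.

(* The term [phi (8 *: x)] keeps this regularized [|x| ^ 2] positive at the origin;
   it vanishes where [enorm x >= 1], which contains the support of every piece
   [P j], [j > 0], rescaled by [2 ^- j]. *)
Definition den x : R := dotp x x + phi (8 *: x).

Lemma phi_ge0 x : 0 <= phi x.
Proof. by have [_ /(_ x)/andP[h _]] := hphi; apply: le_trans h; rewrite indicE. Qed.

Lemma dotpxx_ge0 x : 0 <= dotp x x.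
Proof. by apply: sumr_ge0 => i _; rewrite -expr2 sqr_ge0. Qed.

(** For [enorm x < 8^-1] the summand [phi (8 *: x)] is 1; elsewhere [dotp x x] is positive. *)
Lemma den_gt0 x : 0 < den x.
Proof.
case: (ltP (enorm x) (8^-1)) => hx.
  rewrite /den (phi1 hphi); first by rewrite ltr_wpDl ?dotpxx_ge0.
  rewrite enormZ ger0_norm//; lra.
rewrite ltr_wpDr ?phi_ge0// lt_neqAle dotpxx_ge0 andbT eq_sym; apply/eqP => h.
by move: hx; rewrite /enorm h sqrtr0 leNgt invr_gt0 ltr0n.
Qed.

Lemma smooth_den : smooth (fun x => (den x)%:C%C).
Proof.
rewrite (_ : (fun x => _) = fun x => \sum_(i <- index_enum 'I_n) (x 0 i)%:C%C * (x 0 i)%:C%C + (phi (8 *: x))%:C%C).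
  apply: smoothD; last exact: (smooth_scale 8 (cc_smooth (cc_phi hphi))).
  by apply: smooth_sum => i; apply: smoothM; exact: smooth_coord.
apply/funext => x; rewrite /den rmorphD; congr (_ + _).
by rewrite /dotp rmorph_sum; apply: eq_bigr => i _; rewrite rmorphM.
Qed.

(** The symbol [i x_i / |x| ^ 2] that inverts the gradient, regularized at the origin by [den] and
    cut off by [phi (2^-1 *: x)]. The cutoff is 1 for [enorm x < 4], hence on the region
    [1 <= enorm x < 3] of a rescaled piece, and its compact support makes the kernel integrable. *)
Definition mu i : V -> R[i] := fun x => (ii * (x 0 i)%:C%C * ((den x)^-1)%:C%C) * (phi (2^-1 *: x))%:C%C.

Lemma cc_mu i : cc (mu i).
Proof.
have h2 : 0 < 2^-1 :> R by rewrite invr_gt0.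
apply: cc_mul; last first.
  exact: (cc_scale h2 (cc_phi hphi)).
apply: smoothM; first by apply: smoothM; [exact: smooth_cst|exact: smooth_coord].
apply: smooth_inv smooth_den => x; by rewrite gt_eqF// den_gt0.
Qed.

(** The prefactor [2 ^- j] reflects the homogeneity of degree -1 of [x_i / |x| ^ 2]; it survives in
    [kL1_mt] because [kL1] ignores the dilation. *)
Definition mt j i : V -> R[i] := fun x => (2 ^- j)%:C%C * mu i (2 ^- j *: x).

Lemma cc_mt j i : cc (mt j i).
Proof. exact: (cc_mul (smooth_cst _) (cc_scale (two_pow_gt0 j) (cc_mu i))). Qed.

Lemma kL1_mt j i : kL1 (mt j i) = 2 ^- j * kL1 (mu i).
Proof.
rewrite /mt kL1Z; last exact/cc_schw/(cc_scale (two_pow_gt0 j) (cc_mu i)).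
by rewrite (kL1_scale (two_pow_gt0 j) (cc_schw (cc_mu i))) cmod_real gtr0_norm// two_pow_gt0.
Qed.

Lemma gradient_term j i x (z : R[i]) (D : R) : ((-1)%:C%C * ii) * (x 0 i)%:C%C *
    (z * ((2 ^- j)%:C%C * (ii * ((2 ^- j *: x) 0 i)%:C%C * D%:C%C * 1%:C%C))) =
  (((2 ^- j *: x) 0 i * (2 ^- j *: x) 0 i) * D)%:C%C * z.
Proof.
rewrite !mxE; have i2 : ii * ii = -1 :> R[i] by apply: cplx_eq; rewrite /= ?cReM ?cImM /=; ring.
transitivity ((-1)%:C%C * (ii * ii) * ((x 0 i)%:C%C * (2 ^- j)%:C%C * ((2 ^- j * x 0 i)%:C%C) * D%:C%C) * z).
  rewrite /GRing.one /=; move: (x 0 i)%:C%C (2 ^- j)%:C%C (2 ^- j * x 0 i)%:C%C D%:C%C ((-1)%:C)%C => a b c d e.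
  by rewrite rmorph1; ring.
rewrite i2 rmorphN1 mulrNN mulr1 mul1r -!rmorphM; congr (_%:C%C * _); ring.
Qed.

(** Where [P j] does not vanish, [y = 2 ^- j *: x] satisfies [1 <= enorm y < 3]; there [mu] is the
    exact symbol, and its products with [- i x_i] add up to [dotp y y / dotp y y = 1]. *)
Lemma P_gradient j : (0 < j)%N ->
  P j = fun x => \sum_(i <- index_enum 'I_n) mulxi i (fun x => P j x * mt j i x) x.
Proof.
move=> j0; apply/funext => x.
have [Pz|Pnz] := eqVneq (P j x) 0.
  by rewrite Pz big1// => i _; rewrite /mulxi Pz mul0r mulr0.
set y := 2 ^- j *: x.
have ey : enorm y = 2 ^- j * enorm x by exact: enorm_two.
have h1 : 1 <= enorm y.
  rewrite leNgt; apply: contra Pnz; rewrite ey mulrC ltr_pdivrMr ?exprn_gt0// mul1r => h.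
  by rewrite (P_eq0_near hphi j0 h).
have h3 : enorm y < 3.
  rewrite ltNge; apply: contra Pnz; rewrite ey mulrC ler_pdivlMr ?exprn_gt0// => h.
  by rewrite (P_eq0_far hphi h).
have p1 : phi (2^-1 *: y) = 1.
  by apply: (phi1 hphi); rewrite enormZ ger0_norm ?invr_ge0//; lra.
have p0 : phi (8 *: y) = 0.
  by apply: (phi0 hphi); rewrite enormZ ger0_norm//; lra.
have dE : den y = dotp y y by rewrite /den p0 addr0.
have d0 : dotp y y != 0 by rewrite -dE gt_eqF ?den_gt0.
transitivity (\sum_(i <- index_enum 'I_n) ((y 0 i * y 0 i) * (dotp y y)^-1)%:C%C * P j x); last first.
  by apply: eq_bigr => i _; rewrite /mulxi /mt /mu -/y dE p1 gradient_term.
rewrite -mulr_suml -rmorph_sum -mulr_suml mulfV//.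
by rewrite rmorph1 mul1r.
Qed.

Lemma stemp_Tm_sum (I : Type) u (m : I -> V -> R[i]) (l : seq I) psi : stemp u -> (forall i, cc (m i)) -> schw psi ->
  u (Tm (fun x => \sum_(i <- l) m i x) psi) = \sum_(i <- l) u (Tm (m i) psi).
Proof.
move=> su cm hp; have cs l' : cc (fun x => \sum_(i <- l') m i x).
  elim: l' => [|i l' IH].
    rewrite (_ : (fun x => _) = fun=> 0); last by apply/funext => x; rewrite big_nil.
    by split; [exact: smooth_cst|exists 0].
  rewrite (_ : (fun x => _) = fun x => m i x + \sum_(i <- l') m i x); last by apply/funext => x; rewrite big_cons.
  exact: cc_add.
elim: l => [|i l IH].
  rewrite big_nil Tm0; first exact: stemp0.
  by move=> x; rewrite big_nil.
rewrite big_cons -IH; have t1 := cc_tame (cm i); have t2 := cc_tame (cs l).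
rewrite -(stempD su (schw_Tm t1 hp) (schw_Tm t2 hp)); congr u.
transitivity (Tm (fun x => 1 * m i x + \sum_(i <- l) m i x) psi).
  by congr (Tm _ psi); apply/funext => x; rewrite big_cons mul1r.
by rewrite (Tm_lin 1 t1 t2 hp); apply/funext => x; rewrite mul1r.
Qed.

(** The factor -1 comes from transposing the derivative in [w i psi = - v (pd i psi)]. *)
Lemma P_derivative j v (w : 'I_n -> functional R n) psi : (0 < j)%N -> stemp v ->
  (forall i psi, schw psi -> w i psi = - v (pd i psi)) -> schw psi ->
  v (Tm (P j) psi) = \sum_(i <- index_enum 'I_n) (-1) * w i (Tm (P j) (Tm (mt j i) psi)).
Proof.
move=> j0 sv hw hp; rewrite {1}(P_gradient j0).
have ccm i : cc (fun x => P j x * mt j i x) := cc_mul (cc_smooth (cc_P hphi j)) (cc_mt j i).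
rewrite (stemp_Tm_sum _ sv (fun i => cc_mulxi i (ccm i)) hp); apply: eq_bigr => i _.
have tm := cc_tame (ccm i).
rewrite (Tm_comp _ (cc_tame (cc_mt j i)) hp) (hw i _ (schw_Tm tm hp)) (pd_Tm i tm hp).
by rewrite mulN1r opprK.
Qed.

End inverse_gradient.

(** * The theorem *)

Section tail.
Context {R : realType} {n : nat}.
Local Notation V := 'rV[R]_n.
Variable phi : V -> R.
Variables (p q s : R) (r : \bar R).
Hypothesis hphi : LP_generator phi.
Hypothesis q1 : 1 < q.
Hypothesis qp : q <= p.
Hypothesis r1 : (1 <= r)%E.
Implicit Types (h m psi : V -> R[i]) (f u v w : functional R n) (A B K T : R).
Local Notation mrep := (@mrep R n p q).
Local Notation mor := (@mor R n p q).
Local Notation P := (P phi).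
Local Notation Phi := (Phi phi).
Local Notation TLMn := (TLM_norm phi p q r s).
Local Notation wgt := (wgt s).
Local Notation wcm := (@wcm R n s).
Local Notation lrw := (@lrw R n s r).

Lemma TLM_finite u : (TLMn u < +oo)%E -> exists B : R, (TLMn u < B%:E)%E.
Proof.
move=> hu; move: hu (TLM_norm_ge0 phi p q s r u); case: (TLMn u) => [t| |]// _ _.
by exists (t + 1); rewrite lte_fin ltrDl.
Qed.

(** A gain of [2 ^- j] over the size [(wgt j)^-1] that [TLM_data] gives. The index 0 is excluded, as
    [P_gradient] concerns pieces that vanish near the origin. *)
Definition decay T (vj : nat -> V -> R[i]) v := 0 <= T /\ forall j, (0 < j)%N ->
  mrep (T * (2 ^- j * (wgt j)^-1)) (vj j) (fun psi => v (Tm (P j) psi)).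

Lemma decay_piece j i B g w : mrep ((wgt j)^-1 * B) g (fun psi => w (Tm (P j) psi)) ->
  mrep (2 * (kL1 (mu phi i) + 1) * B * (2 ^- j * (wgt j)^-1))
    (fun x => (-1) * convk g (ker (mt phi j i)) x) (fun psi => (-1) * w (Tm (P j) (Tm (mt phi j i) psi))).
Proof.
move=> hg.
have K0 : 0 < 2 ^- j * (kL1 (mu phi i) + 1) by rewrite mulr_gt0 ?two_pow_gt0// ltr_wpDl ?kL1_ge0.
have hK : kL1 (mt phi j i) <= 2 ^- j * (kL1 (mu phi i) + 1).
  by rewrite kL1_mt// ler_wpM2l ?(ltW (two_pow_gt0 _))// lerDl.
have := mrepZ q1 qp (-1) (mrep_conv q1 qp hg (cc_mt hphi j i) K0 hK).
rewrite cmodN (_ : cmod 1 = 1); last by rewrite -(rmorph1 (real_complex R)) cmod_real normr1.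
rewrite mul1r; apply: (mrep_le q1).
by rewrite le_eqVlt; apply/orP; left; apply/eqP; ring.
Qed.

Lemma smooth_decay v : TLM_smooth phi p q r s v -> exists T vj, decay T vj v.
Proof.
move=> [[/tempered_stemp sv _] [f [sf rf hf]]].
have /choice[w hw] : forall i : 'I_n, exists w : functional R n,
    [/\ stemp w, (TLMn w < +oo)%E & represents (pd i f) w].
  (* [pd i] is [mderiv] for the multi-index with a single 1 at [i], which counts the letters of the
     word [[:: i]]. *)
  move=> i; have [w [/tempered_stemp sw fw] rw] := hf (fun k => count_mem k [:: i]).
  by exists w; split => //; rewrite -(dw_mderiv [:: i] sf) in rw.
have /choice[B hB] : forall i : 'I_n, exists B : R, (TLMn (w i) < B%:E)%E.
  by move=> i; have [_ h _] := hw i; exact: TLM_finite.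
have /choice[g hg] : forall i : 'I_n, exists g : nat -> V -> R[i], forall j,
    mrep ((wgt j)^-1 * B i) (g j) (fun psi => w i (Tm (P j) psi)).
  move=> i; have [sw _ _] := hw i.
  by have [g [_ h _]] := TLM_data hphi q1 qp r1 sw (hB i); exists g.
have [T T0 hT] := @mrep_sum R n p q q1 qp _ (fun i => 2 * (kL1 (mu phi i) + 1) * B i) (index_enum 'I_n).
exists T, (fun j x => \sum_(i <- index_enum 'I_n) (-1) * convk (g i j) (ker (mt phi j i)) x).
split => // j j0.
have X0 : 0 <= 2 ^- j * (wgt j)^-1 by rewrite mulr_ge0 ?invr_ge0 ?wgt_ge0 ?exprn_ge0.
apply: mrep_ext (hT _ _ _ X0 (fun i => decay_piece i (hg i j))) => psi hp /=.
symmetry; apply: (P_derivative hphi j0 sv _ hp) => i psi' hp'.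
by have [sw _ rw] := hw i; exact: (derivative_rep hphi sv sw sf rf rw).
Qed.

Lemma tail_functional f N psi : stemp f -> schw psi ->
  (f - \sum_(0 <= j < N.+1) multiplier (phi_ phi j) f)%R psi = f psi - f (Tm (Phi N) psi).
Proof.
move=> sf hp; rewrite -(sum_P hphi N sf hp).
transitivity (f psi - (\sum_(0 <= j < N.+1) multiplier (phi_ phi j) f)%R psi); first by [].
congr (_ - _); elim: (N.+1) => [|k IH]; first by rewrite !big_geq.
rewrite !big_nat_recr//= -IH -multiplierE; by [].
Qed.

Lemma split_functional (f v : functional R n) psi : (f - v)%R psi = f psi - v psi.
Proof. by []. Qed.

Lemma mor_piece A (c : R) h : 0 <= c -> cm h -> 0 <= A -> mor A (fun x => (cmod (h x))%:E) ->
  mor (c * A) (fun x => (c * cmod (h x))%:E).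
Proof.
move=> c0 mh A0 hA.
have h0 (y : V) : (0 <= (cmod (h y))%:E)%E by rewrite lee_fin cmod_ge0.
exact: (morZ A0 c0 (cmodEm mh) h0 hA).
Qed.

Lemma sub_sub_cancel (a b c : R[i]) : b - c = (a - c) - (a - b).
Proof. by ring. Qed.

Lemma one_le_const K : 0 <= K -> 1 <= 2 * (4 * (1 + 8 * K)).
Proof. by move=> K0; lra. Qed.

Lemma Tm_comm m m' psi : cc m -> cc m' -> schw psi -> Tm m' (Tm m psi) = Tm m (Tm m' psi).
Proof.
move=> hm hm' hp; rewrite (Tm_comp m' (cc_tame hm) hp) (Tm_comp m (cc_tame hm') hp).
apply: (congr1 (fun m => Tm m psi)); apply/funext => x; exact: mulrC.
Qed.

(** [f] is recovered as [(f - v) + v] before [Phi N] is applied, so both sizes enter. The piece of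
    [f - v] itself is left out, since [tail_estimate] adds it under the [l^r] norm. Here [8 * K] is
    the 4 of [mrep_add] times the [2 * K] of [mrep_conv]. *)
Lemma mid_piece f v d vj (N j : nat) eps T : stemp f -> 0 <= eps -> 0 <= T ->
  mrep ((wgt j)^-1 * eps) d (fun psi => (f - v)%R (Tm (P j) psi)) ->
  mrep (T * (2 ^- j * (wgt j)^-1)) vj (fun psi => v (Tm (P j) psi)) ->
  mrep ((wgt j)^-1 * (4 * (1 + 8 * (kL1 (fun x => (phi x)%:C%C) + 1)) * (eps + T * 2 ^- j)))
    (fun x => vj x + (-1) * convk (fun x => d x + vj x) (ker (Phi N)) x)
    (fun psi => v (Tm (P j) psi) - f (Tm (Phi N) (Tm (P j) psi))).
Proof.
move=> sf e0 T0 hd hv; set K := kL1 _ + 1.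
have K0 : 0 < K by rewrite ltr_wpDl ?kL1_ge0.
have hK : kL1 (Phi N) <= K by rewrite (kL1_Phi hphi) lerDl.
have hF : mrep (4 * ((wgt j)^-1 * eps + T * (2 ^- j * (wgt j)^-1))) (fun x => d x + vj x) (fun psi => f (Tm (P j) psi)).
  apply: mrep_ext (mrep_add q1 qp hd hv) => psi hp.
  by rewrite split_functional subrK.
have cF := cc_Phi hphi N.
have := mrepZ q1 qp (-1) (mrep_conv q1 qp hF cF K0 hK).
rewrite cmodN (_ : cmod 1 = 1); last by rewrite -(rmorph1 (real_complex R)) cmod_real normr1.
rewrite mul1r => /(mrep_add q1 qp hv).
have iw : 0 <= (wgt j)^-1 by rewrite invr_ge0 wgt_ge0.
have tj : 0 <= T * 2 ^- j by rewrite mulr_ge0// ltW// two_pow_gt0.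
move=> h; apply: (mrep_ext _ (mrep_le q1 _ h)) => [psi hp|].
  by rewrite (Tm_comm cF (cc_P hphi j) hp) mulN1r.
have -> : 4 * (T * (2 ^- j * (wgt j)^-1) + 2 * K * (4 * ((wgt j)^-1 * eps + T * (2 ^- j * (wgt j)^-1)))) =
  (wgt j)^-1 * (4 * (T * 2 ^- j + 8 * K * (eps + T * 2 ^- j))) by ring.
apply: (ler_wpM2l iw); rewrite -[X in _ <= X]mulrA; apply: ler_wpM2l => //.
rewrite [X in _ <= X]mulrDl mul1r lerD2r.
by rewrite lerDr.
Qed.

(** The pieces [d] of [f - v] have no decay beyond the weight and are kept together, with their
    [l^r] bound [eps]. The remainder [b] starts at [N] and decays geometrically, so [mor_lr] handles
    it with the factor 12. The factor 16 is the 4 of [lr_add] times the 4 of [mor_add]. *)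
Lemma tail_estimate f v eps T vj (N : nat) : stemp f -> stemp v -> decay T vj v ->
  (TLMn (f - v)%R < eps%:E)%E -> (0 < N)%N ->
  (TLMn (f - \sum_(0 <= j < N.+1) multiplier (phi_ phi j) f)%R <=
   (16 * (eps + 12 * (8 * (1 + 8 * (kL1 (fun x => (phi x)%:C%C) + 1)) * (eps + T * 2 ^- N))))%:E)%E.
Proof.
move=> sf sv [T0 hv] hfv N0.
have sfv : stemp (f - v)%R by exact: stemp_sub.
have [d [e0 hd hld]] := TLM_data hphi q1 qp r1 sfv hfv.
set K := kL1 _ + 1; have K0 : 0 <= K by rewrite addr_ge0 ?kL1_ge0.
pose C1 := 4 * (1 + 8 * K); have C10 : 0 <= C1 by rewrite mulr_ge0// addr_ge0// mulr_ge0.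
(* The factor 2 offsets the decay [2^-1] that [mor_lr] demands at [j = N.+1]: both middle pieces are
   estimated by the same bound. *)
pose tau := 2 * C1 * (eps + T * 2 ^- N).
have tN : 0 <= T * 2 ^- N by rewrite mulr_ge0// ltW// two_pow_gt0.
have tau0 : 0 <= tau by rewrite mulr_ge0 ?addr_ge0// mulr_ge0.
have -> : 16 * (eps + 12 * (8 * (1 + 8 * K) * (eps + T * 2 ^- N))) = 16 * (eps + 12 * tau) by rewrite /tau /C1; ring.
(* What the tail has in addition to [f - v]: at [N] and [N.+1] the piece of [v] minus that of
   [Phi N (D) f], and beyond them the piece of [v] alone, by [Phi_P_high]. *)
pose b (j : nat) : V -> R[i] := if (j < N)%N then fun=> 0 else
  if (j < N.+2)%N then fun x => vj j x + (-1) * convk (fun x => d j x + vj j x) (ker (Phi N)) x else vj j.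
pose d' (j : nat) : V -> R[i] := if (j < N)%N then fun=> 0 else d j.
pose g (j : nat) : V -> R[i] := fun x => d' j x + b j x.
pose E := (f - \sum_(0 <= j < N.+1) multiplier (phi_ phi j) f)%R.
have EE psi j : schw psi -> E (Tm (P j) psi) = f (Tm (P j) psi) - f (Tm (Phi N) (Tm (P j) psi)).
  by move=> hp; apply: tail_functional => //; exact: (schw_Tm (cc_tame (cc_P hphi j)) hp).
have low psi j : (j < N)%N -> schw psi -> E (Tm (P j) psi) = 0.
  by move=> jN hp; rewrite EE// (Tm_comp _ (cc_tame (cc_P hphi j)) hp) (Phi_P_low hphi jN) subrr.
have high psi j : (N.+2 <= j)%N -> schw psi -> E (Tm (P j) psi) = f (Tm (P j) psi).
  move=> Nj hp; rewrite EE// (Tm_comp _ (cc_tame (cc_P hphi j)) hp) (Tm0 _ (fun x => Phi_P_high hphi x Nj)).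
  by rewrite (stemp0 sf) subr0.
have iw j : 0 <= (wgt j)^-1 by rewrite invr_ge0 wgt_ge0.
have half j : (N <= j)%N -> 2 ^- j = 2 ^- N * 2^-1 ^+ (j - N) :> R.
  by move=> Nj; rewrite exprVn -invfM -exprD subnKC.
have pow_le j : (N <= j)%N -> T * 2 ^- j <= T * 2 ^- N.
  by move=> Nj; rewrite ler_wpM2l// lef_pV2 ?posrE ?exprn_gt0// two_pow_le.
have hb j : (N <= j)%N -> exists Hj, mrep ((wgt j)^-1 * (tau * 2^-1 ^+ (j - N))) (b j) Hj /\
    forall psi, schw psi -> Hj psi = E (Tm (P j) psi) - (f - v)%R (Tm (P j) psi).
  move=> Nj; have hvj := hv j (leq_trans N0 Nj).
  rewrite /b ltnNge Nj /=; case: ltnP => j2.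
    exists (fun psi => v (Tm (P j) psi) - f (Tm (Phi N) (Tm (P j) psi))); split.
      apply: (mrep_le q1 _ (mid_piece N sf e0 T0 (hd j) hvj)); rewrite ler_wpM2l//.
      apply: (@le_trans _ _ (C1 * (eps + T * 2 ^- N))).
        by apply: (ler_wpM2l C10); rewrite lerD2l pow_le.
      rewrite /tau (_ : 2 * C1 * _ * _ = C1 * (eps + T * 2 ^- N) * (2 * 2^-1 ^+ (j - N))); last by ring.
      apply: ler_peMr; first by rewrite mulr_ge0 ?addr_ge0.
      have jN1 : (j - N <= 1)%N by rewrite leq_subLR addn1.
      case: (j - N)%N jN1 => [|[|//]] _; first by rewrite expr0 mulr1 ler1n.
      by rewrite expr1 mulfV.
    by move=> psi hp; rewrite (EE _ _ hp) split_functional; exact: sub_sub_cancel.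
  exists (fun psi => v (Tm (P j) psi)); split.
    apply: (mrep_le q1 _ hvj).
    rewrite mulrA [X in X <= _]mulrC ler_wpM2l// (half j Nj) mulrA ler_wpM2r ?exprn_ge0 ?invr_ge0//.
    rewrite /tau -[X in X <= _]mul1r; apply: ler_pM => //; last by rewrite lerDr.
    exact: one_le_const K0.
  by move=> psi hp; rewrite (high _ _ j2 hp) split_functional subKr.
have hg j : exists A, mrep A (g j) (fun psi => E (Tm (P j) psi)).
  case: (ltnP j N) => jN.
    exists 0; rewrite /g /d' /b jN (_ : (fun x : V => _) = fun=> 0); last by apply/funext => x; rewrite addr0.
    apply: (@mrep0 R n p q q1) => [|psi hp]; [exact: lexx|exact: low].
  have [Hj [h1 h2]] := hb j jN.
  exists (4 * ((wgt j)^-1 * eps + (wgt j)^-1 * (tau * 2^-1 ^+ (j - N)))).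
  have -> : g j = fun x => d j x + b j x by rewrite /g /d' ltnNge jN.
  by apply: mrep_ext (mrep_add q1 qp (hd j) h1) => psi hp; rewrite (h2 _ hp); exact: subrKC.
have {hg} /choice[A hg] := hg.
have mg j : cm (g j) by have [] := hg j.
have mb j : cm (b j).
  case: (ltnP j N) => jN; first by rewrite /b jN; exact: cm_cst.
  by have [Hj [[]]] := hb j jN.
have md j : cm (d j) by have [] := hd j.
have hlb : mor (12 * tau) (lrw b).
  apply: (mor_lr q1 (N := N)) => //.
  - by move=> j x; exact: wcm_ge0.
  - by move=> j; exact: measurable_wcm.
  - by move=> j x jN; rewrite /wcm /b jN cmod0 mulr0.
  - move=> j jN; have [Hj [[mbj B0 hbj _] _]] := hb j jN.
    have := mor_piece (wgt_ge0 s j) mbj B0 hbj.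
    by rewrite mulrA mulfV ?mul1r// gt_eqF ?wgt_gt0.
have t12 : 0 <= 12 * tau by rewrite mulr_ge0.
have l0 (a : nat -> V -> R[i]) x : (0 <= lrw a x)%E by exact: lrw_ge0.
have ml (a : nat -> V -> R[i]) : (forall j, cm (a j)) -> measurable_fun setT (lrw a) by exact: measurable_lrw.
have hsum := mor_add q1 e0 t12 (ml _ md) (ml _ mb) (l0 d) (l0 b) hld hlb.
have msum : measurable_fun setT (fun x => (lrw d x + lrw b x)%E) by apply: emeasurable_funD; exact: ml.
have sum0 x : (0 <= lrw d x + lrw b x)%E by rewrite adde_ge0.
have e12 : 0 <= 4 * (eps + 12 * tau) by rewrite mulr_ge0// addr_ge0.
have h4 := morZ e12 (ler0n R 4) msum sum0 hsum.
have hlg : mor (16 * (eps + 12 * tau)) (lrw g).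
  rewrite (_ : 16 * (eps + 12 * tau) = 4 * (4 * (eps + 12 * tau))); last by ring.
  apply: (mor_mono q1 (ml _ mg) _ (l0 g) _ h4); first exact: emeasurable_funM.
  move=> x; apply: le_trans (lr_add r1 (fun j => wcm_ge0 s d j x) (fun j => wcm_ge0 s b j x)).
  apply: lr_mono => // [j|j _]; first exact: wcm_ge0.
  rewrite /wcm -mulrDr ler_wpM2l ?wgt_ge0//.
  (* Dropping the pieces of [d] below [N] only lowers the norm. *)
  apply: le_trans (cmodD _ _) _; rewrite lerD2r /d'; case: ifP => // _.
  by rewrite cmod0 cmod_ge0.
(* [0 < N] puts the zeroth piece among those that vanish. *)
have h0 : mor 0 (fun x => (cmod (g 0%N x))%:E).
  by apply: (@mor0 R n p q q1) => // x; rewrite /g /d' /b N0 addr0 cmod0.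
rewrite -[16 * _]add0r; apply: (TLM_norm_le q1 qp r1 _ _ hg h0 hlg) => //.
by rewrite mulr_ge0// addr_ge0.
Qed.

End tail.

Lemma cvge0P {R : realType} (u : nat -> \bar R) : (forall N, 0 <= u N)%E ->
  (u @ \oo --> 0%E <-> forall eps : R, 0 < eps -> exists N0, forall N, (N0 <= N)%N -> (u N < eps%:E)%E).
Proof.
move=> u0; split=> [/fine_cvgP[ufin uc] eps e0|h].
  have [N1 _ h1] := ufin; have /cvgrPdist_lt/(_ eps e0)[N2 _ h2] := uc.
  exists (maxn N1 N2) => N; rewrite geq_max => /andP[/h1 f1 /h2].
  rewrite sub0r normrN /= => h; rewrite -(fineK f1) lte_fin.
  exact: le_lt_trans (ler_norm _) h.
have fin (N : nat) (eps : R) : (u N < eps%:E)%E -> u N \is a fin_num.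
  by move=> hN; rewrite ge0_fin_numE// (lt_trans hN)// ltry.
apply/fine_cvgP; split.
  (* Convergence in the extended reals also demands that the terms be eventually finite, which
     [eps = 1] provides. *)
  by have [N0 hN0] := h 1 ltr01; exists N0 => // N /= /hN0 /fin.
apply/cvgrPdist_lt => eps e0; have [N0 hN0] := h eps e0.
exists N0 => // N /= /hN0 hN; rewrite sub0r normrN ger0_norm ?fine_ge0//.
by rewrite -lte_fin fineK// (fin _ _ hN).
Qed.

Lemma two_pow_small {R : realType} (T eps : R) : 0 <= T -> 0 < eps ->
  exists N0, forall N, (N0 <= N)%N -> T * 2 ^- N <= eps.
Proof.
move=> T0 e0; exists (Num.truncn (T / eps)).+1 => N hN.
rewrite ler_pdivrMr ?exprn_gt0// mulrC -ler_pdivrMr//.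
apply: (@le_trans _ _ N%:R).
  by apply: le_trans (ltW (truncnS_gt _)) _; rewrite ler_nat.
by rewrite -natrX ler_nat ltnW// ltn_expl.
Qed.

Lemma affine_bound {R : realType} (K e x : R) : 0 <= K -> x <= e ->
  16 * (e + 12 * (K * (e + x))) <= 16 * (1 + 24 * K) * e.
Proof. by move=> K0 /(ler_wpM2l K0) h; lra. Qed.

Lemma mul_half_lt {R : realType} (C e : R) : 0 < C -> 0 < e -> C * (e / (2 * C)) < e.
Proof.
move=> C0 e0; rewrite (_ : C * _ = e / 2); first by lra.
by field; rewrite gt_eqF.
Qed.

Theorem theorem1p2 (R : realType) (n : nat) (phi : 'rV[R]_n -> R)
    (p q s : R) (r : \bar R) (f : functional R n) :
  (0 < n)%N ->
  LP_generator phi ->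
  1 < q -> q <= p -> (1%:E <= r)%E ->
  TLM phi p q r s f ->
  (TLM_diamond phi p q r s f <->
   TLM_norm phi p q r s
     (f - \sum_(0 <= j < N.+1) multiplier (phi_ phi j) f) @[N --> \oo] --> 0%E).
Proof.
move=> _ hphi q1 qp r1 hf; have [/tempered_stemp sf ff] := hf.
pose E (N : nat) : functional R n := f - \sum_(0 <= j < N.+1) multiplier (phi_ phi j) f.
have E0 N : (0 <= TLM_norm phi p q r s (E N))%E by exact: TLM_norm_ge0.
split=> [[_ hd]|].
  apply/(cvge0P E0) => eta eta0.
  (* The constant of [tail_estimate] once [T * 2 ^- N <= eps]: the sum [eps + T * 2 ^- N] is then at
     most [2 * eps], which turns the factor 12 into 24. *)
  pose C : R := 16 * (1 + 24 * (8 * (1 + 8 * (kL1 (fun x => (phi x)%:C%C) + 1)))).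
  have C0 : 0 < C.
    rewrite mulr_gt0// ltr_pwDl// mulr_ge0// mulr_ge0// addr_ge0// mulr_ge0// addr_ge0//.
    exact: kL1_ge0.
  pose eps := eta / (2 * C).
  have e0 : 0 < eps by rewrite divr_gt0// mulr_gt0.
  (* The order of choices matters: [eps] fixes [v], [v] fixes [T], and only then is [N] taken so
     large that [T * 2 ^- N <= eps]. *)
  have [v hv hfv] := hd eps e0.
  have [T [vj hdec]] := smooth_decay hphi q1 qp r1 hv.
  have [[/tempered_stemp sv _] _] := hv.
  have [T0 _] := hdec.
  have [N0 hN0] := two_pow_small T0 e0.
  (* The 1 ensures the condition [0 < N] of [tail_estimate]. *)
  exists (maxn 1 N0) => N; rewrite geq_max => /andP[N1 /hN0 hN].
  apply: le_lt_trans (tail_estimate hphi q1 qp r1 sf sv hdec hfv N1) _.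
  rewrite lte_fin; apply: (@le_lt_trans _ _ (C * eps)).
    rewrite /C; set K := 8 * (1 + _); have K0 : 0 <= K.
      by rewrite /K mulr_ge0// addr_ge0// mulr_ge0// addr_ge0// kL1_ge0.
    exact: affine_bound K0 hN.
  exact: mul_half_lt.
move/(cvge0P E0) => hc; split=> // eps e0.
have [N hN] := hc eps e0.
exists (\sum_(0 <= j < N.+1) multiplier (phi_ phi j) f); last exact: hN (leqnn N).
apply: (TLM_smooth_sum hphi q1 qp r1 sf ff (N := N)) => psi hp.
(* Cancelling [f] in the formula for the tail identifies the partial sum with [Phi N (D) f] on
   Schwartz functions. *)
have := tail_functional hphi N sf hp.
by rewrite split_functional => /addrI/oppr_inj.
Qed.
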